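(* Consider the closed-loop system (CL) defined in the context, and let Assumptions A1 (plant), A2 (costs) and A3 (network), stated in the context, hold. Then there exist $\bar\alpha_1,\bar\alpha_2>0$ such that, for all $\alpha_1\in(0,\bar\alpha_1)$ and $\alpha_2\in(0,\bar\alpha_2)$: (1) for all initial conditions $(x_i(0),u_i(0),w_i(0),z_i(0))\in\mathbb{R}^{n_i}\times\mathbb{R}^{m_i}\times\mathbb{R}^d\times\mathbb{R}^d$, $i\in\{1,\dots,N\}$, with $w_i(0)=z_i(0)=0$ for all $i\in\{1,\dots,N\}$, the trajectories of (CL) are bounded and $$\lim_{t\to\infty}\left\|\begin{bmatrix} x(t) \\ u(t) \\ w(t)-\pi^w(x(t)) \\ z(t)-\pi^z(x(t))\end{bmatrix}\right\|_{\mathcal{X}}=0;$$ (2) further, given any $\bar u\in\mathbb{R}^m$ that is an isolated stationary point and a local minimum of $F_{\sigma,h}$, the point $\big(h(\bar u),\bar u,\pi^w(h(\bar u)),\pi^z(h(\bar u))\big)$ is locally asymptotically stable for the system (CL) restricted to $\mathcal{S}$.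
   Context: **Notation.** $\mathrm{col}(v_1,\dots,v_N)$ is the vertical concatenation of vectors; $\mathbf{1}:=1_N\otimes I_d\in\mathbb{R}^{Nd\times d}$, where $1_N$ is the vector of $N$ ones. For a set $Y\subseteq\mathbb{R}^q$ and $y\in\mathbb{R}^q$, $\|y\|_Y:=\inf_{y'\in Y}\|y-y'\|$. $\nabla_1 f,\nabla_2 f$ are the gradients of $f$ with respect to its first and second argument. For a vector-valued map $g:\mathbb{R}^a\to\mathbb{R}^b$ (such as $h_i$, $\phi_i$), $\nabla g(x)\in\mathbb{R}^{a\times b}$ is the transposed Jacobian. **Data.** $N$ agents; agent $i\in\{1,\dots,N\}$ has state $x_i\in\mathbb{R}^{n_i}$, input $u_i\in\mathbb{R}^{m_i}$ and dynamics $\dot x_i=p_i(x_i,u_i)$, $p_i:\mathbb{R}^{n_i}\times\mathbb{R}^{m_i}\to\mathbb{R}^{n_i}$. Let $n=\sum_i n_i$, $m=\sum_i m_i$, $x=\mathrm{col}(x_1,\dots,x_N)$, $u=\mathrm{col}(u_1,\dots,u_N)$. There are local costs $f_i:\mathbb{R}^{n_i}\times\mathbb{R}^d\to\mathbb{R}$, maps $\phi_i:\mathbb{R}^{n_i}\to\mathbb{R}^d$, and the aggregation function $\sigma(x)=\frac1N\sum_{i=1}^N\phi_i(x_i)$. With $h_i$ the maps of Assumption A1, set $h(u)=\mathrm{col}(h_1(u_1),\dots,h_N(u_N))$, $F(x,\sigma(x))=\sum_{i=1}^N f_i(x_i,\sigma(x))$ and $F_{\sigma,h}(u)=F(h(u),\sigma(h(u)))$.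 In Assumption A2, $\nabla F(x,\sigma(x))$ denotes the gradient (with respect to $x$) of the function $x\mapsto F(x,\sigma(x))$. The optimization problem is $$\min_{x\in\mathbb{R}^n,\,u\in\mathbb{R}^m}\ \sum_{i=1}^N f_i(x_i,\sigma(x))\quad\text{subject to } x_i=h_i(u_i),\ i=1,\dots,N.$$ The maps $h_i$ are differentiable. **Assumption A1 (plant).** For all $i\in\{1,\dots,N\}$ there exist $h_i:\mathbb{R}^{m_i}\to\mathbb{R}^{n_i}$ and $\delta_1,\delta_2>0$ such that, for all (constant) $\bar u_i\in\mathbb{R}^{m_i}$, $p_i(h_i(\bar u_i),\bar u_i)=0$ and the trajectories of $\dot x_i=p_i(x_i,\bar u_i)$ satisfy $\|x_i(t)-h_i(\bar u_i)\|\le\delta_1\|x_i(0)-h_i(\bar u_i)\|\exp(-\delta_2t)$ for all $x_i(0)\in\mathbb{R}^{n_i}$, $t\ge0$. Further, there exist $L_h,L_p>0$ such that $\|h_i(u_i)-h_i(u_i')\|\le L_h\|u_i-u_i'\|$, $\|p_i(x_i,u_i)-p_i(x_i',u_i)\|\le L_p\|x_i-x_i'\|$, $\|p_i(x_i,u_i)-p_i(x_i,u_i')\|\le L_p\|u_i-u_i'\|$ for all $x_i,x_i'\in\mathbb{R}^{n_i}$, $u_i,u_i'\in\mathbb{R}^{m_i}$ and all $i$. **Assumption A2 (costs).** $F_{\sigma,h}$ is radially unbounded and differentiable and there exist $L_0,L_1,L_2>0$ such that $\|\nabla F(x,\sigma(x))-\nabla F(x',\sigma(x'))\|\le L_0\|x-x'\|$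 and, for $k=1,2$, $\|\nabla_k f_i(x_i,y_i)-\nabla_k f_i(x_i',y_i')\|\le L_k\|\mathrm{col}(x_i-x_i',y_i-y_i')\|$, for all $x,x'\in\mathbb{R}^n$, $x_i,x_i'\in\mathbb{R}^{n_i}$, $y_i,y_i'\in\mathbb{R}^d$ and all $i$. The $\phi_i$ are differentiable and there exists $L_3>0$ with $\|\phi_i(x_i)-\phi_i(x_i')\|\le L_3\|x_i-x_i'\|$ for all $x_i,x_i'\in\mathbb{R}^{n_i}$ and all $i$. **Assumption A3 (network).** The agents communicate over a directed graph $\mathcal{G}=(\{1,\dots,N\},\mathcal{E})$, with in-neighbor sets $\mathcal{N}_i=\{j:(j,i)\in\mathcal{E}\}$ and weights $a_{ij}>0$ if $(j,i)\in\mathcal{E}$, $a_{ij}=0$ otherwise. $\mathcal{G}$ is strongly connected and weight-balanced, i.e. $\sum_{j=1}^N a_{ij}=\sum_{j=1}^N a_{ji}$ for all $i$. **System (CL)** (Aggregative Tracking Feedback), with parameters $\alpha_1,\alpha_2>0$ and additional states $w_i,z_i\in\mathbb{R}^d$: for $i=1,\dots,N$, $$\dot x_i=p_i(x_i,u_i),$$ $$\dot u_i=-\alpha_1\nabla h_i(u_i)\Big(\nabla_1f_i(x_i,w_i+\phi_i(x_i))+\nabla\phi_i(x_i)\big(z_i+\nabla_2f_i(x_i,w_i+\phi_i(x_i))\big)\Big),$$ $$\dot w_i=-\frac1{\alpha_2}\sum_{j\in\mathcal{N}_i}a_{ij}\big(w_i+\phi_i(x_i)-w_j-\phi_j(x_j)\big),$$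 $$\dot z_i=-\frac1{\alpha_2}\sum_{j\in\mathcal{N}_i}a_{ij}\big(z_i+\nabla_2f_i(x_i,w_i+\phi_i(x_i))-z_j-\nabla_2f_j(x_j,w_j+\phi_j(x_j))\big).$$ Put $w=\mathrm{col}(w_1,\dots,w_N)$, $z=\mathrm{col}(z_1,\dots,z_N)$. **Sets and maps.** $\mathcal{S}:=\{(x,u,w,z)\in\mathbb{R}^{n+m+2Nd}:\mathbf{1}^\top w=0,\ \mathbf{1}^\top z=0\}$. $X\subset\mathbb{R}^n\times\mathbb{R}^m$ is the set of stationary points of the optimization problem, i.e. $X=\{(x,u):x=h(u),\ \nabla F_{\sigma,h}(u)=0\}$. $\mathcal{X}:=\{(x,u,w,z)\in\mathbb{R}^{n+m+2Nd}:(x,u)\in X,\ w=0,\ z=0\}$. The maps $\pi^w,\pi^z:\mathbb{R}^n\to\mathbb{R}^{Nd}$ have $i$-th blocks $\pi^w_i(x)=-\phi_i(x_i)+\sigma(x)$ and $\pi^z_i(x)=-\nabla_2f_i(x_i,\sigma(x))+\frac1N\sum_{j=1}^N\nabla_2f_j(x_j,\sigma(x))$.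
   Formalization: The maps h_i are assumed continuously differentiable, not merely differentiable; with h_i only differentiable the claim is false, since a trajectory can stall at a non-stationary point where the derivative of h_i is discontinuous. *)

(* Defs.v *)
From HB Require Import structures.
From mathcomp Require Import all_boot all_order all_algebra.
From mathcomp Require Import all_classical all_reals all_analysis.

Set Implicit Arguments.
Unset Strict Implicit.
Unset Printing Implicit Defensive.

Import Order.TTheory GRing.Theory Num.Theory.
Import numFieldNormedType.Exports.

Local Open Scope classical_set_scope.
Local Open Scope ring_scope.

(* Vectors are row vectors, and R^(q_1 + ... + q_N) is 'rV_(\sum_i q_ i), with
   i-th block [submxrow x i] and stacking [\mxrow_i].  A column-vector product
   M v thus reads v *m M^T. *)

Section euclidean.
Variable R : realType.

(* The library norm on matrices is the max norm. *)
Definition enorm k (v : 'rV[R]_k) : R := Num.sqrt (\sum_j v 0 j ^+ 2).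

Definition grad k (g : 'rV[R]_k -> R) (x : 'rV[R]_k) : 'rV[R]_k :=
  \row_j 'D_(delta_mx 0 j) g x.

(* For g : R^a -> R^b, [jacobian g x] acts on row vectors by right
   multiplication; it is a x b, the transpose of the usual Jacobian. *)
Definition nabla a b (g : 'rV[R]_a -> 'rV[R]_b) (x : 'rV[R]_a) : 'M[R]_(a, b) :=
  jacobian g x.

Definition radially_unbounded k (g : 'rV[R]_k -> R) : Prop :=
  forall M : R, exists r : R, forall x, r <= enorm x -> M <= g x.

End euclidean.

Section ode.
Variables (R : realType) (V : normedModType R).

(* [0, T[, where T may be +oo *)
Definition time_domain (T : \bar R) : set R :=
  [set t | 0 <= t /\ (t%:E < T)%E].

(* A trajectory of s' = g(s) on [0, T[.  At t = 0 only continuity is required,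
   so that s may take arbitrary values at negative times. *)
Definition trajectory (g : V -> V) (T : \bar R) (s : R -> V) : Prop :=
  [/\ (0 < T)%E,
      {within time_domain T, continuous s} &
      forall t, 0 < t -> (t%:E < T)%E -> is_derive t (1 : R) s (g (s t))].

(* S is meant to be forward invariant, so restricting the system to S amounts
   to restricting the initial conditions.  The notion depends only on the
   topology of V, not on the norm. *)
Definition locally_asymptotically_stable_on
    (S : set V) (g : V -> V) (e : V) : Prop :=
  [/\ S e, g e = 0,
      forall eps : R, 0 < eps -> exists2 delta : R, 0 < delta &
        forall (T : \bar R) (s : R -> V),
          trajectory g T s -> S (s 0) -> `|s 0 - e| < delta ->
          forall t, time_domain T t -> `|s t - e| < eps &
      exists2 delta : R, 0 < delta &
        forall s : R -> V,
          trajectory g +oo%E s -> S (s 0) -> `|s 0 - e| < delta ->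
          s t @[t --> +oo] --> e].

End ode.

Section aggregative.
Variables (R : realType) (N d : nat) (n m : 'I_N -> nat).
Variable p : forall i, 'rV[R]_(n i) -> 'rV[R]_(m i) -> 'rV[R]_(n i).
Variable h : forall i, 'rV[R]_(m i) -> 'rV[R]_(n i).
Variable f : forall i, 'rV[R]_(n i) -> 'rV[R]_d -> R.
Variable phi : forall i, 'rV[R]_(n i) -> 'rV[R]_d.
Variable E : rel 'I_N.
Variable a : 'I_N -> 'I_N -> R.

Local Notation Rn := 'rV[R]_(\sum_i n i).
Local Notation Rm := 'rV[R]_(\sum_i m i).
Local Notation RNd := 'rV[R]_(\sum_(i < N) d).

Definition sigma (x : Rn) : 'rV[R]_d :=
  N%:R^-1 *: \sum_i phi (submxrow x i).

Definition hstack (u : Rm) : Rn := \mxrow_i h (submxrow u i).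

Definition Fcost (x : Rn) (y : 'rV[R]_d) : R := \sum_i f (submxrow x i) y.

Definition Fsigma (x : Rn) : R := Fcost x (sigma x).

Definition Fsigmah (u : Rm) : R := Fsigma (hstack u).

Definition grad1 i (x : 'rV[R]_(n i)) (y : 'rV[R]_d) : 'rV[R]_(n i) :=
  grad (fun x' => f x' y) x.

Definition grad2 i (x : 'rV[R]_(n i)) (y : 'rV[R]_d) : 'rV[R]_d :=
  grad (f x) y.

Definition plant_assumption : Prop :=
  (forall i, exists delta1 delta2 : R, [/\ 0 < delta1, 0 < delta2 &
     forall ubar : 'rV[R]_(m i),
       p (h ubar) ubar = 0 /\
       forall x : R -> 'rV[R]_(n i),
         trajectory (fun x' => p x' ubar) +oo%E x ->
         forall t, 0 <= t ->
           enorm (x t - h ubar)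
             <= delta1 * enorm (x 0 - h ubar) * expR (- delta2 * t)]) /\
  (exists Lh Lp : R, [/\ 0 < Lh, 0 < Lp &
     forall i (x x' : 'rV[R]_(n i)) (u u' : 'rV[R]_(m i)),
       [/\ enorm (h u - h u') <= Lh * enorm (u - u'),
           enorm (p x u - p x' u) <= Lp * enorm (x - x') &
           enorm (p x u - p x u') <= Lp * enorm (u - u')]]).

(* Continuity of the Jacobians is needed: if the h_i are merely differentiable,
   a trajectory may converge to a non-stationary point. *)
Definition steady_state_C1 : Prop :=
  forall i, (forall u : 'rV[R]_(m i), differentiable (@h i) u) /\
            continuous (nabla (@h i)).

Definition cost_assumption : Prop :=
  [/\ radially_unbounded Fsigmah,
      forall u, differentiable Fsigmah u,
      forall i (xy : 'rV[R]_(n i) * 'rV[R]_d),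
        differentiable (fun xy' : 'rV[R]_(n i) * 'rV[R]_d => f xy'.1 xy'.2) xy,
      exists L0 L1 L2 : R,
        [/\ 0 < L0, 0 < L1, 0 < L2,
            forall x x' : Rn,
              enorm (grad Fsigma x - grad Fsigma x') <= L0 * enorm (x - x') &
            forall i (x x' : 'rV[R]_(n i)) (y y' : 'rV[R]_d),
              enorm (grad1 x y - grad1 x' y')
                <= L1 * enorm (row_mx (x - x') (y - y')) /\
              enorm (grad2 x y - grad2 x' y')
                <= L2 * enorm (row_mx (x - x') (y - y'))] &
      (forall i (x : 'rV[R]_(n i)), differentiable (@phi i) x) /\
      exists2 L3 : R, 0 < L3 &
        forall i (x x' : 'rV[R]_(n i)),
          enorm (phi x - phi x') <= L3 * enorm (x - x')].

(* [E j i] is the edge (j, i), along which agent i receives from agent j. *)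
Definition network_assumption : Prop :=
  [/\ forall i j, (E j i -> 0 < a i j) /\ (~~ E j i -> a i j = 0),
      forall i j, connect E i j &
      forall i, \sum_j a i j = \sum_j a j i].

(* (x, u, w, z) *)
Definition state : Type := (Rn * Rm * RNd * RNd)%type.

Definition closed_loop (alpha1 alpha2 : R) (s : state) : state :=
  let: (x, u, w, z) := s in
  let xi i := submxrow x i in
  let ui i := submxrow u i in
  let wi i : 'rV[R]_d := submxrow w i in
  let zi i : 'rV[R]_d := submxrow z i in
  let y i := wi i + phi (xi i) in
  let v i := zi i + grad2 (xi i) (y i) in
  (\mxrow_i p (xi i) (ui i),
   \mxrow_i - (alpha1 *: ((grad1 (xi i) (y i)
                           + v i *m (nabla (@phi i) (xi i))^T)
                          *m (nabla (@h i) (ui i))^T)),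
   \mxrow_i - (alpha2^-1 *: \sum_(j | E j i) a i j *: (y i - y j)),
   \mxrow_i - (alpha2^-1 *: \sum_(j | E j i) a i j *: (v i - v j))).

Definition zero_mean_states : set state :=
  [set s | let: (_, _, w, z) := s in
     \sum_i (submxrow w i : 'rV[R]_d) = 0 /\
     \sum_i (submxrow z i : 'rV[R]_d) = 0].

Definition stationary : set (Rn * Rm) :=
  [set xu | xu.1 = hstack xu.2 /\ grad Fsigmah xu.2 = 0].

Definition target : set state :=
  [set s | let: (x, u, w, z) := s in [/\ stationary (x, u), w = 0 & z = 0]].

Definition piw (x : Rn) : RNd :=
  \mxrow_i (- phi (submxrow x i) + sigma x).

Definition piz (x : Rn) : RNd :=
  \mxrow_i (- grad2 (submxrow x i) (sigma x)
            + N%:R^-1 *: \sum_j grad2 (submxrow x j) (sigma x)).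

Definition state_norm (s : state) : R :=
  let: (x, u, w, z) := s in enorm (row_mx (row_mx x u) (row_mx w z)).

(* Extended-real valued, so that the distance to the empty set is +oo. *)
Definition state_dist (Y : set state) (s : state) : \bar R :=
  ereal_inf [set (state_norm (s - s'))%:E | s' in Y].

Definition shifted (s : state) : state :=
  let: (x, u, w, z) := s in (x, u, w - piw x, z - piz x).

Definition zero_trackers (s : state) : Prop :=
  let: (_, _, w, z) := s in w = 0 /\ z = 0.

Definition tracking_equilibrium (u : Rm) : state :=
  (hstack u, u, piw (hstack u), piz (hstack u)).

Definition isolated_stationary_point (u : Rm) : Prop :=
  isolated [set u' | grad Fsigmah u' = 0] u.

Definition local_minimum (u : Rm) : Prop :=
  \forall u' \near u, Fsigmah u <= Fsigmah u'.

End aggregative.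

(* Main.v *)
Require Import Defs.
From HB Require Import structures.
From mathcomp Require Import all_boot all_order all_algebra.
From mathcomp Require Import all_classical all_reals all_analysis.
From mathcomp Require Import ring lra zify.

Set Implicit Arguments.
Unset Strict Implicit.
Unset Printing Implicit Defensive.

Import Order.TTheory GRing.Theory Num.Theory.
Import numFieldNormedType.Exports.

Local Open Scope classical_set_scope.
Local Open Scope ring_scope.

(* On the invariant set where w and z have zero mean, the averages over the agents
   of y_i = w_i + phi_i(x_i) and v_i = z_i + nabla_2 f_i(x_i, y_i) are sigma(x) and
   the average of the nabla_2 f_i(x_i, y_i).  A composite Lyapunov function

     W = F_sigma,h(u) + 1/2 sum_i V_i(x_i, u_i)^2 + kw dis(y) + 1/2 dis(v)

   is used, where dis is the sum of squared deviations from the mean and V_i is a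
   converse Lyapunov function of the i-th plant with frozen input: the supremum over
   t >= 0 of e^(kappa t) times the distance to h_i(u_i) along the frozen flow.  The
   consensus part contracts at the rate lambda / alpha_2 given by the spectral gap of
   the symmetrized Laplacian, so that for small alpha_1 and alpha_2 all cross terms
   are absorbed and W decreases at least at the rate

     rho = alpha_1/2 |grad F_sigma,h(u)|^2 + kappa/2 sum_i V_i^2 + dis(y) + dis(v).

   W is only locally Lipschitz, so "decreases" refers to right Dini derivatives.
   Radial unboundedness makes trajectories bounded, and a LaSalle-Barbalat argument
   gives rho -> 0, hence convergence to the stationary set.  Near an isolated local
   minimum the same W confines trajectories. *)

(** * Right Dini derivatives *)

Section right_derivatives.
Variable R : realType.
Implicit Types (t c : R) (psi phi : R -> R).

(** The upper right Dini derivative at [t] is at most [c], in epsilon form. No limsup is formed, so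
    such bounds add, scale and sum by filter arguments. *)
Definition dini_le phi t c : Prop :=
  forall eta : R, 0 < eta ->
    \forall s \near (0 : R)^'+, phi (t + s) <= phi t + (c + eta) * s.

Definition right_derive (V : normedModType R) (x : R -> V) t (v : V) : Prop :=
  forall eta : R, 0 < eta ->
    \forall s \near (0 : R)^'+, `|x (t + s) - x t - s *: v| <= eta * s.

Lemma near_right_shift (P : R -> Prop) t :
  (\forall x \near t, P x) -> \forall s \near (0 : R)^'+, P (t + s).
Proof.
move=> /nbhs_ballP[e /= e0 H]; near=> s; apply: H.
rewrite /ball /= opprD addrA subrr add0r normrN gtr0_norm; last by near: s; exact: nbhs_right_gt.
by near: s; exact: nbhs_right_lt.
Unshelve. all: by end_near. Qed.

(** The supremum [T] of the times with [psi <= 0] satisfies [psi T <= 0] by continuity. If [T < b],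
    then [psi] stays nonpositive just after [T], by continuity when [psi T < 0] and by the Dini
    bound when [psi T = 0], against the choice of [T]. The slope is constrained only at zeros of
    [psi], which is all that a comparison argument supplies. *)
Lemma barrier psi (a b : R) : a <= b ->
  (forall t, a <= t <= b -> {for t, continuous psi}) -> psi a < 0 ->
  (forall t, a < t < b -> psi t = 0 -> exists2 c, c < 0 & dini_le psi t c) ->
  psi b <= 0.
Proof.
move=> ab cpsi psia H; rewrite leNgt; apply/negP => psib.
pose S := [set t | a <= t <= b /\ psi t <= 0].
have Sa : S a by split; [rewrite lexx | exact: ltW].
have hS : has_sup S by split; [exists a | exists b => t [/andP[]]].
have ub := sup_upper_bound hS; set T := sup S in ub.
have aT : a <= T by apply: ub.
have Tb : T <= b by apply: sup_le_ub; [exists a | move=> t [/andP[]]].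
have cT := cpsi T (introT andP (conj aT Tb)).
have psiT : psi T <= 0.
  rewrite leNgt; apply/negP => psiT.
  have /nbhs_ballP[e /= e0 He] : \forall x \near T, 0 < psi x by exact: cT _ (lt_nbhsr psiT).
  have [t [/andP[at_ tb] ps] tT] := sup_adherent e0 hS.
  have := He t; rewrite /ball /= ltr_norml -/T in tT *.
  have := ub t; rewrite /S /= at_ tb ps => /(_ (conj isT isT)) h1.
  move=> /(_ _); rewrite [_ < psi t]ltNge ps /= => h; apply: notF; apply: h.
  by apply/andP; split; lra.
have Tb' : T < b.
  by rewrite lt_neqAle Tb andbT; apply/eqP => E; rewrite E leNgt psib in psiT.
have Hr : \forall s \near (0 : R)^'+, psi (T + s) <= 0.
  move: psiT; rewrite le_eqVlt => /predU1P[psiT|psiT].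
    have aT' : a < T.
      rewrite lt_neqAle aT andbT; apply/eqP => E.
      by move: psia; rewrite E psiT ltxx.
    have [c c0 D] := H T (introT andP (conj aT' Tb')) psiT.
    have e0 : 0 < - c / 2 by lra.
    have := D _ e0; apply: filterS2 (nbhs_right_gt 0) => s s0 /le_trans; apply.
    by rewrite psiT; nra.
  apply: (@near_right_shift (fun x => psi x <= 0)).
  have : \forall x \near T, psi x < 0 by exact: cT _ (lt_nbhsl psiT).
  by apply: filterS => x; exact: ltW.
have : \forall s \near (0 : R)^'+, False.
  have dT : 0 < b - T by lra.
  near=> s.
  have s0 : 0 < s by near: s; exact: nbhs_right_gt.
  have sb : s < b - T by near: s; exact: nbhs_right_lt.
  have := ub (T + s); rewrite leNgt ltrDl s0 /= => h; suff : false by []; apply: h; split.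
    by apply/andP; split; lra.
  by near: s.
by move=> /filter_ex[].
Unshelve. all: by end_near. Qed.

Lemma dini_leD phi psi t c d : dini_le phi t c -> dini_le psi t d ->
  dini_le (fun x => phi x + psi x) t (c + d).
Proof.
move=> h1 h2 e e0; have e2 : 0 < e / 2 by lra.
have := h2 _ e2; have := h1 _ e2.
by apply: filterS2 => s; lra.
Qed.

Lemma dini_leW phi t c d : c <= d -> dini_le phi t c -> dini_le phi t d.
Proof.
move=> cd h e e0; have := h _ e0; apply: filterS2 (nbhs_right_gt 0) => s s0.
by move=> /le_trans; apply; nra.
Qed.

Lemma dini_leZ phi t c k : 0 <= k -> dini_le phi t c ->
  dini_le (fun x => k * phi x) t (k * c).
Proof.
move=> k0 h e e0; have e2 : 0 < e / (k + 1) by rewrite divr_gt0 //; lra.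
have := h _ e2; apply: filterS2 (nbhs_right_gt 0) => s s0 H.
apply: (le_trans (ler_wpM2l k0 H)).
have : k * (e / (k + 1)) <= e.
  by rewrite mulrA ler_pdivrMr; nra.
by move=> ?; nra.
Qed.

Lemma dini_le_sum (I : Type) (r : seq I) (P : pred I) (phi : I -> R -> R) t (c : I -> R) :
  (forall i, P i -> dini_le (phi i) t (c i)) ->
  dini_le (fun x => \sum_(i <- r | P i) phi i x) t (\sum_(i <- r | P i) c i).
Proof.
move=> H; elim: r => [|i r IH].
  move=> e e0; apply: filterS (nbhs_right_gt 0) => s s0.
  by rewrite !big_nil; nra.
rewrite big_cons; case: ifPn => Pi.
  have := dini_leD (H i Pi) IH; congr dini_le.
  by apply: funext => x; rewrite big_cons Pi.
move: IH; congr dini_le.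
by apply: funext => x; rewrite big_cons (negbTE Pi).
Qed.

Lemma right_derive_dini phi t (c : R) : right_derive phi t c -> dini_le phi t c.
Proof.
move=> h e e0; have := h _ e0; apply: filterS => s.
by rewrite ler_norml => /andP[_]; rewrite /GRing.scale /=; lra.
Qed.

Lemma right_deriveN (V : normedModType R) (x : R -> V) t v :
  right_derive x t v -> right_derive (fun s => - x s) t (- v).
Proof.
move=> h e e0; have := h _ e0; apply: filterS => s.
by rewrite scalerN -!opprD normrN.
Qed.

Lemma right_deriveD (V : normedModType R) (x y : R -> V) t v w :
  right_derive x t v -> right_derive y t w ->
  right_derive (fun s => x s + y s) t (v + w).
Proof.
move=> h1 h2 e e0; have e2 : 0 < e / 2 by lra.
have := h2 _ e2; have := h1 _ e2; apply: filterS2 => s H1 H2.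
have -> : x (t + s) + y (t + s) - (x t + y t) - s *: (v + w) =
  (x (t + s) - x t - s *: v) + (y (t + s) - y t - s *: w).
  by rewrite scalerDr !opprD (addrACA (x (t + s)) (y (t + s)) (- x t)) (addrACA (x (t + s) - x t)).
apply: (le_trans (ler_normD _ _)); apply: (le_trans (lerD H1 H2)).
by rewrite -mulrDl -splitr.
Qed.

(** Mean value inequality for Dini bounds. [barrier] is applied to [phi] minus a line of slope
    [c + e'] that starts [e'] above [phi a]: both the initial value and the slope become strictly
    negative, at a total cost of [e' * (b - a + 1) = e]. *)
Lemma dini_le_const_bound phi (a b c : R) : a <= b ->
  (forall t, a <= t <= b -> {for t, continuous phi}) ->
  (forall t, a < t < b -> dini_le phi t c) ->
  phi b <= phi a + c * (b - a).
Proof.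
move=> ab cphi H; apply/ler_addgt0Pr => e e0.
have e1 : 0 < e / (b - a + 1) by rewrite divr_gt0 //; lra.
set e' := e / (b - a + 1) in e1.
have ee' : e' * (b - a + 1) = e by rewrite /e' divfK //; apply: lt0r_neq0; lra.
pose psi t := phi t + (- phi a - e' - (c + e') * (t - a)).
suff : psi b <= 0 by rewrite /psi; nra.
apply: (barrier ab).
- move=> t tab; apply: cvgD; first exact: cphi.
  apply: cvgB; first exact: cvg_cst.
  apply: cvgM; first exact: cvg_cst.
  by apply: cvgB; [exact: cvg_id | exact: cvg_cst].
- rewrite /psi; nra.
- move=> t tab _; exists (- e'); first lra.
  rewrite -[- e'](_ : c + - (c + e') = _); last ring.
  apply: dini_leD; first exact: H.
  move=> h h0; apply: filterS (nbhs_right_gt 0) => s s0; nra.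
Qed.

Lemma is_derive_right (V : normedModType R) (x : R -> V) t v :
  is_derive t (1 : R) x v -> right_derive x t v.
Proof.
move=> [dx xv] e e0.
have dx' : (fun h : R => h^-1 *: (x (h *: 1 + t) - x t)) @ 0^' --> v.
  by rewrite -xv; exact: dx.
move/cvgrPdist_le : dx' => /(_ _ e0).
rewrite /at_right; move=> H.
rewrite near_withinE in H *.
apply: filterS H => s Hs s0.
have s0' : s != 0 by rewrite gt_eqF.
have := Hs s0'.
rewrite -(ler_pM2l (s0 : 0 < s)) -{1}(gtr0_norm s0) -normrZ scalerBr scalerA divff // scale1r.
rewrite /GRing.scale /= mulr1 (addrC s) -normrN opprB [s * e]mulrC; congr (`|_| <= _).
Qed.

Lemma dini_le_norm (V : normedModType R) (x : R -> V) t v :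
  right_derive x t v -> dini_le (fun s => `|x s|) t `|v|.
Proof.
move=> h e e0; have := h _ e0; apply: filterS2 (nbhs_right_gt 0) => s s0 H.
rewrite -[x (t + s)](subrK (x t + s *: v)).
apply: (le_trans (ler_normD _ _));
have -> : x (t + s) - (x t + s *: v) = x (t + s) - x t - s *: v by rewrite opprD addrA.
have := ler_normD (x t) (s *: v); rewrite normrZ gtr0_norm //.
by nra.
Qed.

Lemma right_derive_near_norm (V : normedModType R) (x : R -> V) t v (e : R) :
  right_derive x t v -> 0 < e ->
  \forall s \near (0 : R)^'+, `|x (t + s) - x t| <= (`|v| + e) * s.
Proof.
move=> h e0; have := h _ e0; apply: filterS2 (nbhs_right_gt 0) => s s0 H.
rewrite -[x (t + s) - x t](subrK (s *: v)).
apply: (le_trans (ler_normD _ _)); rewrite normrZ gtr0_norm //.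
by nra.
Qed.

(** The increment of the square is [phi (t + s) - phi t] times [q = phi (t + s) + phi t]. Since
    [0 <= q], the one-sided bound may be multiplied by [q]; continuity sends [q] to [2 * phi t],
    which an upper Dini bound alone does not give. *)
Lemma dini_le_sqr phi t c : {for t, continuous phi} -> (forall s, 0 <= phi s) ->
  dini_le phi t c -> dini_le (fun s => phi s ^+ 2) t (2 * phi t * c).
Proof.
move=> cphi phi0 D e e0.
pose M := 2 * phi t + 1.
have M0 : 0 < M by have := phi0 t; rewrite /M; lra.
have e1 : 0 < e / (2 * M) by rewrite divr_gt0 //; lra.
have E1 : e / (2 * M) * M = e / 2 by field; exact: lt0r_neq0.
have e2 : 0 < Num.min 1 (e / (2 * (`|c| + 1))).
  by rewrite lt_min ltr01 /= divr_gt0 //; have := normr_ge0 c; lra.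
set d := Num.min _ _ in e2.
have d1 : d <= 1 by rewrite /d ge_min lexx.
have d2 : d * `|c| <= e / 2.
  have : d <= e / (2 * (`|c| + 1)) by rewrite /d ge_min lexx orbT.
  rewrite ler_pdivlMr; last by have := normr_ge0 c; lra.
  by have := normr_ge0 c; nra.
have N : \forall s \near (0 : R)^'+, `|phi t - phi (t + s)| < d.
  by apply: (@near_right_shift (fun x => `|phi t - phi x| < d)); move/cvgrPdist_lt : cphi; exact.
have := D _ e1; apply: filterS3 (nbhs_right_gt 0) N => s s0.
rewrite ltr_norml => /andP[N1 N2] H.
have p1 := phi0 t; have p2 := phi0 (t + s).
have -> : phi (t + s) ^+ 2 = phi t ^+ 2 + (phi (t + s) - phi t) * (phi (t + s) + phi t) by ring.
rewrite lerD2l.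
set q := phi (t + s) + phi t.
have q0 : 0 <= q by rewrite /q; lra.
have qM : q <= M by rewrite /q /M; lra.
apply: (@le_trans _ _ (s * (c + e / (2 * M)) * q)); first by rewrite ler_wpM2r // ; lra.
have h1 : c * (q - 2 * phi t) <= e / 2.
  apply: le_trans d2; apply: (le_trans (ler_norm _)).
  rewrite normrM mulrC ler_wpM2r // ltW // ltr_norml /q; apply/andP; split; lra.
have h2 : e / (2 * M) * q <= e / 2 by rewrite -E1 ler_wpM2l // ltW.
have -> : s * (c + e / (2 * M)) * q = s * (c * (q - 2 * phi t) + e / (2 * M) * q + 2 * phi t * c) by ring.
by rewrite [leRHS]mulrC ler_pM2l //; lra.
Qed.

End right_derivatives.

(** * The Picard-Lindelof theorem *)

Section row_norms.
Variable R : realType.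

Lemma coord_norm_le a b (M : 'M[R]_(a, b)) i j : `|M i j| <= `|M|.
Proof.
rewrite [leRHS]/Num.Def.normr/= mx_normrE.
exact: (le_bigmax _ (fun ij => `|M ij.1 ij.2|) (i, j)).
Qed.

Lemma mx_norm_le a b (M : 'M[R]_(a, b)) (e : R) : 0 <= e ->
  (forall i j, `|M i j| <= e) -> `|M| <= e.
Proof.
move=> e0 H; rewrite [leLHS]/Num.Def.normr/= mx_normrE.
by apply/bigmax_leP; split=> // -[i j] _; exact: H.
Qed.

Lemma rV_norm_le k (v : 'rV[R]_k) (e : R) : 0 <= e ->
  (forall j, `|v 0 j| <= e) -> `|v| <= e.
Proof. by move=> e0 H; apply: mx_norm_le => // i j; rewrite (ord1 i). Qed.

Lemma continuous_normP (V W : normedModType R) (g : V -> W) x :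
  {for x, continuous g} <-> forall e : R, 0 < e ->
    exists2 r : R, 0 < r & forall y, `|y - x| < r -> `|g y - g x| < e.
Proof.
split=> [/cvgrPdist_lt H e e0|H].
  have /nbhs_normP[r r0 Hr] := H e e0; exists r => // y yx.
  by rewrite distrC; apply: Hr; rewrite /= distrC.
apply/cvgrPdist_lt => e e0; have [r r0 Hr] := H e e0.
by apply/nbhs_normP; exists r => // y /=; rewrite distrC => /Hr; rewrite distrC.
Qed.

Lemma lipschitz_continuous (V W : normedModType R) (g : V -> W) (L : R) :
  (forall x y, `|g x - g y| <= L * `|x - y|) -> continuous g.
Proof.
move=> gL x; apply/continuous_normP => e e0.
have L0 : 0 < `|L| + 1 by have := normr_ge0 L; lra.
exists (e / (`|L| + 1)); first by rewrite divr_gt0.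
move=> y; rewrite ltr_pdivlMr // => H; apply: (le_lt_trans (gL _ _)).
by have := ler_norm L; have := normr_ge0 (y - x); nra.
Qed.

End row_norms.

Section picard.
Variable R : realType.

(** The intervals from [u k - b k] to [u k + b k] are nested, so the supremum of their left ends
    lies in all of them. This produces the limit of the Picard iterates coordinate by coordinate,
    with an explicit error. *)
Lemma dominated_increments_limit (u b : nat -> R) : (forall k, 0 <= b k) ->
  (forall k, b k.+1 + `|u k.+1 - u k| <= b k) ->
  exists l, forall k, `|l - u k| <= b k.
Proof.
move=> b0 H.
have up k j : u k - b k <= u (k + j)%N - b (k + j)%N.
  elim: j => [|j IH]; first by rewrite addn0.
  rewrite addnS; apply: (le_trans IH); have := H (k + j)%N.
  have := ler_norm (- (u (k + j).+1 - u (k + j)%N)); rewrite normrN; lra.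
have down k j : u (k + j)%N + b (k + j)%N <= u k + b k.
  elim: j => [|j IH]; first by rewrite addn0.
  rewrite addnS; apply: le_trans IH; have := H (k + j)%N.
  have := ler_norm (u (k + j).+1 - u (k + j)%N); lra.
have cross j k : u j - b j <= u k + b k.
  apply: (le_trans (up j k)); apply: le_trans (down k j).
  by rewrite addnC; have := b0 (k + j)%N; lra.
pose A := range (fun k => u k - b k).
have hA : has_sup A.
  by split; [exists (u 0%N - b 0%N); exists 0%N | exists (u 0%N + b 0%N) => _ [k _ <-]].
exists (sup A) => k; rewrite ler_norml; apply/andP; split.
  have : u k - b k <= sup A by apply: (sup_upper_bound hA); exists k.
  lra.
have : sup A <= u k + b k.
  by apply: ge_sup; [exists (u 0%N - b 0%N); exists 0%N | move=> _ [j _ <-]].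
lra.
Qed.

Lemma continuous_primitive (f : R -> R) : continuous f ->
  exists F : R -> R, F 0 = 0 /\ forall t : R, -1 < t -> is_derive t 1 F (f t).
Proof.
move=> cf.
(* Integrating from -1 makes 0 an interior point, so the primitive has a two-sided derivative at
   time 0. *)
pose G x := (\int[@lebesgue_measure R]_(t in [set` `[(-1 : R), x]]) (f t))%R.
exists (fun x => G x - G 0); split; first by rewrite subrr.
move=> t t1.
have [||dG G'] := @continuous_FTC1_closed R f (-1) t (t + 1) _ _ t1 (cf t); first lra.
  apply: continuous_compact_integrable; first exact: segment_compact.
  exact: continuous_subspaceT.
have GD : is_derive t 1 G (f t).
  by apply: DeriveDef; [exact: dG | rewrite -derive1E].
have := is_deriveB GD (is_derive_cst (G 0) t (1 : R)); rewrite subr0.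
exact.
Qed.

Lemma is_derive_rV k (F : R -> 'rV[R]_k) t (v : 'rV[R]_k) :
  (forall j, is_derive t (1 : R) (fun s => F s 0 j) (v 0 j)) -> is_derive t (1 : R) F v.
Proof.
move=> H; have D : derivable F t 1.
  by apply/derivable_mxP => i j; rewrite (ord1 i); have [] := H j.
apply: DeriveDef => //; rewrite derive_mx //; apply/rowP => j.
by rewrite mxE; have [_ ->] := H j.
Qed.

Lemma continuous_primitive_rV k (f : R -> 'rV[R]_k) : continuous f ->
  exists F : R -> 'rV[R]_k, F 0 = 0 /\ forall t : R, -1 < t -> is_derive t (1 : R) F (f t).
Proof.
move=> cf.
have H j : exists F : R -> R, F 0 = 0 /\ forall t : R, -1 < t -> is_derive t 1 F (f t 0 j).
  apply: continuous_primitive => t.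
  apply: (@continuous_comp _ _ _ f (fun M : 'rV[R]_k => M 0 j)); first exact: cf.
  exact: coord_continuous.
have /choice[F HF] := H.
exists (fun t => \row_j F j t); split.
  by apply/rowP => j; rewrite !mxE; have [] := HF j.
move=> t t1; apply: is_derive_rV => j.
have [_ /(_ t t1)] := HF j; congr is_derive.
by apply/funext => s; rewrite mxE.
Qed.

Lemma is_derive_continuous (V : normedModType R) (X : R -> V) t v :
  is_derive t (1 : R) X v -> {for t, continuous X}.
Proof. by move=> [/derivable1_diffP/differentiable_continuous]. Qed.

Lemma is_derive_expRM (c t : R) :
  is_derive t 1 (fun s => expR (c * s)) (c * expR (c * t)).
Proof.
have h1 : is_derive t 1 (fun s : R => c * s) c.
  have := is_deriveZ c (is_derive_id t (1 : R)); rewrite [X in is_derive _ _ _ X]mulr1; exact.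
have h2 : is_derive (c * t) 1 (@expR R) (expR (c * t)) by exact: is_derive_expR.
by have := is_derive1_comp h2 h1; rewrite mulrC.
Qed.

Section solution.
Variables (k : nat) (g : 'rV[R]_k -> 'rV[R]_k) (L : R) (x0 : 'rV[R]_k).
Hypothesis L1 : 1 <= L.
Hypothesis gL : forall x y, `|g x - g y| <= L * `|x - y|.

Let clamp (t : R) := Num.max t 0.

Let clamp_ge0 t : 0 <= clamp t. Proof. by rewrite /clamp le_max lexx orbT. Qed.

Let clamp_id t : 0 <= t -> clamp t = t. Proof. by move=> t0; rewrite /clamp max_l. Qed.

Let clamp_continuous : continuous clamp.
Proof. by move=> t; apply: continuous_max; [exact: cvg_id | exact: cvg_cst]. Qed.

(** Picard iteration in the weighted norm of Bielecki, with weight [expR (2 * L * t)]: the integral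
    operator halves distances on the whole half line at once, so no local solutions have to be
    glued. *)
Lemma picard_lindelof : exists X : R -> 'rV[R]_k,
  X 0 = x0 /\ forall t : R, 0 <= t -> is_derive t (1 : R) X (g (X t)).
Proof.
have /choice[prim Hprim] : forall f : R -> 'rV[R]_k, exists F : R -> 'rV[R]_k,
    continuous f -> F 0 = 0 /\ forall t : R, -1 < t -> is_derive t (1 : R) F (f t).
  move=> f; have [cf|ncf] := pselect (continuous f); last by exists (fun=> 0).
  by have [F HF] := continuous_primitive_rV cf; exists F.
(* [clamp] keeps every iterate equal to [x0] at negative times, so that all iterates are continuous
   on the whole line. *)
pose P (Y : R -> 'rV[R]_k) t := x0 + prim (g \o Y) (clamp t).
have cg (Y : R -> 'rV[R]_k) : continuous Y -> continuous (g \o Y).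
  by move=> cY t; apply: continuous_comp; [exact: cY | exact: (lipschitz_continuous gL)].
have dprim (Y : R -> 'rV[R]_k) (t : R) : continuous Y -> 0 <= t ->
    is_derive t (1 : R) (prim (g \o Y)) (g (Y t)).
  by move=> cY t0; have [_ H] := Hprim _ (cg _ cY); apply: H; lra.
have prim0 (Y : R -> 'rV[R]_k) : continuous Y -> prim (g \o Y) 0 = 0.
  by move=> cY; have [] := Hprim _ (cg _ cY).
have cP (Y : R -> 'rV[R]_k) : continuous Y -> continuous (P Y).
  move=> cY t; apply: cvgD; first exact: cvg_cst.
  apply: continuous_comp; first exact: clamp_continuous.
  exact: is_derive_continuous (dprim _ _ cY (clamp_ge0 t)).
pose E (t : R) := expR (2 * L * t).
have E0 t : 0 < E t by exact: expR_gt0.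
(* The slope of [c / 2 * E] is [c * L * E], exactly the Lipschitz bound on the slope of [D]; this is
   the reason for the factor 2 in the exponent. *)
have contr (U V : R -> 'rV[R]_k) (c : R) : continuous U -> continuous V -> 0 <= c ->
    (forall t, `|U t - V t| <= c * E (clamp t)) ->
    forall t, `|P U t - P V t| <= c / 2 * E (clamp t).
  move=> cU cV c0 H t; rewrite /P opprD addrACA subrr add0r.
  set D := fun s => prim (g \o U) s - prim (g \o V) s.
  have dD (s : R) : 0 <= s -> is_derive s (1 : R) D (g (U s) - g (V s)).
    by move=> s0; apply: is_deriveB; exact: dprim.
  pose psi s := `|D s| + - (c / 2) * E s.
  have := @dini_le_const_bound R psi 0 (clamp t) 0 (clamp_ge0 t).
  rewrite mul0r addr0 /psi.
  have -> : D 0 = 0 by rewrite /D !prim0 // subrr.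
  rewrite normr0.
  have cE (s : R) : is_derive s 1 E (2 * L * E s) by exact: is_derive_expRM.
  move=> HH; have : `|D (clamp t)| + - (c / 2) * E (clamp t) <= 0 + - (c / 2) * E 0.
    apply: HH.
      move=> s /andP[s0 _]; apply: cvgD.
        by apply: cvg_norm; exact: is_derive_continuous (dD s s0).
      by apply: cvgM; [exact: cvg_cst | exact: is_derive_continuous (cE s)].
    move=> s /andP[s0 _]; have s0' := ltW s0.
    apply: (@dini_leW _ _ _ (`|g (U s) - g (V s)| + - (c / 2) * (2 * L * E s))).
      have := H s; rewrite clamp_id // => Hs.
      have := gL (U s) (V s).
      have : L * `|U s - V s| <= L * (c * E s) by apply: ler_wpM2l => //; exact: le_trans L1.
      lra.
    apply: dini_leD; first by apply: dini_le_norm; apply: is_derive_right; exact: dD.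
    by apply: right_derive_dini; apply: is_derive_right.
  by have := E0 0; rewrite /D; nra.
pose Y := fix Y n := if n is n'.+1 then P (Y n') else (fun=> x0).
have cY n : continuous (Y n).
  by elim: n => [|n IH]; [exact: cst_continuous | exact: cP].
pose M := `|g x0|.
have M0 : 0 <= M by exact: normr_ge0.
have d0 t : `|Y 1%N t - Y 0%N t| <= M * E (clamp t).
  have d := @dini_le_const_bound R (fun s => `|prim (g \o Y 0%N) s|) 0 (clamp t) M (clamp_ge0 t).
  rewrite /= /P addrC addKr; apply: (le_trans (d _ _)).
  - by move=> s /andP[s0 _]; apply: cvg_norm; exact: is_derive_continuous (dprim _ _ (cY 0%N) s0).
  - move=> s /andP[s0 _]; apply: dini_le_norm; apply: is_derive_right.
    exact: dprim (cY 0%N) (ltW s0).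
  - rewrite prim0 ?normr0 ?add0r ?subr0; last exact: (cY 0%N).
    rewrite ler_wpM2l //; have := expR_ge1Dx (2 * L * clamp t).
    have c0 := clamp_ge0 t; have : clamp t <= L * clamp t by rewrite ler_peMl.
    by rewrite /E; move: (expR _) => e; move: c0; move: (clamp t) => c c0 h1; lra.
have dn n t : `|Y n.+1 t - Y n t| <= M / 2 ^+ n * E (clamp t).
  elim: n t => [|n IH] t; first by rewrite expr0 divr1.
  have h : 0 <= M / 2 ^+ n by rewrite divr_ge0 // exprn_ge0.
  have -> : M / 2 ^+ n.+1 = M / 2 ^+ n / 2.
    by rewrite exprSr invfM mulrA mulrAC.
  exact: (contr _ _ _ (cY n.+1) (cY n) h IH t).
(* The tail of the geometric series of increments: it halves at each step, and the lost half pays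
   for one increment. *)
pose b n t := 2 * (M / 2 ^+ n) * E (clamp t).
have b0 n t : 0 <= b n t.
  by rewrite /b !mulr_ge0 // ?ltW // invr_ge0 exprn_ge0.
have bS n t : b n.+1 t = b n t / 2.
  by rewrite /b exprS; field; rewrite expf_neq0 // pnatr_eq0.
have lim_j t j : exists l, forall n, `|l - Y n t 0 j| <= b n t.
  apply: dominated_increments_limit => [n|n]; first exact: b0.
  have := coord_norm_le (Y n.+1 t - Y n t) 0 j; rewrite !mxE => h.
  by have := dn n t; rewrite bS /b; lra.
have /choice[Z HZ] : forall t, exists l : 'rV[R]_k, forall n, `|l - Y n t| <= b n t.
  move=> t; have /choice[l Hl] := lim_j t.
  exists (\row_j l j) => n; apply: rV_norm_le => // j; rewrite !mxE; exact: Hl.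
have small t e : 0 < e -> exists n, b n t < e.
  move=> e0; have e1 : 0 < e / (2 * (M + 1) * E (clamp t)) by rewrite divr_gt0 // mulr_gt0 //; lra.
  have [n _ /(_ n (leqnn n)) Hn] := near_infty_natSinv_expn_lt (PosNum e1).
  exists n; move: Hn; rewrite /= ltr_pdivlMr; last by rewrite mulr_gt0 //; lra.
  apply: le_lt_trans; rewrite /b mul1r.
  have := E0 (clamp t); have : 0 <= (2 ^+ n)^-1 :> R by rewrite invr_ge0 exprn_ge0.
  move=> h1 h2; have := mulr_ge0 h1 (ltW h2); nra.
have cZ : continuous Z.
  move=> t; apply/cvgrPdist_le => e e0.
  have e3 : 0 < e / 3 by lra.
  have [n Hn] := small (t + 1) _ e3.
  near=> s.
  have bmono r : r <= t + 1 -> b n r <= e / 3.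
    move=> rt; apply: le_trans (ltW Hn); rewrite /b ler_wpM2l //.
      by rewrite mulr_ge0 // divr_ge0 // exprn_ge0.
    have L2 : 0 <= 2 * L by apply: mulr_ge0 => //; exact: le_trans L1.
    rewrite /E ler_expR; apply: ler_wpM2l => //.
    by rewrite /clamp ge_max !le_max lexx rt orbT.
  have -> : Z t - Z s = (Z t - Y n t) + (Y n t - Y n s) + (Y n s - Z s).
    by rewrite !addrA !subrK.
  apply: (le_trans (ler_normD _ _)); rewrite -(distrC (Z s)).
  have h1 := ler_normD (Z t - Y n t) (Y n t - Y n s).
  have h2 := HZ t n; have h3 := HZ s n.
  have h4 : b n t <= e / 3 by apply: bmono; lra.
  have h5 : b n s <= e / 3.
    apply: bmono; apply: ltW; near: s; apply: lt_nbhsl; lra.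
  have h6 : `|Y n t - Y n s| <= e / 3.
    by near: s; move: (cY n t) => /cvgrPdist_le; exact.
  lra.
have PZ t : P Z t = Z t.
  apply/eqP; rewrite -subr_eq0 -normr_le0; apply/ler_addgt0Pr => e e0; rewrite add0r.
  have e2 : 0 < e / 2 by lra.
  have [n Hn] := small t _ e2.
  have -> : P Z t - Z t = (P Z t - Y n.+1 t) + (Y n.+1 t - Z t) by rewrite addrA subrK.
  apply: (le_trans (ler_normD _ _)); rewrite -(distrC (Z t)).
  have h : 0 <= 2 * (M / 2 ^+ n) by rewrite mulr_ge0 // divr_ge0 // exprn_ge0.
  have := contr _ _ _ cZ (cY n) h (fun s => HZ s n) t.
  have := HZ t n.+1; rewrite bS; have : b n t = 2 * (M / 2 ^+ n) * E (clamp t) by [].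
  lra.
(* Without [clamp] the curve is differentiable from both sides at 0, and it agrees with [Z] for
   [t >= 0]. *)
exists (fun t => x0 + prim (g \o Z) t); split; first by rewrite prim0 ?addr0.
move=> t t0.
have -> : x0 + prim (g \o Z) t = Z t by rewrite -[RHS]PZ /P clamp_id.
have := is_deriveD (is_derive_cst x0 t (1 : R)) (dprim Z t cZ t0).
by rewrite add0r.
Unshelve. all: by end_near. Qed.

End solution.
End picard.

(** * Converse Lyapunov theorem *)

Section gronwall.
Variables (R : realType) (V : normedModType R) (L b : R) (D v : R -> V).
Hypotheses (L0 : 0 <= L) (b0 : 0 <= b).
Hypothesis cD : forall t, 0 <= t -> {for t, continuous D}.
Hypothesis dD : forall t, 0 <= t -> right_derive D t (v t).
Hypothesis vL : forall t, 0 <= t -> `|v t| <= L * `|D t| + b.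

(** Comparison with [(A + B * s) * expR (L * s)], a strict supersolution once [A] and [B] exceed the
    initial norm and [b] by [e']. The linear factor replaces the sharper
    [b * (expR (L * t) - 1) / L] and covers [L = 0] as well. *)
Lemma gronwall t : 0 <= t -> `|D t| <= (`|D 0| + b * t) * expR (L * t).
Proof.
move=> t0; apply/ler_addgt0Pr => e e0.
have E0 s : 0 < expR (L * s) by exact: expR_gt0.
have [e' e1 ee'] : exists2 e' : R, 0 < e' & e' * ((1 + t) * expR (L * t)) = e.
  have P : 0 < (1 + t) * expR (L * t) by rewrite mulr_gt0 //; lra.
  by exists (e / ((1 + t) * expR (L * t))); [rewrite divr_gt0 | rewrite divfK // gt_eqF].
pose A := `|D 0| + e'; pose B := b + e'.
pose psi s := `|D s| + - ((A + B * s) * expR (L * s)).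
have dB (s : R) : is_derive s (1 : R) (fun s => (A + B * s) * expR (L * s))
    (B * expR (L * s) + L * ((A + B * s) * expR (L * s))).
  have h1 : is_derive s (1 : R) (fun s : R => A + B * s) B.
    have h := is_deriveD (is_derive_cst A s (1 : R)) (is_deriveZ B (is_derive_id s (1 : R))).
    by rewrite [X in is_derive _ _ _ X]add0r [X in is_derive _ _ _ X]mulr1 in h; exact: h.
  apply: is_derive_eq (is_deriveM h1 (is_derive_expRM L s)) _.
  by rewrite /GRing.scale /=; ring.
suff : psi t <= 0 by rewrite /psi /A /B; nra.
apply: (barrier t0).
- move=> s /andP[s0 _]; apply: cvgD; first by apply: cvg_norm; exact: cD.
  by apply: cvgN; exact: is_derive_continuous (dB s).
- by rewrite /psi /A !mulr0 expR0; lra.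
- move=> s /andP[/ltW s0 _] psi0.
  exists (`|v s| + - (B * expR (L * s) + L * ((A + B * s) * expR (L * s)))).
    have := vL s0; have -> : `|D s| = (A + B * s) * expR (L * s) by move: psi0; rewrite /psi; lra.
    have : 1 <= expR (L * s) by rewrite -expR0 ler_expR mulr_ge0.
    move: (expR (L * s)) => E E1 h.
    have : b <= b * E by rewrite ler_peMr.
    have : 0 < e' * E by rewrite mulr_gt0 //; lra.
    have : B * E = b * E + e' * E by rewrite /B mulrDl.
    lra.
  apply: dini_leD; first by apply: dini_le_norm; exact: dD.
  by apply: right_derive_dini; apply: right_deriveN; exact: is_derive_right.
Qed.

End gronwall.

Section converse_lyapunov.
Variables (R : realType) (k l : nat).
Variables (p : 'rV[R]_k -> 'rV[R]_l -> 'rV[R]_k) (h : 'rV[R]_l -> 'rV[R]_k).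
Variables (L d1 d2 : R).
Hypotheses (L1 : 1 <= L) (d1_gt0 : 0 < d1) (d2_gt0 : 0 < d2).
Hypothesis pLx : forall x x' u, `|p x u - p x' u| <= L * `|x - x'|.
Hypothesis pLu : forall x u u', `|p x u - p x u'| <= L * `|u - u'|.
Hypothesis hL : forall u u', `|h u - h u'| <= L * `|u - u'|.
Hypothesis stable : forall u (X : R -> 'rV[R]_k),
  trajectory (fun x => p x u) +oo%E X ->
  forall t, 0 <= t -> `|X t - h u| <= d1 * `|X 0 - h u| * expR (- d2 * t).

Let L0 : 0 <= L. Proof. exact: le_trans L1. Qed.

(* The supremum over the frozen flow is only Lipschitz in (x, u), since p is
   only Lipschitz; this is enough for the one-sided estimates along trajectories. *)
Lemma converse_lyapunov : exists (V : 'rV[R]_k -> 'rV[R]_l -> R) (kappa C : R),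
  [/\ 0 < kappa, 0 < C,
      forall x u, `|x - h u| <= V x u <= C * `|x - h u|,
      forall x u x' u', `|V x u - V x' u'| <= C * (`|x - x'| + `|u - u'|) &
      forall x u (eta : R), 0 < eta -> \forall s \near (0 : R)^'+,
        V (x + s *: p x u) u <= V x u + (- kappa * V x u + eta) * s].
Proof.
have L1' := L1; have L0' := L0; have d1_gt0' := d1_gt0; have d2_gt0' := d2_gt0.
have /choice[Phi HPhi] : forall xu : 'rV[R]_k * 'rV[R]_l, exists X : R -> 'rV[R]_k,
    X 0 = xu.1 /\ forall t : R, 0 <= t -> is_derive t (1 : R) X (p (X t) xu.2).
  by case=> x u; exact: (picard_lindelof x L1 (fun y z => pLx y z u)).
have Phi0 x u : Phi (x, u) 0 = x by have [] := HPhi (x, u).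
have dPhi x u (t : R) : 0 <= t -> is_derive t (1 : R) (Phi (x, u)) (p (Phi (x, u) t) u).
  by have [_] := HPhi (x, u); exact.
have cPhi x u (t : R) : 0 <= t -> {for t, continuous (Phi (x, u))}.
  by move=> t0; exact: is_derive_continuous (dPhi x u t t0).
have decay x u (t : R) : 0 <= t ->
    `|Phi (x, u) t - h u| <= d1 * `|x - h u| * expR (- d2 * t).
  move=> t0; rewrite -{2}(Phi0 x u); apply: stable => //; split => //.
    apply: continuous_in_subspaceT => s; rewrite inE => -[s0 _]; exact: cPhi.
  by move=> s /ltW s0 _; exact: dPhi.
have near_flows x u x' u' (t : R) : 0 <= t -> `|Phi (x, u) t - Phi (x', u') t| <=
    (`|x - x'| + L * `|u - u'| * t) * expR (L * t).
  move=> t0.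
  have := @gronwall R _ L (L * `|u - u'|) (fun s => Phi (x, u) s - Phi (x', u') s)
    (fun s => p (Phi (x, u) s) u - p (Phi (x', u') s) u') L0 (mulr_ge0 L0 (normr_ge0 _)).
  rewrite !Phi0; apply=> //.
  - by move=> s s0; apply: cvgB; exact: cPhi.
  - by move=> s s0; apply: is_derive_right; apply: is_deriveB; exact: dPhi.
  move=> s s0; rewrite -(subrK (p (Phi (x', u') s) u) (p (Phi (x, u) s) u)) -addrA.
  by apply: (le_trans (ler_normD _ _)); rewrite lerD.
(* Both sides solve the same frozen equation from the same point; [gronwall] with [b = 0] makes
   their difference vanish. *)
have semigroup x u (s t : R) : 0 <= s -> 0 <= t ->
    Phi (Phi (x, u) s, u) t = Phi (x, u) (s + t).
  move=> s0 t0; apply/eqP; rewrite -subr_eq0 -normr_le0.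
  have := @gronwall R _ L 0 (fun r => Phi (Phi (x, u) s, u) r - Phi (x, u) (s + r))
    (fun r => p (Phi (Phi (x, u) s, u) r) u - p (Phi (x, u) (s + r)) u) L0 (lexx _).
  rewrite Phi0 addr0 subrr normr0 => H; rewrite (le_trans (H _ _ _ t t0)) ?mul0r ?addr0 ?mul0r //.
  - move=> r r0; apply: cvgB; first exact: cPhi.
    apply: (@continuous_comp _ _ _ (fun r => s + r) (Phi (x, u))).
      by apply: cvgD; [exact: cvg_cst | exact: cvg_id].
    by apply: cPhi; exact: addr_ge0.
  - move=> r r0; apply: right_deriveD; first by apply: is_derive_right; exact: dPhi.
    apply: right_deriveN => e e0.
    have := is_derive_right (dPhi x u _ (addr_ge0 s0 r0)) e0.
    by apply: filterS => q; rewrite addrA.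
  - by move=> r r0; rewrite addr0.
(* Half of the decay rate goes into the weight; the other half still makes the weighted distance
   decay. *)
pose kappa := d2 / 2; have kappa0 : 0 < kappa by rewrite /kappa; lra.
pose gain x u t := expR (kappa * t) * `|Phi (x, u) t - h u|.
have gain0 x u : gain x u 0 = `|x - h u| by rewrite /gain mulr0 expR0 mul1r Phi0.
have gain_ge0 x u t : 0 <= gain x u t by rewrite mulr_ge0 // expR_ge0.
have gain_decay x u (t : R) : 0 <= t -> gain x u t <= d1 * `|x - h u| * expR (- kappa * t).
  move=> t0; rewrite /gain mulrC.
  have -> : - kappa * t = - d2 * t + kappa * t by rewrite /kappa; field.
  by rewrite expRD mulrA ler_wpM2r ?expR_ge0 ?decay.
have gain_le x u (t : R) : 0 <= t -> gain x u t <= d1 * `|x - h u|.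
  move=> t0; apply: (le_trans (gain_decay x u t t0)).
  have h1 : expR (- kappa * t) <= 1.
    by rewrite -expR0 ler_expR mulNr oppr_le0 mulr_ge0 // ltW.
  have h2 : 0 <= d1 * `|x - h u| by rewrite mulr_ge0 // ltW.
  by rewrite -[leRHS]mulr1 ler_wpM2l.
pose S x u := [set gain x u t | t in [set t | 0 <= t]].
have hS x u : has_sup (S x u).
  split; first by exists (gain x u 0); exists 0 => //=.
  by exists (d1 * `|x - h u|) => _ [t /= t0 <-]; exact: gain_le.
pose V x u := sup (S x u).
have V_ge x u (t : R) : 0 <= t -> gain x u t <= V x u.
  by move=> t0; apply: (sup_upper_bound (hS x u)); exists t.
have V_le x u c : (forall t : R, 0 <= t -> gain x u t <= c) -> V x u <= c.
  move=> H; apply: ge_sup; first by exists (gain x u 0); exists 0 => //=.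
  by move=> _ [t /= t0 <-]; exact: H.
have V0 x u : 0 <= V x u by apply: le_trans (V_ge x u 0 (lexx _)).
(* Beyond time T the decay makes the gain smaller than its value at time 0. *)
pose T := d1 / kappa; have T0 : 0 < T by rewrite divr_gt0.
have gain_late x u (t : R) : T <= t -> gain x u t <= `|x - h u|.
  move=> Tt; have t0 : 0 <= t by lra.
  apply: (le_trans (gain_decay x u t t0)).
  rewrite mulrAC ler_piMl // mulNr expRN ler_pdivrMr ?expR_gt0 // mul1r.
  have := expR_ge1Dx (kappa * t).
  have : kappa * T <= kappa * t by rewrite ler_pM2l.
  by rewrite /T mulrCA divff ?gt_eqF // mulr1; lra.
pose G := expR (kappa * T); pose GL := expR (L * T).
have G1 : 1 <= G by rewrite -expR0 ler_expR mulr_ge0 // ltW.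
have GL1 : 1 <= GL by rewrite -expR0 ler_expR mulr_ge0 // ltW.
pose C := G * (GL * (1 + L * T) + L) + L + 1 + d1.
(* After time [T] the gain is at most its value at time 0, which is Lipschitz; up to time [T] the
   two frozen flows stay close by [near_flows], at the price of the constants [G] and [GL]. A bound
   uniform in time passes to the supremum. *)
have lip x u x' u' : V x u <= V x' u' + C * (`|x - x'| + `|u - u'|).
  have LT : 0 <= L * T by rewrite mulr_ge0 // ltW.
  have nx := normr_ge0 (x - x'); have nu := normr_ge0 (u - u').
  have GLT : 0 <= G * (GL * (1 + L * T)) by rewrite !mulr_ge0 //; lra.
  have GL0 : 0 <= G * L by rewrite mulr_ge0 //; lra.
  apply: V_le => t t0; have [tT|/ltW Tt] := leP t T; last first.
    apply: (le_trans (gain_late x u t Tt)).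
    have -> : x - h u = (x - x') + (x' - h u') + (h u' - h u).
      by rewrite !addrA !subrK.
    have := ler_normD (x - x' + (x' - h u')) (h u' - h u).
    have := ler_normD (x - x') (x' - h u').
    have := V_ge x' u' 0 (lexx _); rewrite gain0; have := hL u' u; rewrite (distrC u').
    have : L * `|u - u'| <= C * `|u - u'| by apply: ler_wpM2r => //; rewrite /C; lra.
    have : 1 * `|x - x'| <= C * `|x - x'| by apply: ler_wpM2r => //; rewrite /C; have := L0; lra.
    lra.
  have Eg : expR (kappa * t) <= G by rewrite ler_expR ler_pM2l.
  have El : expR (L * t) <= GL by rewrite ler_expR; apply: ler_wpM2l.
  have Et : 0 < expR (kappa * t) by exact: expR_gt0.
  have N : `|Phi (x, u) t - h u| <= `|Phi (x', u') t - h u'| +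
      (GL * (1 + L * T) + L) * (`|x - x'| + `|u - u'|).
    have -> : Phi (x, u) t - h u = (Phi (x, u) t - Phi (x', u') t) +
        (Phi (x', u') t - h u') + (h u' - h u).
      by rewrite !addrA !subrK.
    have := ler_normD (Phi (x, u) t - Phi (x', u') t + (Phi (x', u') t - h u')) (h u' - h u).
    have := ler_normD (Phi (x, u) t - Phi (x', u') t) (Phi (x', u') t - h u').
    have := hL u' u; rewrite (distrC u').
    have := near_flows x u x' u' t t0.
    have a1 : L * `|u - u'| * t <= L * T * `|u - u'|.
      by rewrite mulrAC; apply: ler_wpM2r => //; apply: ler_wpM2l.
    have a2 : (`|x - x'| + L * `|u - u'| * t) * expR (L * t) <= (`|x - x'| + L * T * `|u - u'|) * GL.
      apply: ler_pM; rewrite ?expR_ge0 ?addr_ge0 ?mulr_ge0 //; lra.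
    have a3 : (`|x - x'| + L * T * `|u - u'|) * GL <= GL * (1 + L * T) * (`|x - x'| + `|u - u'|).
      rewrite mulrC -[leRHS]mulrA; apply: ler_wpM2l; first lra.
      have := mulr_ge0 LT nx; lra.
    have a4 : L * `|u - u'| <= L * (`|x - x'| + `|u - u'|) by apply: ler_wpM2l => //; lra.
    lra.
  have := ler_wpM2l (ltW Et) N; rewrite mulrDr => /le_trans; apply; apply: lerD.
    exact: V_ge.
  rewrite mulrA; apply: ler_wpM2r; first lra.
  apply: (@le_trans _ _ (G * (GL * (1 + L * T) + L))).
    by apply: ler_wpM2r => //; rewrite addr_ge0 // mulr_ge0 //; lra.
  rewrite /C; have := L0; have := d1_gt0; lra.
have C0 : 0 < C.
  rewrite /C ltr_wpDl //; have := mulr_ge0 L0 (ltW T0).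
  have : 0 <= G * (GL * (1 + L * T) + L).
    by rewrite mulr_ge0 ?addr_ge0 ?mulr_ge0 //; have := mulr_ge0 L0 (ltW T0); lra.
  have := L0; lra.
(* By the semigroup law the gains of the shifted orbit are later gains of the original one,
   multiplied by [expR (- kappa * s)]. *)
have V_flow x u (s : R) : 0 <= s -> V (Phi (x, u) s) u <= expR (- kappa * s) * V x u.
  move=> s0; apply: V_le => t t0; rewrite /gain semigroup //.
  have -> : kappa * t = - kappa * s + kappa * (s + t) by ring.
  rewrite expRD -mulrA ler_wpM2l ?expR_ge0 //; apply: V_ge; exact: addr_ge0.
exists V, kappa, C; split => //.
- move=> x u; apply/andP; split; first by rewrite -gain0 V_ge.
  apply: V_le => t t0; apply: (le_trans (gain_le x u t t0)).
  apply: ler_wpM2r => //; rewrite /C lerDr.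
  have : 0 <= G * (GL * (1 + L * T) + L).
    by rewrite mulr_ge0 ?addr_ge0 ?mulr_ge0 //; have := mulr_ge0 L0 (ltW T0); lra.
  have := L0; lra.
- move=> x u x' u'; have := lip x u x' u'; have := lip x' u' x u.
  by rewrite (distrC x') (distrC u') ler_norml; move=> ? ?; apply/andP; split; lra.
move=> x u e e0.
have e2 : 0 < e / 2 by lra.
have e3 : 0 < e / (2 * C) by rewrite divr_gt0 // mulr_gt0.
have := is_derive_right (dPhi x u 0 (lexx _)) e3.
have := dini_leZ (V0 x u) (right_derive_dini (is_derive_right (is_derive_expRM (- kappa) 0))) e2.
rewrite !mulr0 expR0.
apply: filterS3 (nbhs_right_gt 0) => s s0; rewrite !add0r Phi0 => H1 H2.
have := lip (x + s *: p x u) u (Phi (x, u) s) u; rewrite subrr normr0 addr0.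
have := V_flow x u s (ltW s0).
have : C * `|x + s *: p x u - Phi (x, u) s| <= e / 2 * s.
  have -> : e / 2 * s = C * (e / (2 * C) * s) by field; rewrite gt_eqF.
  by apply: ler_wpM2l; [exact: ltW | rewrite -normrN opprB opprD addrA].
lra.
Qed.

End converse_lyapunov.

(** * Consensus *)

Section laplacian.
Variables (R : realType) (N : nat) (E : rel 'I_N) (a : 'I_N -> 'I_N -> R).

(** Weight balance gives the sums of [a i j * e j ^+ 2] and of [a i j * e i ^+ 2] the same value, so
    expanding the squares leaves twice the quadratic form: only the symmetric part of the Laplacian
    counts. *)
Lemma laplacian_energy (e : 'I_N -> R) :
  (forall i, \sum_j a i j = \sum_j a j i) ->
  \sum_i e i * (\sum_j a i j * (e i - e j)) =
  2^-1 * \sum_i \sum_j a i j * (e i - e j) ^+ 2.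
Proof.
move=> bal.
have H : \sum_i \sum_j a i j * e j ^+ 2 = \sum_i \sum_j a i j * e i ^+ 2.
  rewrite exchange_big /=; apply: eq_bigr => i _.
  by rewrite -!mulr_suml bal.
have -> : \sum_i \sum_j a i j * (e i - e j) ^+ 2 =
    2 * \sum_i \sum_j a i j * e i ^+ 2 - 2 * \sum_i \sum_j a i j * (e i * e j).
  rewrite mulrDl mul1r -{2}H !mulr_sumr -sumrN -!big_split /=.
  apply: eq_bigr => i _; rewrite mulr_sumr -!big_split /= -sumrB.
  by apply: eq_bigr => j _; ring.
rewrite mulrBr !mulrA mulVf ?pnatr_eq0 // !mul1r -sumrB; apply: eq_bigr => i _.
by rewrite mulr_sumr -sumrB; apply: eq_bigr => j _; ring.
Qed.

(** Induction along the path. The edge from [i] to [k] has its own term in the energy, with weight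
    [a k i], and the square of a sum is at most twice the sum of the squares, which joins this edge
    to the rest of the path. *)
Lemma path_energy i j : (forall i j, (E j i -> 0 < a i j) /\ (~~ E j i -> a i j = 0)) ->
  connect E i j ->
  exists2 c : R, 0 < c & forall e : 'I_N -> R,
    (e i - e j) ^+ 2 <= c * \sum_i \sum_j a i j * (e i - e j) ^+ 2.
Proof.
move=> wa /connectP[s ps ->] {j}.
have a0 k l : 0 <= a k l.
  have [h1 h2] := wa k l; have [/h1/ltW//|/h2->//] := boolP (E l k).
have D0 (e : 'I_N -> R) : 0 <= \sum_i \sum_j a i j * (e i - e j) ^+ 2.
  by apply: sumr_ge0 => k _; apply: sumr_ge0 => l _; rewrite mulr_ge0 // sqr_ge0.
elim: s i ps => [|k s IH] i /= => [_|/andP[Eik ps]].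
  by exists 1 => // e; rewrite subrr expr0n mul1r.
have [c c0 Hc] := IH k ps.
have aki : 0 < a k i by have [h _] := wa k i; exact: h.
exists (2 * (a k i)^-1 + 2 * c) => [|e].
  by rewrite addr_gt0 // mulr_gt0 // invr_gt0.
have h1 : (e k - e i) ^+ 2 <= (a k i)^-1 * \sum_i \sum_j a i j * (e i - e j) ^+ 2.
  rewrite mulrC ler_pdivlMr // mulrC (bigD1 k) //= (bigD1 i) //= -addrA lerDl.
  apply: addr_ge0; first by apply: sumr_ge0 => l _; rewrite mulr_ge0 // sqr_ge0.
  by apply: sumr_ge0 => k' _; apply: sumr_ge0 => l _; rewrite mulr_ge0 // sqr_ge0.
have := Hc e; set D := \sum_i _ in h1 *; set z := e (last k s).
have : 0 <= ((e i - e k) - (e k - z)) ^+ 2 by exact: sqr_ge0.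
move: h1; set ak := (a k i)^-1 * D; move=> h1 h2 h3.
have -> : (2 * (a k i)^-1 + 2 * c) * D = 2 * ak + 2 * (c * D) by rewrite /ak; ring.
by nra.
Qed.

(** A Poincare inequality. Strong connectivity bounds every [(e i - e j) ^+ 2] by the energy, and
    for zero sum the total over all pairs is [2 * N%:R * \sum_i e i ^+ 2]. The constant [K^-1] is
    far from the optimal eigenvalue, but any positive one will do. *)
Lemma spectral_gap : network_assumption E a ->
  exists2 lambda : R, 0 < lambda & forall e : 'I_N -> R, \sum_i e i = 0 ->
    lambda * \sum_i e i ^+ 2 <= \sum_i e i * (\sum_j a i j * (e i - e j)).
Proof.
move=> [wa conn bal].
have /choice[c Hc] : forall ij : 'I_N * 'I_N, exists c : R, 0 < c /\ forall e : 'I_N -> R,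
    (e ij.1 - e ij.2) ^+ 2 <= c * \sum_i \sum_j a i j * (e i - e j) ^+ 2.
  by move=> [i j]; have [c c0 H] := path_energy wa (conn i j); exists c.
pose K := 1 + \sum_i \sum_j c (i, j).
have K0 : 0 < K.
  rewrite /K ltr_pwDl //; apply: sumr_ge0 => i _; apply: sumr_ge0 => j _.
  by have [/ltW] := Hc (i, j).
exists K^-1 => [|e e0]; first by rewrite invr_gt0.
rewrite laplacian_energy //; set D := \sum_i \sum_j a i j * _.
have D0 : 0 <= D.
  apply: sumr_ge0 => k _; apply: sumr_ge0 => l _; rewrite mulr_ge0 ?sqr_ge0 //.
  by have [h1 h2] := wa k l; have [/h1/ltW//|/h2->//] := boolP (E l k).
have h1 : \sum_i \sum_j (e i - e j) ^+ 2 = 2 * N%:R * \sum_i e i ^+ 2.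
  have -> : \sum_i \sum_j (e i - e j) ^+ 2 = \sum_i (N%:R * e i ^+ 2 + \sum_j e j ^+ 2).
    apply: eq_bigr => i _.
    have -> : \sum_j (e i - e j) ^+ 2 =
        \sum_(j < N) e i ^+ 2 + \sum_j e j ^+ 2 - 2 * e i * \sum_j e j.
      by rewrite mulr_sumr -big_split /= -sumrB; apply: eq_bigr => j _; ring.
    by rewrite e0 mulr0 subr0 sumr_const card_ord mulr_natl.
  rewrite big_split /= -mulr_sumr sumr_const card_ord -[_ *+ N]mulr_natl; ring.
have h2 : \sum_i \sum_j (e i - e j) ^+ 2 <= K * D.
  apply: (@le_trans _ _ ((\sum_i \sum_j c (i, j)) * D)).
    rewrite mulr_suml; apply: ler_sum => i _; rewrite mulr_suml; apply: ler_sum => j _.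
    by have [_] := Hc (i, j); exact.
  by rewrite ler_wpM2r // /K lerDr.
rewrite mulrC ler_pdivrMr //.
have [N0|N0] := posnP N.
  have -> : \sum_i e i ^+ 2 = 0.
    by rewrite big1 // => i _; have := leq_ltn_trans (leq0n i) (ltn_ord i); rewrite lt0n N0.
  by rewrite !mulr_ge0 // ltW.
have N1 : 1 <= N%:R :> R by rewrite ler1n.
have S0 : 0 <= \sum_i e i ^+ 2 by apply: sumr_ge0 => i _; exact: sqr_ge0.
by move: h2; rewrite h1; move: (\sum_i _) S0 => S S0; nra.
Qed.

End laplacian.

(** * Dispersion under Laplacian feedback with a disturbance *)

Section consensus.
Variable R : realType.

Definition sqn d (v : 'rV[R]_d) : R := \sum_j v 0 j ^+ 2.

Lemma sqn_ge0 d (v : 'rV[R]_d) : 0 <= sqn v.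
Proof. by apply: sumr_ge0 => j _; exact: sqr_ge0. Qed.

Lemma sqn_le d (v : 'rV[R]_d) : sqn v <= d%:R * `|v| ^+ 2.
Proof.
rewrite /sqn mulr_natl -[X in _ *+ X]card_ord -sumr_const; apply: ler_sum => j _.
by rewrite -real_normK ?num_real // lerXn2r ?nnegrE ?coord_norm_le.
Qed.

Lemma norm_sqn d (v : 'rV[R]_d) : `|v| ^+ 2 <= sqn v.
Proof.
have H j : `|v 0 j| <= Num.sqrt (sqn v).
  rewrite -sqrtr_sqr ler_wsqrtr // /sqn (bigD1 j) //= lerDl.
  by apply: sumr_ge0 => k _; exact: sqr_ge0.
rewrite -[leRHS](sqr_sqrtr (sqn_ge0 v)) lerXn2r ?nnegrE ?sqrtr_ge0 //.
by apply: rV_norm_le => //; exact: sqrtr_ge0.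
Qed.

Definition mean N d (xi : 'I_N -> 'rV[R]_d) : 'rV[R]_d := N%:R^-1 *: \sum_i xi i.

Definition dispersion N d (xi : 'I_N -> 'rV[R]_d) : R := \sum_i sqn (xi i - mean xi).

Lemma sum_sub_mean N d (xi : 'I_N -> 'rV[R]_d) : (0 < N)%N -> \sum_i (xi i - mean xi) = 0.
Proof.
move=> N0; rewrite sumrB sumr_const card_ord -scaler_nat /mean scalerA divff ?scale1r ?subrr //.
by rewrite pnatr_eq0 -lt0n.
Qed.

(** The mean minimizes the sum of squared distances. Hence the mean can be frozen at time [t] when
    the dispersion at [t + s] is bounded, and is never differentiated. *)
Lemma dispersion_le N d (xi : 'I_N -> 'rV[R]_d) (c : 'rV[R]_d) : (0 < N)%N ->
  dispersion xi <= \sum_i sqn (xi i - c).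
Proof.
move=> N0; rewrite /dispersion /sqn exchange_big [leRHS]exchange_big /=.
apply: ler_sum => j _.
have -> : \sum_i (xi i - c) 0 j ^+ 2 = \sum_i (xi i - mean xi) 0 j ^+ 2 +
    (2 * (mean xi - c) 0 j * (\sum_i (xi i - mean xi) 0 j) +
     N%:R * (mean xi - c) 0 j ^+ 2).
  have -> : N%:R * (mean xi - c) 0 j ^+ 2 = \sum_(i < N) (mean xi - c) 0 j ^+ 2.
    by rewrite sumr_const card_ord mulr_natl.
  rewrite mulr_sumr -!big_split /=.
  by apply: eq_bigr => i _; rewrite !mxE; ring.
have -> : \sum_i (xi i - mean xi) 0 j = 0.
  by have := congr1 (fun M : 'rV[R]_d => M 0 j) (sum_sub_mean xi N0); rewrite summxE mxE.
by rewrite mulr0 add0r lerDl mulr_ge0 // sqr_ge0.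
Qed.

(** The cross term of [e] with [b] is split by Young's inequality with weight [theta * s]; when [b]
    is of order [s], both resulting terms are again of order [s]. The squares of [del] and [b] are
    then of second order. *)
Lemma quadratic_step (I : finType) (e v del b : I -> R) (s theta eta M : R) :
  0 < s -> 0 < theta -> (forall q, `|del q - s * v q| <= eta * s) ->
  (forall q, `|del q| <= M * s) ->
  \sum_q (e q + del q + b q) ^+ 2 <=
    \sum_q e q ^+ 2 + 2 * s * (\sum_q e q * v q) + 2 * eta * s * (\sum_q `|e q|)
    + theta * s * (\sum_q e q ^+ 2) + (theta * s)^-1 * (\sum_q b q ^+ 2)
    + 2 * #|I|%:R * M ^+ 2 * s ^+ 2 + 2 * (\sum_q b q ^+ 2).
Proof.
move=> s0 t0 H1 H2.
have -> : 2 * #|I|%:R * M ^+ 2 * s ^+ 2 = \sum_(q : I) 2 * (M * s) ^+ 2.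
  by rewrite sumr_const -mulr_natl; ring.
rewrite !mulr_sumr -!big_split /=; apply: ler_sum => q _.
have := H1 q; have := H2 q; move: (e q) (v q) (del q) (b q) => x y z w h2 h1.
have ts : 0 < theta * s by rewrite mulr_gt0.
have k1 : 2 * (x * w) <= theta * s * x ^+ 2 + (theta * s)^-1 * w ^+ 2.
  have : 0 <= (theta * s)^-1 * (theta * s * x - w) ^+ 2.
    by rewrite mulr_ge0 ?sqr_ge0 // invr_ge0 ltW.
  have -> : (theta * s)^-1 * (theta * s * x - w) ^+ 2 =
    theta * s * x ^+ 2 + (theta * s)^-1 * w ^+ 2 - 2 * (x * w).
    by field; rewrite !gt_eqF.
  lra.
have k2 : x * (z - s * y) <= eta * s * `|x|.
  rewrite (le_trans (ler_norm _)) // normrM mulrC; exact: ler_wpM2r.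
have k3 : z ^+ 2 <= (M * s) ^+ 2.
  rewrite -(real_normK (num_real z)); apply: lerXn2r => //; rewrite nnegrE //.
  exact: le_trans h2.
have k4 : 0 <= (z - w) ^+ 2 by exact: sqr_ge0.
nra.
Qed.

(** [c] follows the Laplacian feedback with gain [k], and [g] is a disturbance known only by the
    squared size of its increments: for the second tracker it is a partial gradient of the costs,
    merely Lipschitz. The feedback contributes the rate [- 2 * (k * lambda)]; Young's inequality
    with [theta = k * lambda] gives half of it back and leaves the forcing [l2 / (k * lambda)]. *)
Lemma consensus_dini N d (E : rel 'I_N) (a : 'I_N -> 'I_N -> R) (lambda k : R)
    (c g : 'I_N -> R -> 'rV[R]_d) (t l2 : R) :
  (0 < N)%N -> 0 < lambda -> 0 < k -> 0 <= l2 ->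
  (forall e : 'I_N -> R, \sum_i e i = 0 ->
    lambda * \sum_i e i ^+ 2 <= \sum_i e i * (\sum_j a i j * (e i - e j))) ->
  let xi i s := c i s + g i s in
  (forall i, right_derive (c i) t (- (k *: \sum_j a i j *: (xi i t - xi j t)))) ->
  (forall eta : R, 0 < eta -> \forall s \near (0 : R)^'+,
     \sum_i sqn (g i (t + s) - g i t) <= (l2 + eta) * s ^+ 2) ->
  dini_le (fun s => dispersion (xi^~ s)) t
    (- (k * lambda) * dispersion (xi^~ t) + (k * lambda)^-1 * l2).
Proof.
move=> N0 lam0 k0 l20 gap xi dc dg eta eta0.
pose I : finType := ('I_N * 'I_d)%type.
pose m := mean (xi^~ t).
pose v i := - (k *: \sum_j a i j *: (xi i t - xi j t)).
pose e (q : I) := (xi q.1 t - m) 0 q.2.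
pose vv (q : I) := v q.1 0 q.2.
have sqnE (y : 'I_N -> 'rV[R]_d) : \sum_i sqn (y i) = \sum_(q : I) y q.1 0 q.2 ^+ 2.
  by rewrite /sqn pair_big.
have kl : 0 < k * lambda by rewrite mulr_gt0.
pose D := dispersion (xi^~ t).
have DE : D = \sum_(q : I) e q ^+ 2 by rewrite /D /dispersion sqnE.
have ev : \sum_(q : I) e q * vv q <= - (k * lambda) * D.
  rewrite DE -(pair_big xpredT xpredT (fun i j => e (i, j) * vv (i, j))) /=.
  rewrite -(pair_big xpredT xpredT (fun i j => e (i, j) ^+ 2)) /=.
  rewrite exchange_big [X in _ <= _ * X]exchange_big /= mulr_sumr; apply: ler_sum => j _.
  have z : \sum_i e (i, j) = 0.
    have := congr1 (fun M : 'rV[R]_d => M 0 j) (sum_sub_mean (xi^~ t) N0).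
    by rewrite summxE mxE.
  have -> : \sum_i e (i, j) * vv (i, j) =
      - k * \sum_i e (i, j) * (\sum_j' a i j' * (e (i, j) - e (j', j))).
    rewrite mulr_sumr; apply: eq_bigr => i _; rewrite /vv /v /= !mxE summxE.
    rewrite mulrCA mulNr; congr (_ * - (_ * _)); apply: eq_bigr => j' _.
    by rewrite /e !mxE /=; ring.
  by rewrite mulNr mulNr lerN2 -mulrA ler_pM2l //; exact: gap.
pose M := 1 + \sum_i `|v i|.
have M0 : 1 <= M by rewrite lerDl sumr_ge0.
pose B := 1 + \sum_(q : I) `|e q|.
have B0 : 1 <= B by rewrite lerDl sumr_ge0.
pose K := 2 * #|I|%:R * M ^+ 2 + 2 * (l2 + 1).
have K0 : 0 < K.
  by rewrite /K ltr_wpDl ?mulr_ge0 ?sqr_ge0 //; lra.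
(* A quarter of [eta] each covers the differentiation error [e1], the excess [e2] over [l2], and the
   second-order terms collected in [K]. *)
pose e1 := Num.min 1 (eta / (4 * (2 * B))).
have e10 : 0 < e1 by rewrite lt_min ltr01 divr_gt0 // mulr_gt0 //; lra.
have e11 : e1 <= 1 by rewrite ge_min lexx.
have e12 : 2 * e1 * \sum_(q : I) `|e q| <= eta / 4.
  have : e1 <= eta / (4 * (2 * B)) by rewrite ge_min lexx orbT.
  rewrite ler_pdivlMr; last by lra.
  have : 0 <= e1 by exact: ltW.
  rewrite /B; lra.
pose e2 := Num.min 1 (k * lambda * (eta / 4)).
have e20 : 0 < e2 by rewrite lt_min ltr01 mulr_gt0 // divr_gt0.
have e21 : e2 <= 1 by rewrite ge_min lexx.
have e22 : (k * lambda)^-1 * e2 <= eta / 4.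
  by rewrite mulrC ler_pdivrMr // mulrC ge_min lexx orbT.
have dcall : \forall s \near (0 : R)^'+, forall i, `|c i (t + s) - c i t - s *: v i| <= e1 * s.
  by apply: filter_forall => i; exact: dc.
have s_small : \forall s \near (0 : R)^'+, s < eta / (4 * K).
  by apply: nbhs_right_lt; rewrite divr_gt0 // mulr_gt0.
have := dg _ e20.
apply: filterS3 (filterI (nbhs_right_gt 0) dcall) s_small => s [s0 Hc] sK Hg.
rewrite -/D.
apply: (le_trans (dispersion_le _ m N0)); rewrite sqnE.
pose del (q : I) := (c q.1 (t + s) - c q.1 t) 0 q.2.
pose b (q : I) := (g q.1 (t + s) - g q.1 t) 0 q.2.
have -> : \sum_(q : I) (xi q.1 (t + s) - m) 0 q.2 ^+ 2 = \sum_q (e q + del q + b q) ^+ 2.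
  by apply: eq_bigr => q _; congr (_ ^+ 2); rewrite /e /del /b /xi !mxE; ring.
have bE : \sum_q b q ^+ 2 = \sum_i sqn (g i (t + s) - g i t) by rewrite sqnE.
have h1 q : `|del q - s * vv q| <= e1 * s.
  apply: le_trans (Hc q.1); rewrite /del /vv.
  have := coord_norm_le (c q.1 (t + s) - c q.1 t - s *: v q.1) 0 q.2.
  by rewrite [X in `|X| <= _]mxE [X in `|_ + X| <= _]mxE [X in `|_ - X| <= _]mxE.
have h2 q : `|del q| <= M * s.
  rewrite -[del q](subrK (s * vv q)); apply: (le_trans (ler_normD _ _)).
  have := h1 q; have -> : `|s * vv q| = s * `|vv q| by rewrite normrM gtr0_norm.
  have : `|vv q| <= \sum_i `|v i|.
    apply: (le_trans (coord_norm_le _ _ _)).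
    by rewrite (bigD1 q.1) //= lerDl sumr_ge0.
  rewrite /M; move: (\sum_i _) (`|vv q|) => S w; nra.
have := quadratic_step e b s0 kl h1 h2; rewrite bE -DE => /le_trans; apply.
move: Hg; set G := \sum_i sqn _ => Hg.
have G0 : 0 <= G by apply: sumr_ge0 => i _; exact: sqn_ge0.
have k1 : (k * lambda * s)^-1 * G <= ((k * lambda)^-1 * l2 + eta / 4) * s.
  apply: (@le_trans _ _ ((k * lambda * s)^-1 * ((l2 + e2) * s ^+ 2))).
    by rewrite ler_wpM2l // invr_ge0 mulr_ge0 // ltW.
  have -> : (k * lambda * s)^-1 * ((l2 + e2) * s ^+ 2) = ((k * lambda)^-1 * l2 + (k * lambda)^-1 * e2) * s.
    by field; rewrite !gt_eqF.
  by rewrite ler_pM2r // lerD2l.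
have k2 : 2 * #|I|%:R * M ^+ 2 * s ^+ 2 + 2 * G <= eta / 4 * s.
  have : s * (4 * K) < eta by rewrite -ltr_pdivlMr // mulr_gt0.
  have : (l2 + e2) * s ^+ 2 <= (l2 + 1) * s ^+ 2 by rewrite ler_wpM2r ?sqr_ge0 // lerD2l.
  have -> : 4 * K = 8 * (#|I|%:R * M ^+ 2) + 8 * (l2 + 1) by rewrite /K; ring.
  rewrite -[2 * #|I|%:R * _]mulrA; move: (#|I|%:R * M ^+ 2) => P a1 a2.
  have : s * (s * (8 * P + 8 * (l2 + 1))) <= s * eta by rewrite ler_pM2l // ltW.
  lra.
have k3 : s * (\sum_q e q * vv q) <= s * (- (k * lambda) * D) by rewrite ler_pM2l.
have k4 : s * (2 * e1 * \sum_q `|e q|) <= s * (eta / 4) by rewrite ler_pM2l.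
have k5 : 0 < eta * s by rewrite mulr_gt0.
lra.
Qed.

End consensus.

(** * Chain rule and gradients *)

Section chain_rule.
Variable R : realType.

Lemma right_derive_unique (V : normedModType R) (x : R -> V) t v w :
  right_derive x t v -> right_derive x t w -> v = w.
Proof.
move=> h1 h2; apply/eqP; rewrite -subr_eq0 -normr_le0; apply/ler_addgt0Pr => e e0.
have e2 : 0 < e / 2 by lra.
have : \forall s \near (0 : R)^'+, [/\ `|x (t + s) - x t - s *: v| <= e / 2 * s,
    `|x (t + s) - x t - s *: w| <= e / 2 * s & 0 < s].
  by apply: filterS3 (nbhs_right_gt 0) (h1 _ e2) (h2 _ e2).
move=> /filter_ex[s []].
rewrite add0r => H1 H2 s0; rewrite -(ler_pM2l s0) -{1}(gtr0_norm s0) -normrZ.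
have -> : s *: (v - w) = (x (t + s) - x t - s *: w) - (x (t + s) - x t - s *: v).
  by rewrite scalerBr opprB [RHS]addrC addrA subrK.
by apply: (le_trans (ler_normB _ _)); lra.
Qed.

Lemma right_derive_comp (V W : normedModType R) (g : V -> W) (x : R -> V) t v :
  differentiable g (x t) -> right_derive x t v ->
  right_derive (g \o x) t ('d g (x t) v).
Proof.
move=> dg dx e e0.
have [k k0 Hk] := linear_lipschitz (diff_continuous dg).
have N0 : 0 < 2 * (`|v| + 1) by have := normr_ge0 v; lra.
have e1 : 0 < e / (2 * (`|v| + 1)) by rewrite divr_gt0.
have e2 : 0 < e / (2 * k) by rewrite divr_gt0 // mulr_gt0.
have /eqaddoP/(_ _ e1) := diff_locally dg.
move=> /nbhs_normP[r /= r0 Hr].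
have sr : \forall s \near (0 : R)^'+, s < r / (`|v| + 1).
  by apply: nbhs_right_lt; rewrite divr_gt0 //; lra.
have := dx _ e2; have := right_derive_near_norm dx ltr01.
apply: filterS3 (filterI (nbhs_right_gt 0) sr) => s [s0 {}sr] H1 H2 /=.
set y := x (t + s) - x t in H1 H2.
have yr : `|y| < r.
  apply: (le_lt_trans H1); rewrite mulrC -ltr_pdivlMr //.
have := Hr y; rewrite /= sub0r normrN => /(_ yr).
rewrite [X in `|X| <= _](_ : _ = g (x (t + s)) - (g (x t) + 'd g (x t) y)); last first.
  by rewrite -[in RHS](subrK (x t) (x (t + s))).
move=> H3.
have -> : g (x (t + s)) - g (x t) - s *: 'd g (x t) v =
  (g (x (t + s)) - (g (x t) + 'd g (x t) y)) + ('d g (x t) (y - s *: v)).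
  have -> : 'd g (x t) (y - s *: v) = 'd g (x t) y - s *: 'd g (x t) v.
    by rewrite linearD linearN linearZ.
  by rewrite opprD !addrA subrK.
apply: (le_trans (ler_normD _ _)).
have -> : e * s = e / (2 * (`|v| + 1)) * ((`|v| + 1) * s) + k * (e / (2 * k) * s).
  have := normr_ge0 v; move=> v0; field; rewrite !gt_eqF //; lra.
apply: lerD.
  by apply: (le_trans H3); apply: ler_wpM2l => //; exact: ltW.
apply: (le_trans (Hk _)); apply: ler_wpM2l => //; exact: ltW.
Qed.

Definition dot k (u v : 'rV[R]_k) : R := (u *m v^T) 0 0.

Lemma dotE k (u v : 'rV[R]_k) : dot u v = \sum_j u 0 j * v 0 j.
Proof. by rewrite /dot mxE; apply: eq_bigr => j _; rewrite mxE. Qed.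

Lemma dot_mulmx a b (u : 'rV[R]_a) (A : 'M[R]_(a, b)) (v : 'rV[R]_b) :
  dot (u *m A) v = dot u (v *m A^T).
Proof. by rewrite /dot trmx_mul trmxK mulmxA. Qed.

Lemma dot_mxrow N (n : 'I_N -> nat) (u v : 'rV[R]_(\sum_i n i)) :
  dot u v = \sum_i dot (submxrow u i) (submxrow v i).
Proof.
rewrite -{1}(submxrowK u) -{1}(submxrowK v) /dot tr_mxrow mul_mxrow_mxcol summxE.
by [].
Qed.

Lemma dotC k (u v : 'rV[R]_k) : dot u v = dot v u.
Proof. by rewrite !dotE; apply: eq_bigr => j _; rewrite mulrC. Qed.

Lemma dotDl k (u v w : 'rV[R]_k) : dot (u + v) w = dot u w + dot v w.
Proof. by rewrite /dot mulmxDl mxE. Qed.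

Lemma dotDr k (u v w : 'rV[R]_k) : dot w (u + v) = dot w u + dot w v.
Proof. by rewrite dotC dotDl !(dotC w). Qed.

Lemma dotZl k (c : R) (u v : 'rV[R]_k) : dot (c *: u) v = c * dot u v.
Proof. by rewrite /dot -scalemxAl mxE. Qed.

Lemma dot_suml k (I : finType) (u : I -> 'rV[R]_k) v : dot (\sum_i u i) v = \sum_i dot (u i) v.
Proof. by rewrite /dot mulmx_suml summxE. Qed.

Lemma dot_sqn k (u : 'rV[R]_k) : dot u u = sqn u.
Proof. by rewrite dotE; apply: eq_bigr => j _; rewrite expr2. Qed.

Lemma sqn_mxrow N (n : 'I_N -> nat) (u : 'rV[R]_(\sum_i n i)) :
  sqn u = \sum_i sqn (submxrow u i).
Proof. by rewrite -dot_sqn dot_mxrow; apply: eq_bigr => i _; rewrite dot_sqn. Qed.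

Lemma dot_delta k (v : 'rV[R]_k) j : dot (delta_mx 0 j) v = v 0 j.
Proof. by rewrite /dot -rowE !mxE. Qed.

Lemma diff_grad k (g : 'rV[R]_k -> R) x v : differentiable g x ->
  'd g x v = dot v (grad g x).
Proof.
move=> dg; rewrite dotE {1}(row_sum_delta v) linear_sum; apply: eq_bigr => j _.
by rewrite linearZ /= /grad mxE deriveE.
Qed.

Lemma right_derive_line (V : normedModType R) (x v : V) :
  right_derive (fun s => x + s *: v) 0 v.
Proof.
move=> e e0; apply: filterS (nbhs_right_gt 0) => s s0.
by rewrite add0r scale0r addr0 (addrC x) addrK subrr normr0 mulr_ge0 // ltW.
Qed.

(** One-sided derivatives along lines determine the gradient, so the same chain rule for
    [right_derive] serves for gradient formulas and along trajectories. *)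
Lemma grad_unique k (g : 'rV[R]_k -> R) x G : differentiable g x ->
  (forall v, right_derive (fun s => g (x + s *: v)) 0 (dot v G)) -> grad g x = G.
Proof.
move=> dg H; apply/rowP => j; rewrite -[RHS]dot_delta.
apply: right_derive_unique (H (delta_mx 0 j)).
rewrite -dot_delta -diff_grad //.
have := @right_derive_comp _ _ g (fun s : R => x + s *: delta_mx 0 j) 0 (delta_mx 0 j).
by rewrite scale0r addr0; apply => //; exact: right_derive_line.
Qed.

Lemma right_derive_pair (V W : normedModType R) (x : R -> V) (y : R -> W) t v w :
  right_derive x t v -> right_derive y t w ->
  right_derive (fun s => (x s, y s)) t (v, w).
Proof.
move=> h1 h2 e e0; have := h2 _ e0; have := h1 _ e0; apply: filterS2 => s H1 H2.
by rewrite prod_normE /= ge_max H1.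
Qed.

Lemma right_derive_fst (V W : normedModType R) (x : R -> V * W) t v :
  right_derive x t v -> right_derive (fun s => (x s).1) t v.1.
Proof.
move=> h e e0; have := h _ e0; apply: filterS => s; apply: le_trans.
by rewrite [leRHS]prod_normE /= le_max lexx.
Qed.

Lemma right_derive_snd (V W : normedModType R) (x : R -> V * W) t v :
  right_derive x t v -> right_derive (fun s => (x s).2) t v.2.
Proof.
move=> h e e0; have := h _ e0; apply: filterS => s; apply: le_trans.
by rewrite [leRHS]prod_normE /= le_max lexx orbT.
Qed.

Lemma submxrowZ N (n : 'I_N -> nat) (c : R) (u : 'rV[R]_(\sum_i n i)) i :
  submxrow (c *: u) i = c *: submxrow u i.
Proof. by apply/rowP => j; rewrite !mxE. Qed.

Lemma submxrow_norm N (n : 'I_N -> nat) (u : 'rV[R]_(\sum_i n i)) i :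
  `|submxrow u i| <= `|u|.
Proof. by apply: rV_norm_le => // j; rewrite mxE coord_norm_le. Qed.

Lemma mxrow_norm_le N (n : 'I_N -> nat) (B : forall i, 'rV[R]_(n i)) (e : R) :
  0 <= e -> (forall i, `|B i| <= e) -> `|\mxrow_i B i| <= e.
Proof.
move=> e0 H; apply: rV_norm_le => // j; rewrite mxE.
by apply: le_trans (H (tagnat.sig1 j)); exact: coord_norm_le.
Qed.

Lemma right_derive_submxrow N (n : 'I_N -> nat) (x : R -> 'rV[R]_(\sum_i n i)) t v i :
  right_derive x t v -> right_derive (fun s => submxrow (x s) i) t (submxrow v i).
Proof.
move=> h e e0; have := h _ e0; apply: filterS => s; apply: le_trans.
by rewrite -submxrowZ -!submxrowB submxrow_norm.
Qed.

Lemma right_derive_mxrow N (n : 'I_N -> nat) (x : forall i, R -> 'rV[R]_(n i)) t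
    (v : forall i, 'rV[R]_(n i)) :
  (forall i, right_derive (x i) t (v i)) ->
  right_derive (fun s => \mxrow_i x i s) t (\mxrow_i v i).
Proof.
move=> h e e0.
have : \forall s \near (0 : R)^'+, forall i, `|x i (t + s) - x i t - s *: v i| <= e * s.
  by apply: filter_forall => i; exact: h.
apply: filterS2 (nbhs_right_gt 0) => s s0 H.
have -> : s *: (\mxrow_i v i) = \mxrow_i (s *: v i) by apply/rowP => j; rewrite !mxE.
by rewrite -!mxrowB; apply: mxrow_norm_le => //; rewrite mulr_ge0 // ltW.
Qed.

Lemma right_derive_sum (V : normedModType R) (I : Type) (r : seq I) (P : pred I)
    (x : I -> R -> V) t (v : I -> V) :
  (forall i, right_derive (x i) t (v i)) ->
  right_derive (fun s => \sum_(i <- r | P i) x i s) t (\sum_(i <- r | P i) v i).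
Proof.
move=> H; elim: r => [|i r IH].
  move=> e e0; apply: filterS (nbhs_right_gt 0) => s s0.
  by rewrite !big_nil scaler0 !subrr normr0 mulr_ge0 // ltW.
rewrite big_cons; case: ifPn => Pi.
  have := right_deriveD (H i) IH; congr right_derive.
  by apply: funext => x0; rewrite big_cons Pi.
move: IH; congr right_derive.
by apply: funext => x0; rewrite big_cons (negbTE Pi).
Qed.

Lemma right_deriveZ (V : normedModType R) (x : R -> V) t v (c : R) :
  right_derive x t v -> right_derive (fun s => c *: x s) t (c *: v).
Proof.
move=> h e e0; have e1 : 0 < e / (`|c| + 1) by rewrite divr_gt0 // ltr_wpDl.
have := h _ e1; apply: filterS2 (nbhs_right_gt 0) => s s0 H.
rewrite scalerA mulrC -scalerA -!scalerBr normrZ.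
apply: (le_trans (ler_wpM2l (normr_ge0 c) H)); rewrite mulrA; apply: ler_wpM2r; first exact: ltW.
have c0 := normr_ge0 c; rewrite mulrA ler_pdivrMr; last lra.
by nra.
Qed.

End chain_rule.

Section gradients.
Variables (R : realType) (N d : nat) (n m : 'I_N -> nat).
Variable h : forall i, 'rV[R]_(m i) -> 'rV[R]_(n i).
Variable f : forall i, 'rV[R]_(n i) -> 'rV[R]_d -> R.
Variable phi : forall i, 'rV[R]_(n i) -> 'rV[R]_d.
Hypothesis df : forall i (xy : 'rV[R]_(n i) * 'rV[R]_d),
  differentiable (fun xy' : 'rV[R]_(n i) * 'rV[R]_d => f xy'.1 xy'.2) xy.
Hypothesis dphi : forall i (x : 'rV[R]_(n i)), differentiable (@phi i) x.
Hypothesis dh : forall i (u : 'rV[R]_(m i)), differentiable (@h i) u.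

Lemma diff_nabla a b (g : 'rV[R]_a -> 'rV[R]_b) x v : 'd g x v = v *m nabla g x.
Proof. by rewrite /nabla /jacobian mul_rV_lin1. Qed.

Lemma differentiable_submxrow k (q : 'I_k -> nat) i (x : 'rV[R]_(\sum_i q i)) :
  differentiable (fun y : 'rV[R]_(\sum_i q i) => submxrow y i) x.
Proof.
have lin : linear (fun y : 'rV[R]_(\sum_i q i) => submxrow y i : 'rV[R]_(q i)).
  by move=> c y z; rewrite submxrowD submxrowZ.
pose L := GRing.isLinear.Build _ _ _ _ _ lin.
pose Lin : {linear 'rV[R]_(\sum_i q i) -> 'rV[R]_(q i)} := HB.pack (fun y => submxrow y i) L.
have -> : (fun y => submxrow y i) = Lin by [].
apply: linear_differentiable.
apply: (@lipschitz_continuous _ _ _ _ 1) => y z.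
by rewrite mul1r -submxrowB submxrow_norm.
Qed.

Lemma differentiable_sigma (x : 'rV[R]_(\sum_i n i)) : differentiable (sigma phi) x.
Proof.
rewrite /sigma; apply: differentiableZ.
rewrite [X in differentiable X _](_ : _ =
    \sum_i (fun x0 : 'rV[R]_(\sum_i n i) => phi (submxrow x0 i))); last first.
  by apply/funext => y; rewrite fct_sumE.
apply: differentiable_sum => i.
apply: (@differentiable_comp _ _ _ _ (fun y => submxrow y i) (@phi i)) => //.
exact: differentiable_submxrow.
Qed.

Lemma differentiable_Fsigma x : differentiable (Fsigma f phi) x.
Proof.
have -> : Fsigma f phi = \sum_i (fun x0 => f (submxrow x0 i) (sigma phi x0)).
  by apply/funext => y; rewrite fct_sumE.
apply: differentiable_sum => i.
apply: (@differentiable_comp _ _ _ _ (fun y => (submxrow y i, sigma phi y))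
  (fun xy : 'rV[R]_(n i) * 'rV[R]_d => f xy.1 xy.2)); last exact: df.
by apply: differentiable_pair; [exact: differentiable_submxrow | exact: differentiable_sigma].
Qed.

Lemma right_derive_cst (V : normedModType R) (x : V) t : right_derive (fun=> x) t (0 : V).
Proof.
move=> e e0; apply: filterS (nbhs_right_gt 0) => s s0.
by rewrite subrr scaler0 subrr normr0 mulr_ge0 // ltW.
Qed.

Lemma diff_f i (x v : 'rV[R]_(n i)) (y w : 'rV[R]_d) :
  'd (fun xy : 'rV[R]_(n i) * 'rV[R]_d => f xy.1 xy.2) (x, y) (v, w) =
  dot v (grad1 f x y) + dot w (grad2 f x y).
Proof.
set F := fun _ => _.
have -> : (v, w) = (v, 0) + (0, w) by transitivity (v + 0, 0 + w); first by rewrite addr0 add0r.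
rewrite linearD; congr (_ + _).
  have dg : differentiable (fun x' => f x' y) x.
    apply: (@differentiable_comp _ _ _ _ (fun x' => (x', y)) F) => //.
  rewrite /grad1 -diff_grad //.
  have l := @right_derive_line R _ x v.
  have h1 := @right_derive_comp R _ _ F (fun s : R => (x + s *: v, y)) 0 (v, 0).
  have h2 := @right_derive_comp R _ _ (fun x' => f x' y) (fun s : R => x + s *: v) 0 v.
  rewrite /= scale0r addr0 in h1 h2.
  apply: right_derive_unique (h1 _ _) (h2 _ _) => //.
  by apply: right_derive_pair => //; exact: right_derive_cst.
have dg : differentiable (f x) y.
  apply: (@differentiable_comp _ _ _ _ (fun y' => (x, y')) F) => //.
rewrite /grad2 -diff_grad //.
have l := @right_derive_line R _ y w.
have h1 := @right_derive_comp R _ _ F (fun s : R => (x, y + s *: w)) 0 (0, w).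
have h2 := @right_derive_comp R _ _ (f x) (fun s : R => y + s *: w) 0 w.
rewrite /= scale0r addr0 in h1 h2.
apply: right_derive_unique (h1 _ _) (h2 _ _) => //.
by apply: right_derive_pair => //; exact: right_derive_cst.
Qed.

Lemma right_derive_sigma (x : R -> 'rV[R]_(\sum_i n i)) t v : right_derive x t v ->
  right_derive (fun s => sigma phi (x s)) t
    (mean (fun i => submxrow v i *m nabla (@phi i) (submxrow (x t) i))).
Proof.
move=> dx; apply: right_deriveZ; apply: right_derive_sum => i.
rewrite -diff_nabla.
apply: (@right_derive_comp R _ _ (@phi i) (fun s => submxrow (x s) i)) => //.
exact: right_derive_submxrow.
Qed.

(** Pairing with a direction and exchanging the two sums moves the average from the variation of
    [sigma] onto the second gradients. That average is what the tracker [z] is there to estimate. *)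
Lemma grad_Fsigma x : grad (Fsigma f phi) x = \mxrow_i
  (grad1 f (submxrow x i) (sigma phi x) +
   mean (fun j => grad2 f (submxrow x j) (sigma phi x)) *m (nabla (@phi i) (submxrow x i))^T).
Proof.
apply: grad_unique => [|v]; first exact: differentiable_Fsigma.
set g2 := mean (fun j => grad2 _ _ _).
have dline := @right_derive_line R _ x v.
have -> : dot v (\mxrow_i (grad1 f (submxrow x i) (sigma phi x) +
     g2 *m (nabla (@phi i) (submxrow x i))^T)) =
  \sum_i (dot (submxrow v i) (grad1 f (submxrow x i) (sigma phi x)) +
   dot (mean (fun i => submxrow v i *m nabla (@phi i) (submxrow x i)))
     (grad2 f (submxrow x i) (sigma phi x))).
  rewrite dot_mxrow big_split /=.
  under eq_bigr do rewrite mxrowK dotDr -dot_mulmx.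
  rewrite big_split /=; congr (_ + _).
  rewrite -dot_suml dotC /g2 /mean dotZl dotC -dotZl dotC dot_suml.
  by apply: eq_bigr => i _; rewrite dotC.
apply: right_derive_sum => i; rewrite -diff_f.
have := @right_derive_comp R _ _ (fun xy : 'rV[R]_(n i) * 'rV[R]_d => f xy.1 xy.2)
  (fun s : R => (submxrow (x + s *: v) i, sigma phi (x + s *: v))) 0.
rewrite /= scale0r addr0; apply; first exact: df.
apply: right_derive_pair; first exact: right_derive_submxrow.
by have := right_derive_sigma dline; rewrite scale0r addr0.
Qed.

Lemma grad_Fsigmah u : differentiable (Fsigmah h f phi) u ->
  grad (Fsigmah h f phi) u = \mxrow_i
    (submxrow (grad (Fsigma f phi) (hstack h u)) i *m (nabla (@h i) (submxrow u i))^T).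
Proof.
move=> dF; apply: grad_unique => // v.
have dline := @right_derive_line R _ u v.
rewrite dot_mxrow.
rewrite (eq_bigr (fun i => dot (submxrow v i *m nabla (@h i) (submxrow u i))
    (submxrow (grad (Fsigma f phi) (hstack h u)) i))); last first.
  by move=> i _; rewrite mxrowK -dot_mulmx.
have -> : \sum_i dot (submxrow v i *m nabla (@h i) (submxrow u i))
    (submxrow (grad (Fsigma f phi) (hstack h u)) i) =
  'd (Fsigma f phi) (hstack h u) (\mxrow_i (submxrow v i *m nabla (@h i) (submxrow u i))).
  rewrite diff_grad; last exact: differentiable_Fsigma.
  by rewrite dot_mxrow; apply: eq_bigr => i _; rewrite mxrowK.
have := @right_derive_comp R _ _ (Fsigma f phi) (fun s : R => hstack h (u + s *: v)) 0.
rewrite /= scale0r addr0; apply; first exact: differentiable_Fsigma.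
apply: right_derive_mxrow => i; rewrite -diff_nabla.
have := @right_derive_comp R _ _ (@h i) (fun s : R => submxrow (u + s *: v) i) 0.
by rewrite /= scale0r addr0; apply => //; exact: right_derive_submxrow.
Qed.

End gradients.

(** * Norm bounds for Jacobians and second-order growth rates *)

Section estimates.
Variable R : realType.

Lemma mean_norm_le N d (xi : 'I_N -> 'rV[R]_d) (e : R) : (0 < N)%N ->
  (forall i, `|xi i| <= e) -> `|mean xi| <= e.
Proof.
move=> N0 H; have N0' : 0 < N%:R :> R by rewrite ltr0n.
rewrite /mean normrZ gtr0_norm ?invr_gt0 // mulrC ler_pdivrMr //.
apply: (le_trans (ler_norm_sum _ _ _)); apply: (@le_trans _ _ (\sum_(i < N) e)).
  exact: ler_sum.
by rewrite sumr_const card_ord mulr_natr.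
Qed.

Lemma nabla_norm_le a b (g : 'rV[R]_a -> 'rV[R]_b) (K : R) (x v : 'rV[R]_a) :
  differentiable g x -> (forall y z, `|g y - g z| <= K * `|y - z|) ->
  `|v *m nabla g x| <= K * `|v|.
Proof.
move=> dg gK; rewrite -diff_nabla; apply/ler_addgt0Pr => e e0.
have l := @right_derive_line R _ x v.
have := @right_derive_comp R _ _ g (fun s : R => x + s *: v) 0 v.
rewrite /= scale0r addr0 => /(_ dg l e e0) H.
have : \forall s \near (0 : R)^'+, 0 < s /\ `|g (x + s *: v) - g x - s *: 'd g x v| <= e * s.
  apply: filterS2 (nbhs_right_gt 0) H => s s0.
  by rewrite /= add0r scale0r addr0.
move=> /filter_ex[s [s0 Hs]]; rewrite -(ler_pM2l s0) -{1}(gtr0_norm s0) -normrZ.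
have -> : s *: 'd g x v = (g (x + s *: v) - g x) - (g (x + s *: v) - g x - s *: 'd g x v).
  by rewrite opprB [RHS]addrC subrK.
apply: (le_trans (ler_normB _ _)).
have := gK (x + s *: v) x.
have -> : `|x + s *: v - x| = s * `|v| by rewrite (addrC x) addrK normrZ gtr0_norm.
lra.
Qed.

(** In the max norm a matrix and its transpose have different operator norms. Rows of [nabla g x]
    are images of basis vectors, so all entries are at most [K], and summing over [b] columns
    produces the factor [b]. *)
Lemma mulmx_nablaT_norm_le a b (g : 'rV[R]_a -> 'rV[R]_b) (K : R)
    (x : 'rV[R]_a) (w : 'rV[R]_b) : 0 <= K ->
  differentiable g x -> (forall y z, `|g y - g z| <= K * `|y - z|) ->
  `|w *m (nabla g x)^T| <= b%:R * K * `|w|.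
Proof.
move=> K0 dg gK; apply: rV_norm_le => [|k]; first by rewrite !mulr_ge0.
rewrite mxE; apply: (le_trans (ler_norm_sum _ _ _)).
apply: (@le_trans _ _ (\sum_(j < b) K * `|w|)); last first.
  by rewrite sumr_const card_ord -mulrA mulr_natl.
apply: ler_sum => j _; rewrite normrM mulrC mxE; apply: ler_pM => //; last exact: coord_norm_le.
have := nabla_norm_le (delta_mx 0 k) dg gK.
rewrite -rowE => H.
have h1 : `|delta_mx 0 k : 'rV[R]_a| <= 1.
  by apply: rV_norm_le => // l; rewrite mxE; case: (_ && _); rewrite ?normr1 ?normr0.
have := coord_norm_le (row k (nabla g x)) 0 j; rewrite mxE => /le_trans; apply.
by apply: (le_trans H); rewrite ler_piMr.
Qed.

(** The form in which [consensus_dini] expects the increments of its disturbance. *)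
Definition sq_rate (D : R -> R) (r : R) : Prop :=
  forall eta : R, 0 < eta -> \forall s \near (0 : R)^'+, D s <= (r + eta) * s ^+ 2.

Lemma sq_rateD D1 D2 r1 r2 : sq_rate D1 r1 -> sq_rate D2 r2 ->
  sq_rate (fun s => D1 s + D2 s) (r1 + r2).
Proof.
move=> h1 h2 e e0; have e2 : 0 < e / 2 by lra.
by have := h2 _ e2; have := h1 _ e2; apply: filterS2 => s; lra.
Qed.

Lemma sq_rateZ D r c : 0 <= c -> sq_rate D r -> sq_rate (fun s => c * D s) (c * r).
Proof.
move=> c0 h e e0; have e1 : 0 < e / (c + 1) by rewrite divr_gt0 //; lra.
have := h _ e1; apply: filterS => s H; apply: (le_trans (ler_wpM2l c0 H)).
have : c * (e / (c + 1)) <= e by rewrite mulrA ler_pdivrMr; nra.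
move=> h1; rewrite mulrA; apply: ler_wpM2r; first exact: sqr_ge0.
lra.
Qed.

Lemma sq_rate_sum (I : Type) (l : seq I) (D : I -> R -> R) (r : I -> R) :
  (forall i, sq_rate (D i) (r i)) ->
  sq_rate (fun s => \sum_(i <- l) D i s) (\sum_(i <- l) r i).
Proof.
move=> H; elim: l => [|i l IH].
  move=> e e0; apply: filterS (nbhs_right_gt 0) => s s0.
  by rewrite !big_nil add0r mulr_ge0 ?sqr_ge0 // ltW.
have := sq_rateD (H i) IH; rewrite big_cons; congr sq_rate.
by apply: funext => s; rewrite big_cons.
Qed.

Lemma sq_rateW D1 D2 r1 r2 : (forall s, D1 s <= D2 s) -> r2 <= r1 ->
  sq_rate D2 r2 -> sq_rate D1 r1.
Proof.
move=> h1 h2 H e e0; have := H _ e0; apply: filterS => s Hs.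
apply: (le_trans (h1 s)); apply: (le_trans Hs); apply: ler_wpM2r; first exact: sqr_ge0.
by rewrite lerD2r.
Qed.

Lemma right_derive_sq_rate (V : normedModType R) (x : R -> V) t v : right_derive x t v ->
  sq_rate (fun s => `|x (t + s) - x t| ^+ 2) (`|v| ^+ 2).
Proof.
move=> dx e e0; have v0 := normr_ge0 v.
pose e1 := Num.min 1 (e / (2 * `|v| + 1)).
have e10 : 0 < e1 by rewrite lt_min ltr01 divr_gt0 //; lra.
have e11 : e1 <= 1 by rewrite ge_min lexx.
have e12 : e1 * (2 * `|v| + 1) <= e by rewrite -ler_pdivlMr ?ge_min ?lexx ?orbT //; lra.
have := right_derive_near_norm dx e10; apply: filterS => s H.
apply: (@le_trans _ _ (((`|v| + e1) * s) ^+ 2)).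
  by apply: lerXn2r => //; rewrite nnegrE //; apply: le_trans H.
rewrite exprMn; apply: ler_wpM2r; first exact: sqr_ge0.
nra.
Qed.

Lemma dot_ge k (u v : 'rV[R]_k) : - (sqn u / 4 + sqn v) <= dot u v.
Proof.
rewrite dotE /sqn mulr_suml -big_split /= -sumrN; apply: ler_sum => j _.
have : 0 <= (u 0 j / 2 + v 0 j) ^+ 2 by exact: sqr_ge0.
nra.
Qed.

Lemma sqnD_le k (u v : 'rV[R]_k) : sqn (u + v) <= 2 * sqn u + 2 * sqn v.
Proof.
rewrite /sqn !mulr_sumr -big_split /=; apply: ler_sum => j _; rewrite mxE.
have : 0 <= (u 0 j - v 0 j) ^+ 2 by exact: sqr_ge0.
nra.
Qed.

Lemma sqnZ k (c : R) (u : 'rV[R]_k) : sqn (c *: u) = c ^+ 2 * sqn u.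
Proof. by rewrite /sqn mulr_sumr; apply: eq_bigr => j _; rewrite mxE exprMn. Qed.

Lemma sqnN k (u : 'rV[R]_k) : sqn (- u) = sqn u.
Proof. by apply: eq_bigr => j _; rewrite mxE sqrrN. Qed.

(** Each difference [xi i - xi j] passes through the mean and is at most [2 * q]. The bound is used
    on the speed of [w], which disturbs the second tracker. *)
Lemma laplacian_bounded N d (a : 'I_N -> 'I_N -> R) : exists2 C : R, 0 <= C &
  forall xi : 'I_N -> 'rV[R]_d,
    \sum_i sqn (\sum_j a i j *: (xi i - xi j)) <= C * dispersion xi.
Proof.
pose A := \sum_i \sum_j `|a i j|.
have A0 : 0 <= A by apply: sumr_ge0 => i _; apply: sumr_ge0.
have aA i j : `|a i j| <= A.
  rewrite /A (bigD1 i) //= (bigD1 j) //= -addrA lerDl addr_ge0 ?sumr_ge0 // => k _.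
  by rewrite sumr_ge0.
exists (N%:R * (d%:R * (2 * N%:R * A) ^+ 2)) => [|xi].
  by rewrite !mulr_ge0 ?sqr_ge0.
pose q := Num.sqrt (dispersion xi).
have D0 : 0 <= dispersion xi by apply: sumr_ge0 => i _; exact: sqn_ge0.
have q2 : q ^+ 2 = dispersion xi by rewrite sqr_sqrtr.
have qi i : `|xi i - mean xi| <= q.
  rewrite -(@ler_pXn2r _ 2) ?nnegrE ?sqrtr_ge0 // q2; apply: (le_trans (norm_sqn _)).
  by rewrite /dispersion (bigD1 i) //= lerDl sumr_ge0 // => j _; exact: sqn_ge0.
apply: (@le_trans _ _ (\sum_(i < N) (d%:R * (2 * N%:R * A) ^+ 2 * dispersion xi))); last first.
  by rewrite sumr_const card_ord -[_ *+ N]mulr_natl !mulrA.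
apply: ler_sum => i _.
apply: (le_trans (sqn_le _)); rewrite -mulrA -q2 -exprMn; apply: ler_wpM2l => //.
apply: lerXn2r; rewrite ?nnegrE //.
  by rewrite !mulr_ge0 ?sqrtr_ge0.
apply: (le_trans (ler_norm_sum _ _ _)).
apply: (@le_trans _ _ (\sum_(j < N) A * (2 * q))); last first.
  by rewrite sumr_const card_ord -mulr_natl; have := sqrtr_ge0 (dispersion xi); rewrite -/q; nra.
apply: ler_sum => j _; rewrite normrZ; apply: ler_pM => //.
rewrite -(subrK (mean xi) (xi i)) -addrA -[mean xi - xi j]opprB.
by apply: (le_trans (ler_normB _ _)); have := qi i; have := qi j; lra.
Qed.

End estimates.

(** * The Lyapunov function along the closed loop *)

Section uniform_data.
Variables (R : realType) (N d : nat) (n m : 'I_N -> nat).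
Variable p : forall i, 'rV[R]_(n i) -> 'rV[R]_(m i) -> 'rV[R]_(n i).
Variable h : forall i, 'rV[R]_(m i) -> 'rV[R]_(n i).
Variable f : forall i, 'rV[R]_(n i) -> 'rV[R]_d -> R.
Variable phi : forall i, 'rV[R]_(n i) -> 'rV[R]_d.
Variable E : rel 'I_N.
Variable a : 'I_N -> 'I_N -> R.
Variable V : forall i, 'rV[R]_(n i) -> 'rV[R]_(m i) -> R.
Variables K kappa lambda CL : R.

(* The hypotheses in the form used by the Lyapunov analysis: all bounds are in the
   max norm with a single constant K, and V i is a converse Lyapunov function of
   the i-th plant with frozen input. *)
Record uniform_data : Prop := UniformData {
  N_pos : (0 < N)%N;
  K_ge1 : 1 <= K;
  kappa_gt0 : 0 < kappa;
  lambda_gt0 : 0 < lambda;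
  CL_ge0 : 0 <= CL;
  h_lip : forall i (u u' : 'rV[R]_(m i)), `|h u - h u'| <= K * `|u - u'|;
  p_lip : forall i (x x' : 'rV[R]_(n i)) (u : 'rV[R]_(m i)),
    `|p x u - p x' u| <= K * `|x - x'|;
  p_equil : forall i (u : 'rV[R]_(m i)), p (h u) u = 0;
  phi_lip : forall i (x x' : 'rV[R]_(n i)), `|phi x - phi x'| <= K * `|x - x'|;
  grad1_lip : forall i (x x' : 'rV[R]_(n i)) (y y' : 'rV[R]_d),
    `|grad1 f x y - grad1 f x' y'| <= K * (`|x - x'| + `|y - y'|);
  grad2_lip : forall i (x x' : 'rV[R]_(n i)) (y y' : 'rV[R]_d),
    `|grad2 f x y - grad2 f x' y'| <= K * (`|x - x'| + `|y - y'|);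
  gradF_lip : forall x x' : 'rV[R]_(\sum_i n i),
    `|grad (Fsigma f phi) x - grad (Fsigma f phi) x'| <= K * `|x - x'|;
  V_bounds : forall i (x : 'rV[R]_(n i)) (u : 'rV[R]_(m i)),
    `|x - h u| <= V x u <= K * `|x - h u|;
  V_lip : forall i (x x' : 'rV[R]_(n i)) (u u' : 'rV[R]_(m i)),
    `|V x u - V x' u'| <= K * (`|x - x'| + `|u - u'|);
  V_decay : forall i (x : 'rV[R]_(n i)) (u : 'rV[R]_(m i)) (eta : R), 0 < eta ->
    \forall s \near (0 : R)^'+, V (x + s *: p x u) u <= V x u + (- kappa * V x u + eta) * s;
  gap : forall e : 'I_N -> R, \sum_i e i = 0 ->
    lambda * \sum_i e i ^+ 2 <= \sum_i e i * (\sum_j a i j * (e i - e j));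
  lap_bound : forall xi : 'I_N -> 'rV[R]_d,
    \sum_i sqn (\sum_j a i j *: (xi i - xi j)) <= CL * dispersion xi;
  balanced : forall i, \sum_j a i j = \sum_j a j i;
  off_edge : forall i j, ~~ E j i -> a i j = 0;
  f_diff : forall i (xy : 'rV[R]_(n i) * 'rV[R]_d),
    differentiable (fun xy' : 'rV[R]_(n i) * 'rV[R]_d => f xy'.1 xy'.2) xy;
  phi_diff : forall i (x : 'rV[R]_(n i)), differentiable (@phi i) x;
  h_diff : forall i (u : 'rV[R]_(m i)), differentiable (@h i) u;
  F_diff : forall u, differentiable (Fsigmah h f phi) u;
  gradF_cont : continuous (grad (Fsigmah h f phi));
  F_unbounded : radially_unbounded (Fsigmah h f phi)
}.

End uniform_data.

Section state_functions.
Variables (R : realType) (N d : nat) (n m : 'I_N -> nat).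
Variable h : forall i, 'rV[R]_(m i) -> 'rV[R]_(n i).
Variable f : forall i, 'rV[R]_(n i) -> 'rV[R]_d -> R.
Variable phi : forall i, 'rV[R]_(n i) -> 'rV[R]_d.
Variable V : forall i, 'rV[R]_(n i) -> 'rV[R]_(m i) -> R.
Implicit Type s : state R d n m.

Definition plant_state s i : 'rV[R]_(n i) := submxrow s.1.1.1 i.
Definition plant_input s i : 'rV[R]_(m i) := submxrow s.1.1.2 i.
(* y_est and v_est are the estimates that agent i has of sigma(x) and of the
   network average of the gradients of the f_j in their second argument. *)
Definition y_est s i : 'rV[R]_d := submxrow s.1.2 i + phi (plant_state s i).
Definition v_est s i : 'rV[R]_d := submxrow s.2 i + grad2 f (plant_state s i) (y_est s i).
Definition descent s i : 'rV[R]_(m i) :=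
  (grad1 f (plant_state s i) (y_est s i)
   + v_est s i *m (nabla (@phi i) (plant_state s i))^T)
  *m (nabla (@h i) (plant_input s i))^T.
Definition plant_energy s : R := \sum_i V (plant_state s i) (plant_input s i) ^+ 2.
Definition y_energy s : R := dispersion (y_est s).
Definition v_energy s : R := dispersion (v_est s).
(** A measure of the distance to the quasi-steady state, where each plant rests at [h] of its input
    and the agents agree on both estimates; there, on zero-mean states, [descent] is the true
    gradient. *)
Definition fast_energy s : R := plant_energy s + y_energy s + v_energy s.

Lemma plant_energy_ge0 s : 0 <= plant_energy s.
Proof. by apply: sumr_ge0 => i _; exact: sqr_ge0. Qed.

Lemma dispersion_ge0 k (xi : 'I_N -> 'rV[R]_k) : 0 <= dispersion xi.
Proof. by apply: sumr_ge0 => i _; exact: sqn_ge0. Qed.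

Lemma fast_energy_ge0 s : 0 <= fast_energy s.
Proof. by rewrite !addr_ge0 ?plant_energy_ge0 ?dispersion_ge0. Qed.

Lemma norm_dispersion k (xi : 'I_N -> 'rV[R]_k) i : `|xi i - mean xi| ^+ 2 <= dispersion xi.
Proof.
apply: (le_trans (norm_sqn _)).
by rewrite /dispersion (bigD1 i) //= lerDl sumr_ge0 // => j _; exact: sqn_ge0.
Qed.

Lemma le_sqrt (x e : R) : 0 <= x -> x ^+ 2 <= e -> x <= Num.sqrt e.
Proof.
move=> x0 xe; rewrite -[x]ger0_norm // -sqrtr_sqr ler_wsqrtr //.
Qed.

Lemma zero_mean_y s : zero_mean_states s -> mean (y_est s) = sigma phi s.1.1.1.
Proof.
case: s => [[[x u] w] z] [w0 _]; rewrite /mean /y_est big_split /= w0 add0r.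
by rewrite /sigma.
Qed.

Lemma zero_mean_v s : zero_mean_states s ->
  mean (v_est s) = mean (fun i => grad2 f (plant_state s i) (y_est s i)).
Proof.
case: s => [[[x u] w] z] [_ z0]; rewrite /mean /v_est big_split /= z0 add0r.
by [].
Qed.

End state_functions.

Section closed_loop.
Variables (R : realType) (N d : nat) (n m : 'I_N -> nat).
Variable p : forall i, 'rV[R]_(n i) -> 'rV[R]_(m i) -> 'rV[R]_(n i).
Variable h : forall i, 'rV[R]_(m i) -> 'rV[R]_(n i).
Variable f : forall i, 'rV[R]_(n i) -> 'rV[R]_d -> R.
Variable phi : forall i, 'rV[R]_(n i) -> 'rV[R]_d.
Variable E : rel 'I_N.
Variable a : 'I_N -> 'I_N -> R.
Variable V : forall i, 'rV[R]_(n i) -> 'rV[R]_(m i) -> R.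
Variables K kappa lambda CL : R.
Hypothesis D : uniform_data p h f phi E a V K kappa lambda CL.
Implicit Type s : state R d n m.

Let K1 : 1 <= K := K_ge1 D.
Let K0 : 0 <= K. Proof. exact: le_trans K1. Qed.

Lemma V_ge0 i (x : 'rV[R]_(n i)) (u : 'rV[R]_(m i)) : 0 <= V x u.
Proof. by have /andP[+ _] := V_bounds D x u; apply: le_trans. Qed.

Lemma closed_loopE alpha1 alpha2 s : closed_loop p h f phi E a alpha1 alpha2 s =
  (\mxrow_i p (plant_state s i) (plant_input s i),
   \mxrow_i - (alpha1 *: descent h f phi s i),
   \mxrow_i - (alpha2^-1 *: \sum_j a i j *: (y_est phi s i - y_est phi s j)),
   \mxrow_i - (alpha2^-1 *: \sum_j a i j *: (v_est f phi s i - v_est f phi s j))).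
Proof.
have H (xi : 'I_N -> 'rV[R]_d) i : \sum_(j | E j i) a i j *: (xi i - xi j) =
    \sum_j a i j *: (xi i - xi j).
  rewrite big_mkcond; apply: eq_bigr => j _; case: ifPn => // /(off_edge D) ->.
  by rewrite scale0r.
case: s => [[[x u] w] z]; rewrite /closed_loop.
by congr (_, _, _, _); apply/eq_mxrowP => i; rewrite H.
Qed.

Lemma plant_state_norm s i : `|plant_state s i - h (plant_input s i)| <=
  Num.sqrt (fast_energy f phi V s).
Proof.
apply: le_sqrt => //; have /andP[H _] := V_bounds D (plant_state s i) (plant_input s i).
apply: (@le_trans _ _ (V (plant_state s i) (plant_input s i) ^+ 2)).
  by apply: lerXn2r => //; rewrite nnegrE ?V_ge0.
rewrite /fast_energy /plant_energy (bigD1 i) //= -!addrA lerDl.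
by rewrite !addr_ge0 ?dispersion_ge0 // sumr_ge0 // => j _; exact: sqr_ge0.
Qed.

Lemma y_est_norm s i : `|y_est phi s i - mean (y_est phi s)| <=
  Num.sqrt (fast_energy f phi V s).
Proof.
apply: le_sqrt => //; apply: (le_trans (norm_dispersion _ _)).
rewrite /fast_energy -/(y_energy phi s).
by have := plant_energy_ge0 V s; have := dispersion_ge0 (v_est f phi s); rewrite /v_energy; lra.
Qed.

Lemma v_est_norm s i : `|v_est f phi s i - mean (v_est f phi s)| <=
  Num.sqrt (fast_energy f phi V s).
Proof.
apply: le_sqrt => //; apply: (le_trans (norm_dispersion _ _)).
rewrite /fast_energy -/(v_energy f phi s).
by have := plant_energy_ge0 V s; have := dispersion_ge0 (y_est phi s); rewrite /y_energy; lra.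
Qed.

(** [2 * K] collects the errors in [grad1] and in the gradient of [Fsigma]; [d%:R * K * (1 + K)] is
    the error in [v_est] after the transpose of [nabla phi]; the factor with the [n i] comes from
    the transpose of [nabla h], and the one with the [m i] from passing to squared Euclidean
    norms. *)
Definition error_constant : R :=
  (\sum_i m i)%:R * ((\sum_i n i)%:R * K * (2 * K + d%:R * K * (1 + K))) ^+ 2.

(** The comparison has two stages: at the actual [x], where the estimates differ from their averages
    by at most the root of the fast energy, and then from [x] to [hstack h u], by the Lipschitz
    bound on the gradient of [Fsigma]. Zero mean identifies the average of the [y_est] with [sigma]
    and that of the [v_est] with an average of second gradients. *)
Lemma descent_error s : zero_mean_states s ->
  sqn (\mxrow_i descent h f phi s i - grad (Fsigmah h f phi) s.1.1.2) <=
    error_constant * fast_energy f phi V s.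
Proof.
move=> Ss; set q2 := fast_energy f phi V s.
have q20 : 0 <= q2 by exact: fast_energy_ge0.
pose q := Num.sqrt q2; have q0 : 0 <= q by exact: sqrtr_ge0.
have qE : q ^+ 2 = q2 by rewrite sqr_sqrtr.
have K1' := K1; have K0' := K0.
have d0 : 0 <= d%:R :> R by [].
have c0 : 0 <= 2 * K + d%:R * K * (1 + K) by rewrite addr_ge0 ?mulr_ge0 // addr_ge0.
apply: (le_trans (sqn_le _)); rewrite /error_constant -mulrA -qE -exprMn.
apply: ler_wpM2l => //; apply: lerXn2r; rewrite ?nnegrE //; first by rewrite !mulr_ge0.
rewrite (grad_Fsigmah (f_diff D) (phi_diff D) (h_diff D) (F_diff D _)).
rewrite -mxrowB; apply: mxrow_norm_le => [|i]; first by rewrite !mulr_ge0.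
rewrite -[submxrow s.1.1.2 i]/(plant_input s i) /descent -mulmxBl.
have := mulmx_nablaT_norm_le (grad1 f (plant_state s i) (y_est phi s i)
   + v_est f phi s i *m (nabla (@phi i) (plant_state s i))^T
   - submxrow (grad (Fsigma f phi) (hstack h s.1.1.2)) i) K0
   (h_diff D (plant_input s i)) (@h_lip _ _ _ _ _ _ _ _ _ _ _ _ _ _ _ _ D i).
move=> /le_trans; apply.
have ni : (n i)%:R <= (\sum_i n i)%:R :> R by rewrite ler_nat (bigD1 i) //= leq_addr.
rewrite -[leRHS]mulrA; apply: ler_pM => //; first by rewrite mulr_ge0.
  by apply: ler_wpM2r.
set sg := sigma phi s.1.1.1.
have yE j : `|y_est phi s j - sg| <= q by rewrite /sg -(zero_mean_y phi Ss); exact: y_est_norm.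
have xE : `|s.1.1.1 - hstack h s.1.1.2| <= q.
  rewrite -(submxrowK s.1.1.1) -mxrowB; apply: mxrow_norm_le => // j.
  exact: plant_state_norm.
pose g2 := mean (fun j => grad2 f (plant_state s j) sg).
have gE : submxrow (grad (Fsigma f phi) s.1.1.1) i =
    grad1 f (plant_state s i) sg + g2 *m (nabla (@phi i) (plant_state s i))^T.
  by rewrite (grad_Fsigma (f_diff D) (phi_diff D)) mxrowK.
have -> : grad1 f (plant_state s i) (y_est phi s i)
   + v_est f phi s i *m (nabla (@phi i) (plant_state s i))^T
   - submxrow (grad (Fsigma f phi) (hstack h s.1.1.2)) i =
   (grad1 f (plant_state s i) (y_est phi s i) - grad1 f (plant_state s i) sg)
   + (v_est f phi s i - g2) *m (nabla (@phi i) (plant_state s i))^T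
   + submxrow (grad (Fsigma f phi) s.1.1.1 - grad (Fsigma f phi) (hstack h s.1.1.2)) i.
  rewrite submxrowB gE mulmxBl; apply/rowP => j; rewrite !mxE; ring.
have e1 := grad1_lip D (plant_state s i) (plant_state s i) (y_est phi s i) sg.
rewrite subrr normr0 add0r in e1.
have e3 : `|submxrow (grad (Fsigma f phi) s.1.1.1 - grad (Fsigma f phi) (hstack h s.1.1.2)) i| <= K * q.
  apply: (le_trans (submxrow_norm _ _)); apply: (le_trans (gradF_lip D _ _)).
  exact: ler_wpM2l.
have e4 : `|mean (v_est f phi s) - g2| <= K * q.
  rewrite zero_mean_v // /g2 /mean -scalerBr -sumrB; apply: mean_norm_le => [|j].
    exact: N_pos D.
  apply: (le_trans (grad2_lip D _ _ _ _)); rewrite subrr normr0 add0r; exact: ler_wpM2l.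
have e2 : `|(v_est f phi s i - g2) *m (nabla (@phi i) (plant_state s i))^T| <=
    d%:R * K * (1 + K) * q.
  apply: (le_trans (mulmx_nablaT_norm_le _ K0 (phi_diff D (plant_state s i))
    (@phi_lip _ _ _ _ _ _ _ _ _ _ _ _ _ _ _ _ D i))).
  rewrite -[leRHS]mulrA; apply: ler_wpM2l; first by rewrite mulr_ge0.
  rewrite -(subrK (mean (v_est f phi s)) (v_est f phi s i)) -addrA.
  apply: (le_trans (ler_normD _ _)); rewrite mulrDl mul1r; apply: lerD => //.
  exact: v_est_norm.
apply: (le_trans (ler_normD _ _)); rewrite mulrDl [leRHS]addrC mulr2n (mulrDl 1 1) mul1r.
rewrite mulrDl addrA; apply: lerD => //.
apply: (le_trans (ler_normD _ _)); rewrite addrC; apply: lerD => //.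
by apply: (le_trans e1); exact: ler_wpM2l.
Qed.

End closed_loop.

Section projections.
Variables (R : realType) (N d : nat) (n m : 'I_N -> nat).
Implicit Type s : state R d n m.

Lemma fst_norm (U W : normedModType R) (x : U * W) : `|x.1| <= `|x|.
Proof. by rewrite [leRHS]prod_normE le_max lexx. Qed.

Lemma snd_norm (U W : normedModType R) (x : U * W) : `|x.2| <= `|x|.
Proof. by rewrite [leRHS]prod_normE le_max lexx orbT. Qed.

Lemma state_x_norm s s' : `|s.1.1.1 - s'.1.1.1| <= `|s - s'|.
Proof.
apply: le_trans (fst_norm (s - s')); apply: le_trans (fst_norm (s - s').1).
exact: (fst_norm (s - s').1.1).
Qed.

Lemma state_u_norm s s' : `|s.1.1.2 - s'.1.1.2| <= `|s - s'|.
Proof.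
apply: le_trans (fst_norm (s - s')); apply: le_trans (fst_norm (s - s').1).
exact: (snd_norm (s - s').1.1).
Qed.

Lemma state_w_norm s s' : `|s.1.2 - s'.1.2| <= `|s - s'|.
Proof. apply: le_trans (fst_norm (s - s')); exact: (snd_norm (s - s').1). Qed.

Lemma state_z_norm s s' : `|s.2 - s'.2| <= `|s - s'|.
Proof. exact: (snd_norm (s - s')). Qed.

Lemma plant_state_lip s s' i : `|plant_state s i - plant_state s' i| <= `|s - s'|.
Proof.
apply: le_trans (state_x_norm s s'); rewrite -submxrowB; exact: submxrow_norm.
Qed.

Lemma plant_input_lip s s' i : `|plant_input s i - plant_input s' i| <= `|s - s'|.
Proof.
apply: le_trans (state_u_norm s s'); rewrite -submxrowB; exact: submxrow_norm.
Qed.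

End projections.

(** * Dini bounds for the four terms of the Lyapunov function *)

Section lyapunov_derivative.
Variables (R : realType) (N d : nat) (n m : 'I_N -> nat).
Variable p : forall i, 'rV[R]_(n i) -> 'rV[R]_(m i) -> 'rV[R]_(n i).
Variable h : forall i, 'rV[R]_(m i) -> 'rV[R]_(n i).
Variable f : forall i, 'rV[R]_(n i) -> 'rV[R]_d -> R.
Variable phi : forall i, 'rV[R]_(n i) -> 'rV[R]_d.
Variable E : rel 'I_N.
Variable a : 'I_N -> 'I_N -> R.
Variable V : forall i, 'rV[R]_(n i) -> 'rV[R]_(m i) -> R.
Variables K kappa lambda CL : R.
Hypothesis D : uniform_data p h f phi E a V K kappa lambda CL.
Variables (alpha1 alpha2 : R) (s : R -> state R d n m) (t : R).
Hypotheses (a1_gt0 : 0 < alpha1) (a2_gt0 : 0 < alpha2).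
Hypothesis cs : {for t, continuous s}.
Hypothesis ds : right_derive s t (closed_loop p h f phi E a alpha1 alpha2 (s t)).

Let x i r := plant_state (s r) i.
Let u i r := plant_input (s r) i.
Let w i r : 'rV[R]_d := submxrow (s r).1.2 i.
Let z i r : 'rV[R]_d := submxrow (s r).2 i.
Let y i r := y_est phi (s r) i.
Let v i r := v_est f phi (s r) i.
Let G i := descent h f phi (s t) i.

Lemma dx i : right_derive (x i) t (p (x i t) (u i t)).
Proof.
have := right_derive_submxrow i (right_derive_fst (right_derive_fst (right_derive_fst ds))).
by rewrite (closed_loopE D) /= mxrowK.
Qed.

Lemma du : right_derive (fun r => (s r).1.1.2) t (\mxrow_i - (alpha1 *: G i)).
Proof.
have := right_derive_snd (right_derive_fst (right_derive_fst ds)).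
by rewrite (closed_loopE D).
Qed.

Lemma dui i : right_derive (u i) t (- (alpha1 *: G i)).
Proof. by have := right_derive_submxrow i du; rewrite mxrowK. Qed.

Lemma dw i : right_derive (w i) t (- (alpha2^-1 *: \sum_j a i j *: (y i t - y j t))).
Proof.
have := right_derive_submxrow i (right_derive_snd (right_derive_fst ds)).
by rewrite (closed_loopE D) /= mxrowK.
Qed.

Lemma dz i : right_derive (z i) t (- (alpha2^-1 *: \sum_j a i j *: (v i t - v j t))).
Proof.
have := right_derive_submxrow i (right_derive_snd ds).
by rewrite (closed_loopE D) /= mxrowK.
Qed.

Let A := sqn (grad (Fsigmah h f phi) (s t).1.1.2).
Let B := sqn (\mxrow_i G i - grad (Fsigmah h f phi) (s t).1.1.2).
Let P := plant_energy V (s t).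
Let Q := y_energy phi (s t).
Let Z := v_energy f phi (s t).

(** The descent direction is the gradient plus an error of squared size [B]; [dot_ge] charges a
    quarter of [A] and the whole of [B] for the cross term. *)
Lemma cost_dini : dini_le (fun r => Fsigmah h f phi (s r).1.1.2) t
  (- alpha1 * A + alpha1 * (A / 4 + B)).
Proof.
have := right_derive_dini (right_derive_comp (F_diff D _) du).
apply: dini_leW; rewrite (diff_grad _ (F_diff D _)).
have -> : \mxrow_i - (alpha1 *: G i) = - alpha1 *: \mxrow_i G i.
  by apply/rowP => j; rewrite !mxE mulNr.
set gF := grad _ _.
have : A - (A / 4 + B) <= dot (\mxrow_i G i) gF.
  rewrite -[\mxrow_i G i](subrK gF) dotDl dot_sqn -/A dotC.
  by have := dot_ge gF (\mxrow_i G i - gF); rewrite -/A -/B; lra.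
by move=> /(ler_wpM2l (ltW a1_gt0)); rewrite dotZl; lra.
Qed.

Lemma V_dini i : dini_le (fun r => V (x i r) (u i r)) t
  (- kappa * V (x i t) (u i t) + K * (alpha1 * `|G i|)).
Proof.
move=> e e0; have K1 := K_ge1 D; have K0 : 0 < K by lra.
have e1 : 0 < e / (3 * K) by rewrite divr_gt0 // mulr_gt0.
have e3 : 0 < e / 3 by lra.
have := right_derive_near_norm (dui i) e1; have := dx i e1.
apply: filterS3 (filterI (nbhs_right_gt 0) (V_decay D (x i t) (u i t) e3)) => r [r0 H3] H1 H2.
have nG : `|- (alpha1 *: G i)| = alpha1 * `|G i| by rewrite normrN normrZ gtr0_norm.
rewrite nG in H2.
have := V_lip D (x i (t + r)) (x i t + r *: p (x i t) (u i t)) (u i (t + r)) (u i t).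
have := ler_norm (V (x i (t + r)) (u i (t + r)) - V (x i t + r *: p (x i t) (u i t)) (u i t)).
have -> : `|x i (t + r) - (x i t + r *: p (x i t) (u i t))| =
  `|x i (t + r) - x i t - r *: p (x i t) (u i t)| by rewrite opprD addrA.
have k1 := ler_wpM2l (ltW K0) H1; have k2 := ler_wpM2l (ltW K0) H2.
have k3 : K * (e / (3 * K) * r) = e / 3 * r by field; rewrite gt_eqF.
have k4 : K * ((alpha1 * `|G i| + e / (3 * K)) * r) = K * (alpha1 * `|G i|) * r + e / 3 * r.
  by field; rewrite gt_eqF.
rewrite k3 in k1; rewrite k4 in k2.
move: H3; lra.
Qed.

Lemma sqn_descent : \sum_i `|G i| ^+ 2 <= 2 * A + 2 * B.
Proof.
apply: (@le_trans _ _ (sqn (\mxrow_i G i))).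
  rewrite sqn_mxrow; apply: ler_sum => i _; rewrite mxrowK; exact: norm_sqn.
rewrite -(subrK (grad (Fsigmah h f phi) (s t).1.1.2) (\mxrow_i G i)).
by apply: (le_trans (sqnD_le _ _)); rewrite -/A -/B addrC.
Qed.

(** The cross term of [V] with the norm of [G i] is split with coefficients [4 * K ^+ 2] and
    [1 / 16]; the second is small enough to leave most of the descent [- alpha1 * A] intact. *)
Lemma plant_dini : dini_le (fun r => 2^-1 * plant_energy V (s r)) t
  (- kappa * P + alpha1 * (4 * K ^+ 2 * P + A / 8 + B / 8)).
Proof.
have H i : dini_le (fun r => V (x i r) (u i r) ^+ 2) t
    (2 * V (x i t) (u i t) * (- kappa * V (x i t) (u i t) + K * (alpha1 * `|G i|))).
  apply: dini_le_sqr (V_dini i); last by move=> r; exact: V_ge0 D _ _ _.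
  apply: (@continuous_comp _ _ _ s (fun s' => V (plant_state s' i) (plant_input s' i))) => //.
  apply: (@lipschitz_continuous _ _ _ _ (K * 2)) => s1 s2.
  apply: (le_trans (V_lip D _ _ _ _)); rewrite -mulrA; apply: ler_wpM2l.
    by have := K_ge1 D; lra.
  by have := plant_state_lip s1 s2 i; have := plant_input_lip s1 s2 i; lra.
have h2 : 0 <= 2^-1 :> R by rewrite invr_ge0.
have := dini_leZ h2 (@dini_le_sum R _ (index_enum 'I_N) xpredT _ t _ (fun i _ => H i)).
apply: dini_leW.
apply: (@le_trans _ _ (\sum_i ((- kappa + alpha1 * (4 * K ^+ 2)) * V (x i t) (u i t) ^+ 2 +
    alpha1 / 16 * `|G i| ^+ 2))).
  rewrite mulr_sumr; apply: ler_sum => i _.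
  have := a1_gt0; move: (V _ _) (`|G i|) => b c a10.
  have : 0 <= alpha1 * (2 * K * b - c / 4) ^+ 2 by rewrite mulr_ge0 ?sqr_ge0 // ltW.
  lra.
rewrite big_split /= -!mulr_sumr -/P.
have : alpha1 / 16 * \sum_i `|G i| ^+ 2 <= alpha1 / 16 * (2 * A + 2 * B).
  by apply: ler_wpM2l sqn_descent; rewrite divr_ge0 // ltW.
rewrite /P /plant_energy; lra.
Qed.

(** [p] vanishes at [h u], so its Lipschitz constant in [x] bounds the speed by the distance to the
    equilibrium, hence by [V]. *)
Lemma plant_rate : \sum_i `|p (x i t) (u i t)| ^+ 2 <= K ^+ 2 * P.
Proof.
rewrite mulr_sumr; apply: ler_sum => i _; rewrite -exprMn.
have K0 : 0 <= K by have := K_ge1 D; lra.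
apply: lerXn2r; rewrite ?nnegrE ?mulr_ge0 ?(V_ge0 D) //.
rewrite -[p _ _]subr0 -(p_equil D (u i t)); apply: (le_trans (p_lip D _ _ _)).
by apply: ler_wpM2l => //; have /andP[] := V_bounds D (x i t) (u i t).
Qed.

Let k_gt0 : 0 < alpha2^-1. Proof. by rewrite invr_gt0. Qed.

Lemma y_dini : dini_le (fun r => y_energy phi (s r)) t
  (- (alpha2^-1 * lambda) * Q + (alpha2^-1 * lambda)^-1 * (d%:R * K ^+ 4 * P)).
Proof.
have K0 : 0 <= K by have := K_ge1 D; lra.
apply: (@consensus_dini R N d E a lambda alpha2^-1 w (fun i r => phi (x i r))) => //.
- exact: N_pos D.
- exact: lambda_gt0 D.
- by rewrite !mulr_ge0 ?exprn_ge0 //; exact: plant_energy_ge0.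
- exact: gap D.
- exact: dw.
have := @sq_rate_sum R _ (index_enum 'I_N) _ _ (fun i => right_derive_sq_rate (dx i)).
have c0 : 0 <= d%:R * K ^+ 2 by rewrite mulr_ge0 ?exprn_ge0.
move=> /(sq_rateZ c0); apply: sq_rateW.
  move=> r; rewrite mulr_sumr; apply: ler_sum => i _.
  apply: (le_trans (sqn_le _)); rewrite -mulrA; apply: ler_wpM2l => //.
  rewrite -exprMn; apply: lerXn2r; rewrite ?nnegrE ?mulr_ge0 //; exact: phi_lip D _ _ _.
have -> : d%:R * K ^+ 4 * P = d%:R * K ^+ 2 * (K ^+ 2 * P) by ring.
by apply: ler_wpM2l plant_rate.
Qed.

(** The disturbance of this tracker moves with [x] and with [y], and [y] moves with [w], whose speed
    is of order [alpha2^-1]. After division by the consensus rate the term in [Q] is still of order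
    [alpha2^-1], like the decay of [Q] itself in [y_dini]. *)
Lemma v_dini : dini_le (fun r => v_energy f phi (s r)) t
  (- (alpha2^-1 * lambda) * Z + (alpha2^-1 * lambda)^-1 *
    (d%:R * (8 * K ^+ 6 * P + 2 * K ^+ 2 * (alpha2^-1 ^+ 2 * (CL * Q))))).
Proof.
have K1 := K_ge1 D; have K0 : 0 <= K by lra.
have P0 : 0 <= P by exact: plant_energy_ge0.
have Q0 : 0 <= Q by exact: dispersion_ge0.
apply: (@consensus_dini R N d E a lambda alpha2^-1 z (fun i r => grad2 f (x i r) (y i r))) => //.
- exact: N_pos D.
- exact: lambda_gt0 D.
- have c : 0 <= CL * Q by rewrite mulr_ge0 //; exact: CL_ge0 D.
  have e1 : 0 <= 8 * K ^+ 6 * P by apply: mulr_ge0 => //; apply: mulr_ge0 => //; exact: exprn_ge0.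
  have e2 : 0 <= 2 * K ^+ 2 by apply: mulr_ge0 => //; exact: exprn_ge0.
  have e3 : 0 <= alpha2^-1 ^+ 2 * (CL * Q) by apply: mulr_ge0 => //; exact: sqr_ge0.
  by apply: mulr_ge0 => //; apply: addr_ge0 => //; exact: mulr_ge0.
- exact: gap D.
- exact: dz.
have Hx := @sq_rate_sum R _ (index_enum 'I_N) _ _ (fun i => right_derive_sq_rate (dx i)).
have Hw := @sq_rate_sum R _ (index_enum 'I_N) _ _ (fun i => right_derive_sq_rate (dw i)).
have c1 : 0 <= d%:R * (8 * K ^+ 4) by rewrite !mulr_ge0 ?exprn_ge0.
have c2 : 0 <= d%:R * (2 * K ^+ 2) by rewrite !mulr_ge0 ?exprn_ge0.
have := sq_rateD (sq_rateZ c1 Hx) (sq_rateZ c2 Hw); apply: sq_rateW.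
  move=> r; rewrite !mulr_sumr -big_split /=; apply: ler_sum => i _.
  apply: (le_trans (sqn_le _)); rewrite -!mulrA -mulrDr; apply: ler_wpM2l => //.
  have g1 := grad2_lip D (x i (t + r)) (x i t) (y i (t + r)) (y i t).
  have g2 : `|y i (t + r) - y i t| <= `|w i (t + r) - w i t| + K * `|x i (t + r) - x i t|.
    rewrite /y /y_est opprD addrACA; apply: (le_trans (ler_normD _ _)).
    by rewrite lerD2l; exact: phi_lip D _ _ _.
  set X := `|x i (t + r) - x i t| in g1 g2 *; set W := `|w i (t + r) - w i t| in g2 *.
  have X0 : 0 <= X by exact: normr_ge0.
  have W0 : 0 <= W by exact: normr_ge0.
  apply: (@le_trans _ _ ((2 * K ^+ 2 * X + K * W) ^+ 2)).
    apply: lerXn2r; rewrite ?nnegrE ?addr_ge0 ?mulr_ge0 //.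
    apply: (le_trans g1); apply: (@le_trans _ _ (K * (X + (W + K * X)))).
      by apply: ler_wpM2l => //; rewrite lerD2l.
    have : K * X <= K ^+ 2 * X by rewrite expr2 -mulrA ler_peMl // mulr_ge0.
    lra.
  have : 0 <= (2 * K ^+ 2 * X - K * W) ^+ 2 by exact: sqr_ge0.
  lra.
have h1 : d%:R * (8 * K ^+ 4) * (\sum_i `|p (x i t) (u i t)| ^+ 2) <= d%:R * (8 * K ^+ 4) * (K ^+ 2 * P).
  by apply: ler_wpM2l plant_rate.
have h2 : \sum_i `|- (alpha2^-1 *: \sum_j a i j *: (y i t - y j t))| ^+ 2 <= alpha2^-1 ^+ 2 * (CL * Q).
  apply: (@le_trans _ _ (\sum_i alpha2^-1 ^+ 2 * sqn (\sum_j a i j *: (y i t - y j t)))).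
    by apply: ler_sum => i _; apply: (le_trans (norm_sqn _)); rewrite sqnN sqnZ.
  by rewrite -mulr_sumr; apply: ler_wpM2l; [exact: sqr_ge0 | exact: lap_bound D _].
have := ler_wpM2l c2 h2; lra.
Qed.

End lyapunov_derivative.

(** * The composite Lyapunov function and its dissipation *)

Section lyapunov_function.
Variables (R : realType) (N d : nat) (n m : 'I_N -> nat).
Variable p : forall i, 'rV[R]_(n i) -> 'rV[R]_(m i) -> 'rV[R]_(n i).
Variable h : forall i, 'rV[R]_(m i) -> 'rV[R]_(n i).
Variable f : forall i, 'rV[R]_(n i) -> 'rV[R]_d -> R.
Variable phi : forall i, 'rV[R]_(n i) -> 'rV[R]_d.
Variable E : rel 'I_N.
Variable a : 'I_N -> 'I_N -> R.
Variable V : forall i, 'rV[R]_(n i) -> 'rV[R]_(m i) -> R.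
Variables K kappa lambda CL : R.
Hypothesis D : uniform_data p h f phi E a V K kappa lambda CL.

Definition lyapunov (kw : R) (s : state R d n m) : R :=
  Fsigmah h f phi s.1.1.2 +
  (2^-1 * plant_energy V s + (kw * y_energy phi s + 2^-1 * v_energy f phi s)).

Definition dissipation (alpha1 : R) (s : state R d n m) : R :=
  alpha1 / 2 * sqn (grad (Fsigmah h f phi) s.1.1.2) +
  (kappa / 2 * plant_energy V s + (y_energy phi s + v_energy f phi s)).

Lemma lyapunov_decrease : exists kw a1bar a2bar : R,
  [/\ 1 <= kw, 0 < a1bar, 0 < a2bar &
   forall alpha1 alpha2 : R, 0 < alpha1 < a1bar -> 0 < alpha2 < a2bar ->
   forall (s : R -> state R d n m) (t : R), {for t, continuous s} ->
     right_derive s t (closed_loop p h f phi E a alpha1 alpha2 (s t)) ->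
     zero_mean_states (s t) ->
     dini_le (lyapunov kw \o s) t (- dissipation alpha1 (s t))].
Proof.
have lam := lambda_gt0 D; have kap := kappa_gt0 D; have CL0 := CL_ge0 D.
have K1 := K_ge1 D; have K0 : 0 <= K by lra.
have d0 : 0 <= d%:R :> R by [].
pose C1 := error_constant d n m K.
have C10 : 0 <= C1 by rewrite /C1 /error_constant mulr_ge0 ?sqr_ge0.
(* [c4], [c5] and [c6] are the forcing constants of [y_dini] and [v_dini] with the powers of
   [alpha2] split off. The first part of [kw] cancels the [c6 / alpha2] disturbance of [v_energy],
   and the added 1 keeps a full decay rate for [y_energy]. *)
pose c6 := 2 * d%:R * K ^+ 2 * CL / lambda.
have c60 : 0 <= c6 by rewrite /c6 divr_ge0 ?mulr_ge0 ?exprn_ge0 // ltW.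
pose c5 := 8 * d%:R * K ^+ 6 / lambda.
have c50 : 0 <= c5 by rewrite /c5 divr_ge0 ?mulr_ge0 ?exprn_ge0 // ltW.
pose c4 := d%:R * K ^+ 4 / lambda.
have c40 : 0 <= c4 by rewrite /c4 divr_ge0 ?mulr_ge0 ?exprn_ge0 // ltW.
pose kw := c6 / lambda + 1.
have kw1 : 1 <= kw by rewrite /kw lerDr divr_ge0 // ltW.
have S0 : 0 <= 4 * (4 * K ^+ 2 + 2 * C1).
  by rewrite mulr_ge0 // addr_ge0 // mulr_ge0 // exprn_ge0.
have T0 : 0 <= 4 * (c5 + kw * c4).
  rewrite mulr_ge0 // addr_ge0 // mulr_ge0 //; lra.
(* Each summand of [X1] and [X2] encodes one smallness condition, and the inverse of the sum meets
   them all: the losses in [plant_energy] stay below [kappa / 2], and the consensus rate is at least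
   4. *)
pose X1 := 4 * (4 * K ^+ 2 + 2 * C1) / kappa + 2 * C1 + 1.
have X10 : 0 < X1.
  rewrite /X1 ltr_wpDl // addr_ge0 //; last by rewrite mulr_ge0.
  by apply: divr_ge0 => //; exact: ltW.
pose X2 := 4 * (c5 + kw * c4) / kappa + 4 / lambda.
have X20 : 0 < X2.
  by rewrite /X2 ltr_wpDl ?divr_gt0 //; apply: divr_ge0 => //; exact: ltW.
exists kw, X1^-1, X2^-1; split; rewrite ?invr_gt0 //.
move=> al1 al2 /andP[a10 a11] /andP[a20 a21] s t cs ds Ss.
have b1 : al1 * X1 < 1 by rewrite -ltr_pdivlMr // mul1r.
have b2 : al2 * X2 < 1 by rewrite -ltr_pdivlMr // mul1r.
have S1 : 0 <= 4 * (4 * K ^+ 2 + 2 * C1) / kappa by rewrite divr_ge0 // ltW.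
have T1 : 0 <= 4 * (c5 + kw * c4) / kappa by rewrite divr_ge0 // ltW.
have L1 : 0 < 4 / lambda by rewrite divr_gt0.
have h1 : al1 * (2 * C1) <= 1.
  by apply: le_trans (ltW b1); apply: ler_wpM2l; [exact: ltW | rewrite /X1; lra].
have h2 : al1 * (4 * K ^+ 2 + 2 * C1) <= kappa / 4.
  have : al1 * (4 * (4 * K ^+ 2 + 2 * C1) / kappa) <= 1.
    by apply: le_trans (ltW b1); apply: ler_wpM2l; [exact: ltW | rewrite /X1; lra].
  rewrite mulrA ler_pdivrMr //; lra.
have h3 : al2 * (c5 + kw * c4) <= kappa / 4.
  have : al2 * (4 * (c5 + kw * c4) / kappa) <= 1.
    by apply: le_trans (ltW b2); apply: ler_wpM2l; [exact: ltW | rewrite /X2; lra].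
  rewrite mulrA ler_pdivrMr //; lra.
pose k := al2^-1; have k0 : 0 < k by rewrite invr_gt0.
have h4 : 4 <= k * lambda.
  have : al2 * (4 / lambda) <= 1.
    by apply: le_trans (ltW b2); apply: ler_wpM2l; [exact: ltW | rewrite /X2; lra].
  rewrite mulrA ler_pdivrMr // mul1r => h4; rewrite /k mulrC ler_pdivlMr //; lra.
have half : 0 <= 2^-1 :> R by rewrite invr_ge0.
have kw0 : 0 <= kw by lra.
have := dini_leD (cost_dini D a10 ds) (dini_leD (plant_dini D a10 cs ds)
  (dini_leD (dini_leZ kw0 (y_dini D a20 ds)) (dini_leZ half (v_dini D a20 ds)))).
apply: dini_leW; rewrite /dissipation.
have := descent_error D Ss; rewrite -/C1 /fast_energy.
have := plant_energy_ge0 V (s t).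
have := dispersion_ge0 (y_est phi (s t)); rewrite -/(y_energy phi (s t)).
have := dispersion_ge0 (v_est f phi (s t)); rewrite -/(v_energy f phi (s t)).
move: (plant_energy _ _) (y_energy _ _) (v_energy _ _ _) => P Q Z Z0 Q0 P0.
have := sqn_ge0 (grad (Fsigmah h f phi) (s t).1.1.2).
move: (sqn (grad _ _)) => A A0.
set B := sqn (_ - _) => HB.
have e4 : (k * lambda)^-1 * (d%:R * K ^+ 4 * P) = al2 * c4 * P.
  by rewrite /k /c4; field; rewrite !gt_eqF.
have e5 : (k * lambda)^-1 * (d%:R * (8 * K ^+ 6 * P + 2 * K ^+ 2 * (k ^+ 2 * (CL * Q)))) =
    al2 * c5 * P + c6 * k * Q.
  by rewrite /k /c5 /c6; field; rewrite !gt_eqF.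
rewrite -/k e4 e5.
have e6 : kw * (- (k * lambda) * Q) = - (c6 * k) * Q - k * lambda * Q.
  by rewrite /kw; field; rewrite gt_eqF.
have hB : al1 * B <= al1 * C1 * (P + Q + Z).
  by rewrite -mulrA; apply: ler_wpM2l => //; exact: ltW.
have f1 : al1 * C1 * Q <= 2^-1 * Q by apply: ler_wpM2r => //; lra.
have f2 : al1 * C1 * Z <= 2^-1 * Z by apply: ler_wpM2r => //; lra.
have f3 : al1 * (4 * K ^+ 2 + 2 * C1) * P <= kappa / 4 * P by apply: ler_wpM2r.
have f4 : al2 * (c5 + kw * c4) * P <= kappa / 4 * P by apply: ler_wpM2r.
have f5 : 4 * Q <= k * lambda * Q by apply: ler_wpM2r.
have f6 : 4 * Z <= k * lambda * Z by apply: ler_wpM2r.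
have f7 : 0 <= al1 * A by rewrite mulr_ge0 // ltW.
have f8 := mulr_ge0 (mulr_ge0 (ltW a10) C10) P0.
have f9 := mulr_ge0 (mulr_ge0 c60 (ltW k0)) Q0.
have f10 := mulr_ge0 (mulr_ge0 (ltW a20) c50) P0.
rewrite (mulrDr kw) e6.
have f11 : al1 * (4 * K ^+ 2) * P + 2 * (al1 * C1 * P) <= kappa / 4 * P by lra.
move: (k * lambda) (c6 * k) (al1 * C1) f5 f6 f1 f2 f8 f9 f11 hB => kl ck aC f5 f6 f1 f2 f8 f9 f11 hB.
lra.
Qed.

Lemma continuous_sum (T : topologicalType) (I : Type) (r : seq I) (g : I -> T -> R) :
  (forall i, continuous (g i)) -> continuous (fun x => \sum_(i <- r) g i x).
Proof.
move=> H; elim: r => [|i r IH].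
  have -> : (fun x => \sum_(i <- [::]) g i x) = (fun=> 0) by apply/funext => x; rewrite big_nil.
  exact: cst_continuous.
have -> : (fun x => \sum_(j <- i :: r) g j x) = (fun x => g i x + \sum_(j <- r) g j x).
  by apply/funext => x; rewrite big_cons.
by move=> x; apply: cvgD; [exact: H | exact: IH].
Qed.

Lemma continuous_sqr (T : topologicalType) (g : T -> R) :
  continuous g -> continuous (fun x => g x ^+ 2).
Proof. by move=> cg x; rewrite /=; apply: cvgM; exact: cg. Qed.

Lemma continuous_cM (T : topologicalType) (c : R) (g : T -> R) :
  continuous g -> continuous (fun x => c * g x).
Proof. by move=> cg x; apply: cvgM; [exact: cvg_cst | exact: cg]. Qed.

Lemma continuous_sqn (T : topologicalType) k (g : T -> 'rV[R]_k) :
  continuous g -> continuous (fun x => sqn (g x)).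
Proof.
move=> cg; apply: continuous_sum => j; apply: continuous_sqr => x.
apply: (@continuous_comp _ _ _ g (fun M : 'rV[R]_k => M 0 j)); first exact: cg.
exact: coord_continuous.
Qed.

Lemma continuous_dispersion (W : normedModType R) k (xi : W -> 'I_N -> 'rV[R]_k) (L : R) :
  (forall s s' i, `|xi s i - xi s' i| <= L * `|s - s'|) ->
  continuous (fun s => dispersion (xi s)).
Proof.
move=> H; apply: continuous_sum => i; apply: continuous_sqn.
apply: (@lipschitz_continuous _ _ _ _ (L + L)) => s s'.
rewrite opprD addrACA -opprD; apply: (le_trans (ler_normB _ _)); rewrite mulrDl.
apply: lerD => //; rewrite /mean -scalerBr -sumrB; apply: mean_norm_le => [|j] //.
exact: N_pos D.
Qed.

Lemma y_est_lip (s s' : state R d n m) i :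
  `|y_est phi s i - y_est phi s' i| <= (1 + K) * `|s - s'|.
Proof.
have K0 : 0 <= K by have := K_ge1 D; lra.
rewrite /y_est opprD addrACA; apply: (le_trans (ler_normD _ _)); rewrite mulrDl mul1r.
apply: lerD.
  by apply: le_trans (state_w_norm s s'); rewrite -submxrowB; exact: submxrow_norm.
apply: (le_trans (phi_lip D _ _)); apply: ler_wpM2l => //; exact: plant_state_lip.
Qed.

Lemma v_est_lip (s s' : state R d n m) i :
  `|v_est f phi s i - v_est f phi s' i| <= (1 + K * (1 + (1 + K))) * `|s - s'|.
Proof.
have K0 : 0 <= K by have := K_ge1 D; lra.
rewrite /v_est opprD addrACA; apply: (le_trans (ler_normD _ _)); rewrite mulrDl mul1r.
apply: lerD.
  by apply: le_trans (state_z_norm s s'); rewrite -submxrowB; exact: submxrow_norm.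
apply: (le_trans (grad2_lip D _ _ _ _)); rewrite -mulrA; apply: ler_wpM2l => //.
rewrite mulrDl mul1r; apply: lerD; [exact: plant_state_lip | exact: y_est_lip].
Qed.

Lemma continuous_y_energy : continuous (fun s : state R d n m => y_energy phi s).
Proof. exact: continuous_dispersion y_est_lip. Qed.

Lemma continuous_v_energy : continuous (fun s : state R d n m => v_energy f phi s).
Proof. exact: continuous_dispersion v_est_lip. Qed.

Lemma continuous_plant_energy : continuous (fun s : state R d n m => plant_energy V s).
Proof.
apply: continuous_sum => i; apply: continuous_sqr.
apply: (@lipschitz_continuous _ _ _ _ (K * 2)) => s1 s2.
apply: (le_trans (V_lip D _ _ _ _)); rewrite -mulrA; apply: ler_wpM2l.
  by have := K_ge1 D; lra.
by have := plant_state_lip s1 s2 i; have := plant_input_lip s1 s2 i; lra.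
Qed.

Lemma continuous_input : continuous (fun s : state R d n m => s.1.1.2).
Proof.
apply: (@lipschitz_continuous _ _ _ _ 1) => s s'; rewrite mul1r; exact: state_u_norm.
Qed.

Lemma continuous_lyapunov kw : continuous (lyapunov kw).
Proof.
move=> s; apply: cvgD.
  apply: (@continuous_comp _ _ _ (fun s : state R d n m => s.1.1.2) (Fsigmah h f phi)).
    exact: continuous_input.
  exact: differentiable_continuous (F_diff D _).
apply: cvgD; first exact: continuous_cM continuous_plant_energy s.
apply: cvgD; first exact: continuous_cM continuous_y_energy s.
exact: continuous_cM continuous_v_energy s.
Qed.

Lemma continuous_dissipation alpha1 : continuous (dissipation alpha1).
Proof.
move=> s; apply: cvgD.
  apply: (continuous_cM (g := fun s : state R d n m => sqn (grad (Fsigmah h f phi) s.1.1.2))).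
  apply: continuous_sqn => s'.
  apply: (@continuous_comp _ _ _ (fun s : state R d n m => s.1.1.2) (grad (Fsigmah h f phi))).
    exact: continuous_input.
  exact: gradF_cont D _.
apply: cvgD; first exact: continuous_cM continuous_plant_energy s.
by apply: cvgD; [exact: continuous_y_energy | exact: continuous_v_energy].
Qed.

End lyapunov_function.

(** * Asymptotic behaviour *)

Section trajectories.
Variables (R : realType) (V : normedModType R) (g : V -> V) (T : \bar R) (s : R -> V).
Hypothesis traj : trajectory g T s.

Lemma trajectory_derive t : 0 < t -> (t%:E < T)%E ->
  {for t, continuous s} /\ right_derive s t (g (s t)).
Proof.
move=> t0 tT; have [_ _ H] := traj; have ds := H t t0 tT; split.
  exact: is_derive_continuous ds.
exact: is_derive_right ds.
Qed.

Lemma trajectory_near0 (P : V -> Prop) : (\forall x \near s 0, P x) ->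
  \forall r \near (0 : R)^'+, (r%:E < T)%E -> P (s r).
Proof.
move=> HP; have [T0 /subspace_continuousP cs _] := traj.
have D0 : time_domain T 0 by split.
have H : \forall r \near within (time_domain T) (nbhs (0 : R)), P (s r) := cs 0 D0 _ HP.
rewrite /at_right near_withinE; rewrite near_withinE in H.
apply: filterS H => r Hr r0 rT; apply: Hr; split => //; exact: ltW.
Qed.

(** At time 0 only continuity is known, so the mean value inequality is applied on [[r, t]] with
    small [r]; half of [e] covers the variation of [phi] up to time [r], the other half the missing
    [c * r]. *)
Lemma trajectory_le (phi : V -> R) c : continuous phi ->
  (forall t, 0 < t -> (t%:E < T)%E -> dini_le (phi \o s) t c) ->
  forall t, time_domain T t -> phi (s t) <= phi (s 0) + c * t.
Proof.
move=> cphi H t [t0 tT]; move: t0; rewrite le_eqVlt => /predU1P[<-|t0].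
  by rewrite mulr0 addr0.
apply/ler_addgt0Pr => e e0; have e2 : 0 < e / 2 by lra.
have near_s0 : \forall x \near s 0, phi x < phi (s 0) + e / 2.
  have lt0 : phi (s 0) < phi (s 0) + e / 2 by lra.
  exact: cphi (s 0) _ (lt_nbhsl lt0).
have c0 : 0 < e / (2 * (`|c| + 1)) by rewrite divr_gt0 // mulr_gt0 // ltr_wpDl.
have : \forall r \near (0 : R)^'+, [/\ 0 < r, r < t, r < e / (2 * (`|c| + 1)) &
    (r%:E < T)%E -> phi (s r) < phi (s 0) + e / 2].
  near=> r; split; near: r.
  - exact: nbhs_right_gt.
  - exact: nbhs_right_lt.
  - exact: nbhs_right_lt.
  - exact: (trajectory_near0 near_s0).
move=> /filter_ex[r [r0 rt rc Hr]].
have rT q : q <= t -> (q%:E < T)%E by move=> qt; apply: le_lt_trans tT; rewrite lee_fin.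
have := Hr (rT _ (ltW rt)).
have step : phi (s t) <= phi (s r) + c * (t - r).
  apply: (@dini_le_const_bound R (phi \o s) r t c (ltW rt)).
    move=> q /andP[rq qt].
    have [cq _] := trajectory_derive (lt_le_trans r0 rq) (rT _ qt).
    by apply: continuous_comp; [exact: cq | exact: cphi].
  move=> q /andP[rq qt]; apply: H; first exact: lt_trans rq.
  exact: rT _ (ltW qt).
have : - c * r <= e / 2.
  move: rc; rewrite ltr_pdivlMr; last by rewrite mulr_gt0 // ltr_wpDl.
  have := ler_norm (- c); rewrite normrN => h1 h2.
  have : - c * r <= `|c| * r by rewrite ler_pM2r.
  lra.
by lra.
Unshelve. all: by end_near. Qed.

Lemma trajectory_invariant (W : normedModType R) (L : V -> W) : continuous L ->
  (forall t, 0 < t -> (t%:E < T)%E -> right_derive (fun r => L (s r)) t 0) ->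
  forall t, time_domain T t -> L (s t) = L (s 0).
Proof.
move=> cL dL t tT; apply/eqP; rewrite -subr_eq0 -normr_le0.
have C : continuous (fun x => `|L x - L (s 0)|).
  by move=> x; apply: cvg_norm; apply: cvgB; [exact: cL | exact: cvg_cst].
have Dn r : 0 < r -> (r%:E < T)%E -> dini_le ((fun x => `|L x - L (s 0)|) \o s) r 0.
  move=> r0 rT; rewrite -[X in dini_le _ _ X](normr0 W).
  apply: (@dini_le_norm R W (fun q => L (s q) - L (s 0))).
  move=> e e0; apply: filterS (dL r r0 rT e e0) => q.
  by rewrite opprB addrA subrK.
by have := trajectory_le C Dn tT; rewrite mul0r addr0 subrr normr0.
Qed.

End trajectories.

(** * Barbalat's argument and compactness *)

Lemma compact_unif_continuous (R : realType) (V W : normedModType R) (A : set V) (g : V -> W) :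
  compact A -> continuous g -> forall e : R, 0 < e ->
  exists2 r : R, 0 < r & forall x y, A x -> `|x - y| < r -> `|g x - g y| < e.
Proof.
move=> cA cg e e0; have e2 : 0 < e / 2 by lra.
(* The near-covering form of compactness replaces a finite subcover: a radius valid near each point
   of [A], and for all smaller radii, is valid on all of [A]. *)
have : \forall r \near (0 : R)^'+, A `<=` (fun x => forall y, `|x - y| < r -> `|g x - g y| < e).
  apply: (compact_near_coveringP A).1 => // x Ax.
  have /continuous_normP/(_ _ e2)[r r0 Hr] := cg x.
  have r2 : 0 < r / 2 by lra.
  exists ([set y | `|y - x| < r / 2], [set q : R | q < r / 2]).
    split => /=; last exact: nbhs_right_lt.
    by apply/nbhs_normP; exists (r / 2) => // y /=; rewrite distrC.
  move=> [y q] /= [yx qr] z yz.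
  have zx : `|z - x| < r.
    rewrite -(subrK y z) -addrA; apply: (le_lt_trans (ler_normD _ _)).
    by rewrite distrC; lra.
  have := Hr y; have := Hr z zx; rewrite distrC.
  have yx' : `|y - x| < r by lra.
  move=> h1 /(_ yx') h2; rewrite -(subrK (g x) (g y)) -addrA.
  by apply: (le_lt_trans (ler_normD _ _)); lra.
move=> H; have : \forall r \near (0 : R)^'+, 0 < r /\
  A `<=` (fun x => forall y, `|x - y| < r -> `|g x - g y| < e).
  by apply: filterS2 (nbhs_right_gt 0) H.
by move=> /filter_ex[r [r0 Hr]]; exists r => // x y Ax; exact: Hr.
Qed.

(** Bounded speed keeps the state within the modulus of continuity of [rho] for a fixed time [tau].
    If [rho] reached [e] after the time [t0] at which [W] is within [e / 2 * tau] of its infimum,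
    then [rho] would exceed [e / 2] throughout the next [tau], and [W] would fall below that
    infimum. *)
Lemma lyapunov_dissipation_cvg (R : realType) (V : normedModType R) (g : V -> V) (s : R -> V)
    (A : set V) (W rho : V -> R) (M : R) :
  trajectory g +oo%E s -> compact A -> (forall t, 0 <= t -> A (s t)) ->
  continuous W -> continuous rho -> (forall x, 0 <= rho x) ->
  (forall t, 0 < t -> `|g (s t)| <= M) ->
  (forall t, 0 < t -> dini_le (W \o s) t (- rho (s t))) ->
  forall e : R, 0 < e -> exists2 T0 : R, 0 < T0 & forall t, T0 <= t -> rho (s t) < e.
Proof.
move=> traj cA As cW crho rho0 gM dW e e0.
have e2 : 0 < e / 2 by lra.
have M0 : 0 <= M by apply: le_trans (gM 1 ltr01).
have [r r0 Hr] := compact_unif_continuous cA crho e2.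
pose tau := r / (2 * (M + 1)).
have tau0 : 0 < tau by rewrite divr_gt0 // mulr_gt0 //; lra.
have Mtau : M * tau < r.
  have : tau * (2 * (M + 1)) = r by rewrite /tau divfK // gt_eqF // mulr_gt0 //; lra.
  nra.
have der t : 0 < t -> {for t, continuous s} /\ right_derive s t (g (s t)).
  by move=> t0; apply: (trajectory_derive traj) => //; rewrite ltry.
have cWs t : 0 < t -> {for t, continuous (W \o s)}.
  by move=> /der[cs _]; apply: continuous_comp; [exact: cs | exact: cW].
have Wmono t1 t2 : 0 < t1 -> t1 <= t2 -> W (s t2) <= W (s t1).
  move=> t10 t12; have := @dini_le_const_bound R (W \o s) t1 t2 0 t12.
  rewrite mul0r addr0; apply.
    by move=> q /andP[q1 _]; apply: cWs; exact: lt_le_trans q1.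
  move=> q /andP[q1 _]; apply: dini_leW (dW q (lt_trans t10 q1)).
  by rewrite oppr_le0.
have speed t q : 0 < t -> t <= q -> `|s q - s t| <= M * (q - t).
  move=> t0 tq; have := @dini_le_const_bound R (fun x => `|s x - s t|) t q M tq.
  rewrite subrr normr0 add0r; apply.
    move=> x /andP[tx _]; apply: cvg_norm; apply: cvgB; last exact: cvg_cst.
    by have [] := der x (lt_le_trans t0 tx).
  move=> x /andP[tx _]; have x0 := lt_trans t0 tx.
  apply: dini_leW (gM x x0) _; apply: (@dini_le_norm R V (fun q => s q - s t)).
  move=> eps eps0; have [_ /(_ eps eps0)] := der x x0.
  by apply: filterS => y; rewrite opprB addrA subrK.
have [c cA' cmin] : exists2 c, c \in A & forall t, t \in A -> W c <= W t.
  apply: compact_EVT_min => //; last exact: continuous_subspaceT.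
  by exists (s 0); exact: As.
pose S := [set W (s t) | t in [set t : R | 0 < t]].
have hS : has_inf S.
  split; first by exists (W (s 1)); exists 1 => //=.
  exists (W c) => _ [t /= t0 <-]; apply: cmin; rewrite inE; apply: As; exact: ltW.
have et : 0 < e / 2 * tau by rewrite mulr_gt0.
have [_ [t0 /= t00 <-] Wt0] := inf_adherent et hS.
exists t0 => // t t0t; have tpos := lt_le_trans t00 t0t.
rewrite ltNge; apply/negP => et0.
have drop : W (s (t + tau)) <= W (s t) + - (e / 2) * (t + tau - t).
  have tt : t <= t + tau by lra.
  apply: (@dini_le_const_bound R (W \o s) t (t + tau) (- (e / 2)) tt).
    by move=> q /andP[tq _]; apply: cWs; exact: lt_le_trans tq.
  move=> q /andP[tq qt]; apply: dini_leW (dW q (lt_trans tpos tq)).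
  have : `|s t - s q| < r.
    rewrite distrC; apply: (le_lt_trans (speed t q tpos (ltW tq))).
    by apply: le_lt_trans Mtau; rewrite ler_wpM2l //; lra.
  move=> /(Hr _ _ (As t (ltW tpos))); rewrite ltr_norml => /andP[_ h].
  by rewrite lerN2; lra.
have low : inf S <= W (s (t + tau)).
  by apply: (ge_inf hS.2); exists (t + tau) => //=; lra.
have := Wmono t0 t t00 t0t.
move: Wt0 drop; rewrite -/(S); lra.
Qed.

Section compactness.
Variable R : realType.

Lemma ball_compact k (c : 'rV[R]_k) (r : R) : compact [set u : 'rV[R]_k | `|u - c| <= r].
Proof.
apply: bounded_closed_compact.
  exists (r + `|c|); split; first exact: num_real.
  move=> M rM u /= ur; apply: ltW; apply: le_lt_trans rM.
  by rewrite -(subrK c u); apply: (le_trans (ler_normD _ _)); rewrite lerD2r.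
apply: (@closed_comp _ _ (fun u : 'rV[R]_k => `|u - c|) [set x : R | x <= r]).
  move=> u _; apply: (@lipschitz_continuous _ _ _ (fun u : 'rV[R]_k => `|u - c|) 1) => x y.
  by rewrite mul1r; apply: (le_trans (ler_dist_dist _ _)); rewrite opprB addrA subrK.
exact: closed_le.
Qed.

Lemma compact_pos_lower_bound (T : topologicalType) (A : set T) (G : T -> R) :
  compact A -> continuous G -> (forall u, A u -> 0 < G u) ->
  exists2 eta : R, 0 < eta & forall u, A u -> eta <= G u.
Proof.
move=> cA cG G0; have [A0|A0] := pselect (A !=set0); last first.
  by exists 1 => // u Au; exfalso; apply: A0; exists u.
have [c cA' cmin] := compact_EVT_min A0 cA (continuous_subspaceT cG).
exists (G c); first by apply: G0; rewrite inE in cA'.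
by move=> u Au; apply: cmin; rewrite inE.
Qed.

(** Around a point where [G] is positive, [G] stays above half of its value, so by compactness small
    values occur only near zeros. Applied to the squared gradient, this turns a small gradient into
    proximity to a stationary point. *)
Lemma near_zero_set (V : normedModType R) (A : set V) (G : V -> R) :
  compact A -> continuous G -> (forall u, 0 <= G u) -> forall e : R, 0 < e ->
  exists2 eta : R, 0 < eta & forall u, A u -> G u < eta ->
    exists u0, [/\ A u0, G u0 = 0 & `|u - u0| < e].
Proof.
move=> cA cG G0 e e0.
have : \forall eta \near (0 : R)^'+, A `<=` (fun u => G u < eta ->
    exists u0, [/\ A u0, G u0 = 0 & `|u - u0| < e]).
  apply: (compact_near_coveringP A).1 => // x Ax.
  have := G0 x; rewrite le_eqVlt => /predU1P[Gx|Gx].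
    exists ([set y | `|y - x| < e], setT); last first.
      by move=> [y q] /= [yx _] _; exists x.
    split => /=; last exact: filterT.
    by apply/nbhs_normP; exists e => // y /=; rewrite distrC.
  have Gx2 : 0 < G x / 2 by lra.
  exists ([set y | G x / 2 < G y], [set q : R | q < G x / 2]).
    split => /=; last exact: nbhs_right_lt.
    by apply: (cG x _ (lt_nbhsr _)); lra.
  by move=> [y q] /= [yx qx] Gy; exfalso; lra.
move=> H; have : \forall r \near (0 : R)^'+, 0 < r /\ A `<=` (fun u => G u < r ->
    exists u0, [/\ A u0, G u0 = 0 & `|u - u0| < e]).
  by apply: filterS2 (nbhs_right_gt 0) H.
by move=> /filter_ex[r [r0 Hr]]; exists r => // u Au; exact: Hr.
Qed.

End compactness.

(** * Distances, invariance and boundedness along trajectories *)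

Section closed_loop_trajectories.
Variables (R : realType) (N d : nat) (n m : 'I_N -> nat).
Variable p : forall i, 'rV[R]_(n i) -> 'rV[R]_(m i) -> 'rV[R]_(n i).
Variable h : forall i, 'rV[R]_(m i) -> 'rV[R]_(n i).
Variable f : forall i, 'rV[R]_(n i) -> 'rV[R]_d -> R.
Variable phi : forall i, 'rV[R]_(n i) -> 'rV[R]_d.
Variable E : rel 'I_N.
Variable a : 'I_N -> 'I_N -> R.
Variable V : forall i, 'rV[R]_(n i) -> 'rV[R]_(m i) -> R.
Variables K kappa lambda CL : R.
Hypothesis D : uniform_data p h f phi E a V K kappa lambda CL.
Implicit Type s : state R d n m.

Let K0 : 0 <= K. Proof. by have := K_ge1 D; lra. Qed.

Lemma sigma_lip (x x' : 'rV[R]_(\sum_i n i)) : `|sigma phi x - sigma phi x'| <= K * `|x - x'|.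
Proof.
rewrite /sigma -scalerBr -sumrB; apply: mean_norm_le; first exact: N_pos D.
move=> i; apply: (le_trans (phi_lip D _ _)); apply: ler_wpM2l => //.
by rewrite -submxrowB; exact: submxrow_norm.
Qed.

Lemma hstack_lip (u u' : 'rV[R]_(\sum_i m i)) : `|hstack h u - hstack h u'| <= K * `|u - u'|.
Proof.
rewrite /hstack -mxrowB; apply: mxrow_norm_le => [|i]; first by rewrite mulr_ge0.
apply: (le_trans (h_lip D _ _)); apply: ler_wpM2l => //.
by rewrite -submxrowB; exact: submxrow_norm.
Qed.

Lemma piw_lip (x x' : 'rV[R]_(\sum_i n i)) : `|piw phi x - piw phi x'| <= 2 * K * `|x - x'|.
Proof.
rewrite /piw -mxrowB; apply: mxrow_norm_le => [|i]; first by rewrite !mulr_ge0.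
rewrite opprD addrACA; apply: (le_trans (ler_normD _ _)).
rewrite -opprD normrN; have := sigma_lip x x'.
have := phi_lip D (submxrow x i) (submxrow x' i).
have : K * `|submxrow x i - submxrow x' i| <= K * `|x - x'|.
  by apply: ler_wpM2l => //; rewrite -submxrowB; exact: submxrow_norm.
lra.
Qed.

Lemma grad2_sigma_lip i (x x' : 'rV[R]_(\sum_i n i)) :
  `|grad2 f (submxrow x i) (sigma phi x) - grad2 f (submxrow x' i) (sigma phi x')|
  <= K * (1 + K) * `|x - x'|.
Proof.
apply: (le_trans (grad2_lip D _ _ _ _)); rewrite -mulrA; apply: ler_wpM2l => //.
rewrite mulrDl mul1r; apply: lerD; last exact: sigma_lip.
by rewrite -submxrowB; exact: submxrow_norm.
Qed.

Lemma piz_lip (x x' : 'rV[R]_(\sum_i n i)) :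
  `|piz f phi x - piz f phi x'| <= 2 * (K * (1 + K)) * `|x - x'|.
Proof.
have c0 : 0 <= K * (1 + K) by rewrite mulr_ge0 // addr_ge0.
rewrite /piz -mxrowB; apply: mxrow_norm_le => [|i].
  by apply: mulr_ge0 => //; exact: mulr_ge0.
rewrite opprD addrACA; apply: (le_trans (ler_normD _ _)).
rewrite -opprD normrN -scalerBr -sumrB.
have h1 := grad2_sigma_lip i x x'.
have := mean_norm_le (N_pos D) (fun j => grad2_sigma_lip j x x').
rewrite /mean; lra.
Qed.

Lemma state_norm_le s (e : R) : `|s.1.1.1| <= e -> `|s.1.1.2| <= e ->
  `|s.1.2| <= e -> `|s.2| <= e -> `|s| <= e.
Proof.
by move=> h1 h2 h3 h4; rewrite prod_normE ge_max h4 andbT prod_normE ge_max h3 andbT prod_normE ge_max h1.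
Qed.

Lemma shifted_w_norm s : zero_mean_states s ->
  `|s.1.2 - piw phi s.1.1.1| <= Num.sqrt (fast_energy f phi V s).
Proof.
move=> Ss; rewrite -(submxrowK s.1.2) /piw -mxrowB.
apply: mxrow_norm_le => [|i]; first exact: sqrtr_ge0.
have := y_est_norm f phi V s i; rewrite (zero_mean_y phi Ss).
by rewrite /y_est opprD opprK addrA.
Qed.

Lemma shifted_z_norm s : zero_mean_states s ->
  `|s.2 - piz f phi s.1.1.1| <= (1 + 2 * K) * Num.sqrt (fast_energy f phi V s).
Proof.
move=> Ss; set q := Num.sqrt _; have q0 : 0 <= q by exact: sqrtr_ge0.
rewrite -(submxrowK s.2) /piz -mxrowB.
apply: mxrow_norm_le => [|i]; first by rewrite mulr_ge0 // addr_ge0 // mulr_ge0.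
set sg := sigma phi s.1.1.1.
have gq j : `|grad2 f (plant_state s j) (y_est phi s j) - grad2 f (plant_state s j) sg| <= K * q.
  apply: (le_trans (grad2_lip D _ _ _ _)); rewrite subrr normr0 add0r; apply: ler_wpM2l => //.
  by rewrite /sg -(zero_mean_y phi Ss); exact: y_est_norm.
have h1 : `|v_est f phi s i - mean (v_est f phi s)| <= q by exact: v_est_norm.
have h2 := gq i.
have h3 : `|mean (v_est f phi s) - mean (fun j => grad2 f (plant_state s j) sg)| <= K * q.
  rewrite (zero_mean_v f phi Ss) /mean -scalerBr -sumrB; apply: mean_norm_le => //; exact: N_pos D.
have -> : submxrow s.2 i - (- grad2 f (submxrow s.1.1.1 i) sg +
    N%:R^-1 *: \sum_j grad2 f (submxrow s.1.1.1 j) sg) =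
  (v_est f phi s i - mean (v_est f phi s)) +
  (mean (v_est f phi s) - mean (fun j => grad2 f (plant_state s j) sg)) -
  (grad2 f (plant_state s i) (y_est phi s i) - grad2 f (plant_state s i) sg).
  rewrite addrA subrK /v_est /mean /plant_state.
  by apply/rowP => k; rewrite !mxE; ring.
apply: (le_trans (ler_normB _ _)).
by have := ler_normD (v_est f phi s i - mean (v_est f phi s))
  (mean (v_est f phi s) - mean (fun j => grad2 f (plant_state s j) sg)); lra.
Qed.

Lemma plant_deviation_norm s :
  `|s.1.1.1 - hstack h s.1.1.2| <= Num.sqrt (fast_energy f phi V s).
Proof.
rewrite -(submxrowK s.1.1.1) -mxrowB; apply: mxrow_norm_le => [|j]; first exact: sqrtr_ge0.
exact: (plant_state_norm D).
Qed.

(** The fast energy controls the plant deviation and both shifted trackers; replacing [x] by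
    [hstack h u] then costs only the Lipschitz constants of [hstack], [piw] and [piz]. [C] is large
    enough for all components at once. *)
Lemma tracking_distance : exists2 C : R, 0 < C & forall s (u : 'rV[R]_(\sum_i m i)),
  zero_mean_states s ->
  `|shifted f phi s - (hstack h u, u, 0, 0)| <=
    C * (Num.sqrt (fast_energy f phi V s) + `|s.1.1.2 - u|) /\
  `|s - tracking_equilibrium h f phi u| <=
    C * (Num.sqrt (fast_energy f phi V s) + `|s.1.1.2 - u|).
Proof.
have K0' := K0.
pose C := 1 + 2 * K + 2 * K * (1 + K) * (1 + K).
have KK : 0 <= K * K by rewrite mulr_ge0.
have KKK : 0 <= K * K * K by rewrite !mulr_ge0.
have C1 : 1 <= C by rewrite /C; lra.
exists C => [|s u Ss]; first by lra.
set q := Num.sqrt _; have q0 : 0 <= q by exact: sqrtr_ge0.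
set r := `|s.1.1.2 - u|; have r0 : 0 <= r by exact: normr_ge0.
have hx : `|s.1.1.1 - hstack h u| <= q + K * r.
  rewrite -(subrK (hstack h s.1.1.2) s.1.1.1) -addrA; apply: (le_trans (ler_normD _ _)).
  by apply: lerD; [exact: plant_deviation_norm | exact: hstack_lip].
have hw := shifted_w_norm Ss; rewrite -/q in hw.
have hz := shifted_z_norm Ss; rewrite -/q in hz.
have t1 := mulr_ge0 K0' q0; have t2 := mulr_ge0 K0' r0.
have t3 := mulr_ge0 KK q0; have t4 := mulr_ge0 KK r0.
have t5 := mulr_ge0 KKK q0; have t6 := mulr_ge0 KKK r0.
have b1 : q + K * r <= C * (q + r) by rewrite /C; lra.
have b2 : r <= C * (q + r) by rewrite /C; lra.
have b3 : (1 + 2 * K) * q <= C * (q + r) by rewrite /C; lra.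
have b4 : q + 2 * K * (q + K * r) <= C * (q + r) by rewrite /C; lra.
have b5 : (1 + 2 * K) * q + 2 * (K * (1 + K)) * (q + K * r) <= C * (q + r) by rewrite /C; lra.
have b6 : q <= C * (q + r) by rewrite /C; lra.
have sE : shifted f phi s = (s.1.1.1, s.1.1.2, s.1.2 - piw phi s.1.1.1, s.2 - piz f phi s.1.1.1).
  by case: s {Ss q q0 r r0 hx hw hz t1 t2 t3 t4 t5 t6 b1 b2 b3 b4 b5 b6} => [[[? ?] ?] ?].
split; apply: state_norm_le; rewrite ?sE /=.
- exact: le_trans b1.
- exact: b2.
- by rewrite subr0; apply: (le_trans hw).
- by rewrite subr0; apply: (le_trans hz).
- exact: le_trans b1.
- exact: b2.
- apply: le_trans b4; rewrite -(subrK (piw phi s.1.1.1) s.1.2) -addrA.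
  apply: (le_trans (ler_normD _ _)); apply: lerD => //.
  by apply: (le_trans (piw_lip _ _)); rewrite ler_wpM2l // mulr_ge0.
- apply: le_trans b5; rewrite -(subrK (piz f phi s.1.1.1) s.2) -addrA.
  apply: (le_trans (ler_normD _ _)); apply: lerD => //.
  by apply: (le_trans (piz_lip _ _)); rewrite ler_wpM2l // !mulr_ge0 // addr_ge0.
Qed.

Lemma balanced_sum (xi : 'I_N -> 'rV[R]_d) : \sum_i \sum_j a i j *: (xi i - xi j) = 0.
Proof.
have -> : \sum_i \sum_j a i j *: (xi i - xi j) =
    \sum_i \sum_j a i j *: xi i - \sum_i \sum_j a i j *: xi j.
  rewrite -sumrB; apply: eq_bigr => i _; rewrite -sumrB; apply: eq_bigr => j _.
  by rewrite scalerBr.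
rewrite [X in _ - X]exchange_big /= -sumrB big1 // => i _.
by rewrite -!scaler_suml (balanced D) subrr.
Qed.

Lemma cost_bounded_below : exists B : R, forall u, B <= Fsigmah h f phi u.
Proof.
have [r Hr] := F_unbounded D 0.
pose r' := Num.max r 0.
have cF : continuous (Fsigmah h f phi) by move=> u; exact: differentiable_continuous (F_diff D u).
have A0 : [set u : 'rV[R]_(\sum_i m i) | `|u - 0| <= r'] !=set0.
  by exists 0; rewrite /= subrr normr0 /r' le_max lexx orbT.
have [c _ cmin] := compact_EVT_min A0 (@ball_compact _ _ 0 r') (continuous_subspaceT cF).
exists (Num.min 0 (Fsigmah h f phi c)) => u.
have [ru|ur] := leP r (enorm u); first by rewrite ge_min Hr.
rewrite ge_min cmin ?orbT // inE /= subr0.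
apply: (@le_trans _ _ (enorm u)); last by rewrite le_max (ltW ur).
exact: le_sqrt (normr_ge0 _) (norm_sqn u).
Qed.

Variables (kw alpha1 alpha2 : R).
Hypotheses (kw_ge1 : 1 <= kw) (a1_gt0 : 0 < alpha1) (a2_gt0 : 0 < alpha2).
Hypothesis decrease : forall (s : R -> state R d n m) (t : R), {for t, continuous s} ->
  right_derive s t (closed_loop p h f phi E a alpha1 alpha2 (s t)) ->
  zero_mean_states (s t) ->
  dini_le (lyapunov h f phi V kw \o s) t (- dissipation h f phi V kappa alpha1 (s t)).

Let g := closed_loop p h f phi E a alpha1 alpha2.
Let W := lyapunov h f phi V kw.
Let rho := dissipation h f phi V kappa alpha1.

Lemma dissipation_ge0 s : 0 <= rho s.
Proof.
have kap := kappa_gt0 D; rewrite /rho /dissipation.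
by rewrite !addr_ge0 ?mulr_ge0 ?sqn_ge0 ?plant_energy_ge0 ?dispersion_ge0 // ?divr_ge0 // ltW.
Qed.

Lemma fast_energy_le s : fast_energy f phi V s <= 2 * (W s - Fsigmah h f phi s.1.1.2).
Proof.
rewrite /W /lyapunov /fast_energy; have := kw_ge1.
have := plant_energy_ge0 V s; have := dispersion_ge0 (y_est phi s).
rewrite -/(y_energy phi s) => h1 h2 h3; have : y_energy phi s <= kw * y_energy phi s by rewrite ler_peMl.
lra.
Qed.

Section along.
Variables (T : \bar R) (s : R -> state R d n m).
Hypotheses (traj : trajectory g T s) (s0 : zero_mean_states (s 0)).

(** Weight balance makes the Laplacian terms cancel when summed over the agents, so the sums of the
    [w] and of the [z] blocks have zero right derivative. *)
Lemma zero_mean_invariant t : time_domain T t -> zero_mean_states (s t).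
Proof.
move=> tT.
have cproj (pr : state R d n m -> 'rV[R]_(\sum_(i < N) d)) :
    (forall s1 s2, `|pr s1 - pr s2| <= `|s1 - s2|) ->
    continuous (fun s1 => \sum_i submxrow (pr s1) i : 'rV[R]_d).
  move=> H; apply: (@lipschitz_continuous _ _ _ _ N%:R) => s1 s2; rewrite -sumrB.
  apply: (le_trans (ler_norm_sum _ _ _)).
  apply: (@le_trans _ _ (\sum_(i < N) `|s1 - s2|)).
    by apply: ler_sum => i _; rewrite -submxrowB; apply: le_trans (H s1 s2); exact: submxrow_norm.
  by rewrite sumr_const card_ord mulr_natl.
have vanish (xi : 'I_N -> 'rV[R]_d) :
    \sum_i - (alpha2^-1 *: \sum_j a i j *: (xi i - xi j)) = 0.
  by rewrite sumrN -scaler_sumr balanced_sum scaler0 oppr0.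
have invw := trajectory_invariant traj (cproj (fun s1 => s1.1.2) (@state_w_norm _ _ _ _ _)).
have invz := trajectory_invariant traj (cproj (fun s1 => s1.2) (@state_z_norm _ _ _ _ _)).
have -> : zero_mean_states (s t) = (\sum_i (submxrow (s t).1.2 i : 'rV[R]_d) = 0 /\
    \sum_i (submxrow (s t).2 i : 'rV[R]_d) = 0).
  by case: (s t) => [[[? ?] ?] ?].
have [w0 z0] : \sum_i (submxrow (s 0).1.2 i : 'rV[R]_d) = 0 /\
    \sum_i (submxrow (s 0).2 i : 'rV[R]_d) = 0.
  by move: s0; case: (s 0) => [[[? ?] ?] ?].
split.
  rewrite invw // => r r0 rT; have [_ ds] := trajectory_derive traj r0 rT.
  have := @right_derive_sum _ _ _ (index_enum 'I_N) xpredT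
    (fun i q => submxrow (s q).1.2 i : 'rV[R]_d) r _ (fun i => dw D ds i).
  by rewrite vanish.
rewrite invz // => r r0 rT; have [_ ds] := trajectory_derive traj r0 rT.
have := @right_derive_sum _ _ _ (index_enum 'I_N) xpredT
  (fun i q => submxrow (s q).2 i : 'rV[R]_d) r _ (fun i => dz D ds i).
by rewrite vanish.
Qed.

Lemma along_decrease t : 0 < t -> (t%:E < T)%E -> dini_le (W \o s) t (- rho (s t)).
Proof.
move=> t0 tT; have [cs ds] := trajectory_derive traj t0 tT.
by apply: decrease => //; apply: zero_mean_invariant; split => //; exact: ltW.
Qed.

Lemma lyapunov_le t : time_domain T t -> W (s t) <= W (s 0).
Proof.
move=> tT; have cW : continuous W by exact: (continuous_lyapunov D).
have dW r : 0 < r -> (r%:E < T)%E -> dini_le (W \o s) r 0.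
  move=> r0 rT; apply: dini_leW (along_decrease r0 rT).
  by rewrite oppr_le0 dissipation_ge0.
by have := trajectory_le traj cW dW tT; rewrite mul0r addr0.
Qed.

(** The cost is at most [W (s 0)] along the trajectory, so radial unboundedness at the level
    [W (s 0) + 1] confines [u], and the lower bound [B] on the cost turns the bound on [W] into one
    on the fast energy. [tracking_distance] from the equilibrium over [u = 0] bounds the rest,
    uniformly in the horizon. *)
Lemma trajectory_bounded : exists M : R, forall t, time_domain T t ->
  `|s t| <= M /\ fast_energy f phi V (s t) <= M.
Proof.
have [B HB] := cost_bounded_below.
have [r Hr] := F_unbounded D (W (s 0) + 1).
have [C C0 HC] := tracking_distance.
pose F1 := 2 * (W (s 0) - B).
exists (Num.max (`|tracking_equilibrium h f phi 0| + C * (Num.sqrt F1 + r)) F1) => t tT.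
have Wt := lyapunov_le tT.
have fe := fast_energy_le (s t); have Bt := HB (s t).1.1.2.
have f1 : fast_energy f phi V (s t) <= F1.
  apply: (le_trans fe); rewrite /F1; move: Wt Bt.
  by move: (W _) (W _) (Fsigmah _ _ _ _) => w1 w2 F; lra.
split; last by rewrite le_max f1 orbT.
have ur : `|(s t).1.1.2| <= r.
  apply: (@le_trans _ _ (enorm (s t).1.1.2)).
    exact: le_sqrt (normr_ge0 _) (norm_sqn _).
  rewrite leNgt; apply/negP => /ltW/Hr.
  have := fast_energy_ge0 f phi V (s t); move: fe Wt.
  by move: (W _) (W _) (Fsigmah _ _ _ _) (fast_energy _ _ _ _) => w1 w2 F fa; lra.
rewrite le_max; apply/orP; left.
have [_] := HC (s t) 0 (zero_mean_invariant tT); rewrite subr0 => H.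
rewrite -(subrK (tracking_equilibrium h f phi 0) (s t)) addrC.
apply: (le_trans (ler_normD _ _)); rewrite lerD2l; apply: (le_trans H).
rewrite ler_pM2l //; apply: lerD => //; exact: ler_wsqrtr.
Qed.

End along.

End closed_loop_trajectories.

(** * Convergence to the stationary set *)

Section conclusions.
Variables (R : realType) (N d : nat) (n m : 'I_N -> nat).
Variable p : forall i, 'rV[R]_(n i) -> 'rV[R]_(m i) -> 'rV[R]_(n i).
Variable h : forall i, 'rV[R]_(m i) -> 'rV[R]_(n i).
Variable f : forall i, 'rV[R]_(n i) -> 'rV[R]_d -> R.
Variable phi : forall i, 'rV[R]_(n i) -> 'rV[R]_d.
Variable E : rel 'I_N.
Variable a : 'I_N -> 'I_N -> R.
Variable V : forall i, 'rV[R]_(n i) -> 'rV[R]_(m i) -> R.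
Variables K kappa lambda CL : R.
Hypothesis D : uniform_data p h f phi E a V K kappa lambda CL.
Variables (kw alpha1 alpha2 : R).
Hypotheses (kw_ge1 : 1 <= kw) (a1_gt0 : 0 < alpha1) (a2_gt0 : 0 < alpha2).
Hypothesis decrease : forall (s : R -> state R d n m) (t : R), {for t, continuous s} ->
  right_derive s t (closed_loop p h f phi E a alpha1 alpha2 (s t)) ->
  zero_mean_states (s t) ->
  dini_le (lyapunov h f phi V kw \o s) t (- dissipation h f phi V kappa alpha1 (s t)).

Let g := closed_loop p h f phi E a alpha1 alpha2.
Let W := lyapunov h f phi V kw.
Let rho := dissipation h f phi V kappa alpha1.
Let gF := grad (Fsigmah h f phi).

Lemma sqn_eq0 k (v : 'rV[R]_k) : sqn v <= 0 -> v = 0.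
Proof.
move=> v0; apply/eqP; rewrite -normr_le0 -(@ler_pXn2r _ 2) ?nnegrE // expr0n /=.
exact: le_trans (norm_sqn v) v0.
Qed.

Lemma continuous_sqn_gradF : continuous (fun u => sqn (gF u)).
Proof. apply: continuous_sqn; exact: gradF_cont D. Qed.

(** Supplies the bounded speed for the Barbalat argument. The gradient is bounded on a compact ball
    by continuity, its error by [descent_error], and the other velocities directly by the fast
    energy. *)
Lemma speed_bound (M : R) : exists B : R, forall s : state R d n m,
  zero_mean_states s -> `|s| <= M -> fast_energy f phi V s <= M -> `|g s| <= B.
Proof.
pose M' := Num.max M 0.
have A0 : [set u : 'rV[R]_(\sum_i m i) | `|u - 0| <= M'] !=set0.
  by exists 0; rewrite /= subrr normr0 /M' le_max lexx orbT.
have [c _ cmax] := compact_EVT_max A0 (@ball_compact _ _ 0 M')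
  (continuous_subspaceT continuous_sqn_gradF).
pose A1 := sqn (gF c); pose C1 := error_constant d n m K.
have C10 : 0 <= C1.
  have K0 : 0 <= K by have := K_ge1 D; lra.
  by rewrite /C1 /error_constant mulr_ge0 ?sqr_ge0.
pose b1 := Num.sqrt (K ^+ 2 * M).
pose b2 := alpha1 * Num.sqrt (2 * A1 + 2 * (C1 * M)).
pose b3 := alpha2^-1 * Num.sqrt (CL * M).
have b10 : 0 <= b1 by exact: sqrtr_ge0.
have b20 : 0 <= b2 by rewrite mulr_ge0 ?sqrtr_ge0 // ltW.
have b30 : 0 <= b3 by rewrite mulr_ge0 ?sqrtr_ge0 // invr_ge0 ltW.
exists (b1 + b2 + b3) => s Ss sM fM.
have uM : `|s.1.1.2| <= M.
  by apply: le_trans sM; have := state_u_norm s 0; rewrite !subr0.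
have P0 := plant_energy_ge0 V s.
have Q0 := dispersion_ge0 (y_est phi s); have Z0 := dispersion_ge0 (v_est f phi s).
have AA : sqn (gF s.1.1.2) <= A1.
  by apply: cmax; rewrite inE /= subr0 /M' le_max uM.
have BB := descent_error D Ss.
have hb1 : b1 <= b1 + b2 + b3 by lra.
have hb2 : b2 <= b1 + b2 + b3 by lra.
have hb3 : b3 <= b1 + b2 + b3 by lra.
have sum0 : 0 <= b1 + b2 + b3 by lra.
have lapM (xi : 'I_N -> 'rV[R]_d) i : dispersion xi <= M ->
    `|- (alpha2^-1 *: \sum_j a i j *: (xi i - xi j))| <= b3.
  move=> xM; rewrite normrN normrZ gtr0_norm ?invr_gt0 //; apply: ler_wpM2l.
    by rewrite invr_ge0 ltW.
  apply: le_sqrt => //; apply: (le_trans (norm_sqn _)).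
  apply: (@le_trans _ _ (CL * dispersion xi)); last by apply: ler_wpM2l => //; exact: CL_ge0 D.
  apply: le_trans (lap_bound D xi); rewrite [leRHS](bigD1 i) //= lerDl sumr_ge0 // => j _; exact: sqn_ge0.
rewrite /g (closed_loopE D); apply: state_norm_le => /=; apply: mxrow_norm_le => // i.
- apply: le_trans hb1; apply: le_sqrt => //.
  apply: (@le_trans _ _ (K ^+ 2 * plant_energy V s)); last first.
    apply: ler_wpM2l; first exact: sqr_ge0.
    by apply: le_trans fM; rewrite /fast_energy /y_energy /v_energy; lra.
  (* An estimate stated along a curve depends only on its current point, so a constant curve yields
     it at a state. *)
  apply: le_trans (plant_rate D (fun=> s) 0).
  by rewrite (bigD1 i) //= lerDl sumr_ge0 // => j _; exact: sqr_ge0.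
- apply: le_trans hb2; rewrite normrN normrZ gtr0_norm //; apply: ler_wpM2l; first exact: ltW.
  apply: le_sqrt => //.
  have := sqn_descent h f phi (fun=> s) 0 => SD.
  apply: (@le_trans _ _ (\sum_i `|descent h f phi s i| ^+ 2)).
    by rewrite (bigD1 i) //= lerDl sumr_ge0 // => j _; exact: sqr_ge0.
  apply: (le_trans SD); apply: lerD; first by apply: ler_wpM2l.
  apply: ler_wpM2l => //; apply: (le_trans BB); exact: ler_wpM2l.
- apply: le_trans hb3; apply: lapM; apply: le_trans fM.
  by rewrite /fast_energy /y_energy /v_energy; lra.
- apply: le_trans hb3; apply: lapM; apply: le_trans fM.
  by rewrite /fast_energy /y_energy /v_energy; lra.
Qed.

Lemma state_ball_compact (M : R) : compact
  (([set x : 'rV[R]_(\sum_i n i) | `|x - 0| <= M] `*` [set u : 'rV[R]_(\sum_i m i) | `|u - 0| <= M])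
   `*` [set w : 'rV[R]_(\sum_(i < N) d) | `|w - 0| <= M]
   `*` [set z : 'rV[R]_(\sum_(i < N) d) | `|z - 0| <= M]).
Proof. by do 3?apply: compact_setX; exact: ball_compact. Qed.

Lemma dissipation_cvg (s : R -> state R d n m) : trajectory g +oo%E s ->
  zero_mean_states (s 0) -> forall e : R, 0 < e ->
  exists2 T0 : R, 0 < T0 & forall t, T0 <= t -> rho (s t) < e.
Proof.
move=> traj S0; have [M HM] := trajectory_bounded D kw_ge1 a1_gt0 decrease traj S0.
have dom t : 0 <= t -> time_domain +oo%E t by move=> t0; split => //; rewrite ltry.
have [B HB] := speed_bound M.
apply: (@lyapunov_dissipation_cvg R _ g s _ W rho B traj (@state_ball_compact M)).
- move=> t /dom/HM[sM _] /=; rewrite !subr0.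
  have H1 := state_x_norm (s t) 0; have H2 := state_u_norm (s t) 0.
  have H3 := state_w_norm (s t) 0; have H4 := state_z_norm (s t) 0.
  rewrite !subr0 in H1 H2 H3 H4.
  by split; [split; [split|]|]; apply: le_trans sM.
- exact: (continuous_lyapunov D).
- exact: (continuous_dissipation D).
- exact: (dissipation_ge0 D a1_gt0).
- move=> t /ltW/dom tT; have [sM fM] := HM t tT.
  by apply: HB => //; exact: (zero_mean_invariant D traj S0).
- move=> t t0; apply: (along_decrease D decrease traj S0) => //; exact: ltry.
Qed.

Lemma residual_cvg (s : R -> state R d n m) : trajectory g +oo%E s ->
  zero_mean_states (s 0) -> forall e : R, 0 < e ->
  exists2 T0 : R, 0 < T0 & forall t, T0 <= t ->
    Num.sqrt (fast_energy f phi V (s t)) < e /\ sqn (gF (s t).1.1.2) < e.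
Proof.
move=> traj S0 e e0; have kap := kappa_gt0 D; have a1 := a1_gt0.
(* A common lower bound for the coefficients of the three fast energies in [rho]. *)
pose c := Num.min (kappa / 2) 1.
have c0 : 0 < c by rewrite lt_min ltr01 divr_gt0.
have c1 : c <= kappa / 2 by rewrite ge_min lexx.
have c2 : c <= 1 by rewrite ge_min lexx orbT.
have e1 : 0 < Num.min (c * (e / 2) ^+ 2) (alpha1 / 2 * e).
  by rewrite lt_min !mulr_gt0 // ?divr_gt0 // exprn_gt0 // divr_gt0.
have [T0 T00 HT] := dissipation_cvg traj S0 e1.
exists T0 => // t /HT; rewrite lt_min /rho /dissipation => /andP[H1 H2].
have P0 := plant_energy_ge0 V (s t).
have Q0 := dispersion_ge0 (y_est phi (s t)); have Z0 := dispersion_ge0 (v_est f phi (s t)).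
have A0 := sqn_ge0 (gF (s t).1.1.2).
rewrite -/gF in H1 H2 *; rewrite -/(y_energy _ _) in Q0; rewrite -/(v_energy _ _ _) in Z0.
have A0' := mulr_ge0 (ltW (divr_gt0 a1 (ltr0Sn R 1))) A0.
have P0' := mulr_ge0 (ltW (divr_gt0 kap (ltr0Sn R 1))) P0.
split; last first.
  rewrite -(ltr_pM2l (divr_gt0 a1 (ltr0Sn R 1))); apply: le_lt_trans H2.
  move: (_ * sqn _) A0' => X X0; lra.
have fe : c * fast_energy f phi V (s t) <= c * (e / 2) ^+ 2.
  apply: le_trans (ltW H1); rewrite /fast_energy !mulrDr.
  have k1 := ler_wpM2r P0 c1; have k2 := ler_wpM2r Q0 c2; have k3 := ler_wpM2r Z0 c2.
  rewrite !mul1r in k2 k3; move: (_ * sqn _) A0' k1 k2 k3 => X X0.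
  move: (c * plant_energy _ _) (c * y_energy _ _) (c * v_energy _ _ _) (kappa / 2 * _).
  by move: (y_energy _ _) (v_energy _ _ _) => *; lra.
rewrite ler_pM2l // in fe.
apply: (@le_lt_trans _ _ (e / 2)); last lra.
have e2 : 0 <= e / 2 by lra.
by rewrite -[leRHS]ger0_norm // -sqrtr_sqr; exact: ler_wsqrtr.
Qed.

Lemma state_norm_equiv : exists2 c : R, 0 < c & forall s : state R d n m, state_norm s <= c * `|s|.
Proof.
pose k := ((\sum_i n i + \sum_i m i) + (\sum_(i < N) d + \sum_(i < N) d))%N.
exists (k%:R + 1) => [|s]; first by rewrite ltr_wpDl.
have row_le k1 k2 (x : 'rV[R]_k1) (y : 'rV[R]_k2) (e : R) : 0 <= e -> `|x| <= e -> `|y| <= e ->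
    `|row_mx x y| <= e.
  move=> e0 xe ye; apply: rV_norm_le => // j; rewrite mxE.
  by case: (fintype.split j) => l; [apply: le_trans xe | apply: le_trans ye]; exact: coord_norm_le.
case: s => [[[x u] w] z]; rewrite /state_norm.
have H1 := state_x_norm ((x, u, w, z) : state R d n m) 0.
have H2 := state_u_norm ((x, u, w, z) : state R d n m) 0.
have H3 := state_w_norm ((x, u, w, z) : state R d n m) 0.
have H4 := state_z_norm ((x, u, w, z) : state R d n m) 0.
rewrite !subr0 /= in H1 H2 H3 H4.
set e := `|((x, u, w, z) : state R d n m)| in H1 H2 H3 H4 *; have e0 : 0 <= e by exact: normr_ge0.
have rn : `|row_mx (row_mx x u) (row_mx w z)| <= e by apply: (row_le) => //; apply: row_le.
have k0 : 0 <= (k%:R + 1) * e by rewrite mulr_ge0 // addr_ge0.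
rewrite -[leRHS]ger0_norm // -sqrtr_sqr; apply: ler_wsqrtr.
apply: (le_trans (sqn_le _)); rewrite exprMn.
have kk : k%:R <= (k%:R + 1) ^+ 2 :> R by have := ler0n R k; nra.
by apply: ler_pM => //; apply: lerXn2r; rewrite ?nnegrE.
Qed.

(** The input need not settle at one stationary point: at each late time [near_zero_set] provides a
    possibly different [u0], whose point of the target bounds the infimum from above. *)
Lemma target_distance_cvg (s : R -> state R d n m) : trajectory g +oo%E s ->
  zero_mean_states (s 0) ->
  state_dist (target h f phi) (shifted f phi (s t)) @[t --> +oo] --> 0%E.
Proof.
move=> traj S0; have [M HM] := trajectory_bounded D kw_ge1 a1_gt0 decrease traj S0.
have [C C0 HC] := tracking_distance D.
have [c c0 Hc] := state_norm_equiv.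
suff H : forall e : R, 0 < e -> exists2 T0 : R, 0 < T0 & forall t, T0 <= t ->
    (state_dist (target h f phi) (shifted f phi (s t)) <= e%:E)%E.
  move=> U HU; have /nbhs_normP[e /= e0 He] : \forall r \near (0 : R), U r%:E := HU.
  have e2 : 0 < e / 2 by lra.
  have [T0 T00 HT] := H _ e2.
  exists T0; split; first exact: num_real.
  move=> t /ltW/HT dle.
  have d0 : (0%:E <= state_dist (target h f phi) (shifted f phi (s t)))%E.
    apply: le_ereal_inf_tmp => _ [s' _ <-]; rewrite lee_fin.
    by case: (_ - _) => [[[? ?] ?] ?]; exact: sqrtr_ge0.
  rewrite /=; move: (state_dist _ _) d0 dle => [r||] //=; rewrite !lee_fin => r0 re.
  by apply: He; rewrite /= sub0r normrN ger0_norm //; lra.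
move=> e e0; pose e1 := e / (2 * (c * C)).
have cC : 0 < c * C by rewrite mulr_gt0.
have e10 : 0 < e1 by rewrite divr_gt0 // mulr_gt0.
have e1E : c * (C * (e1 + e1)) = e by rewrite /e1; field; rewrite !gt_eqF.
have [eta eta0 Heta] := near_zero_set (@ball_compact _ _ 0 M) continuous_sqn_gradF
  (fun u => sqn_ge0 (gF u)) e10.
have e2 : 0 < Num.min e1 eta by rewrite lt_min e10.
have [T0 T00 HT] := residual_cvg traj S0 e2.
exists T0 => // t Tt; have [] := HT t Tt; rewrite !lt_min => /andP[fe _] /andP[_ ge].
have dom : time_domain +oo%E t by split; [exact: le_trans (ltW T00) Tt | rewrite ltry].
have uM : `|(s t).1.1.2 - 0| <= M.
  by have [sM _] := HM t dom; apply: le_trans sM; have := state_u_norm (s t) 0; rewrite !subr0.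
have [u0 [_ gu0 uu0]] := Heta _ uM ge.
have St := zero_mean_invariant D traj S0 dom.
have [H1 _] := HC (s t) u0 St.
apply: (@le_trans _ _ (state_norm (shifted f phi (s t) - (hstack h u0, u0, 0, 0)))%:E).
  apply: ereal_inf_lbound; exists (hstack h u0, u0, 0, 0) => //; split => //; split => //=.
  by apply: sqn_eq0; rewrite -/gF gu0.
rewrite lee_fin -e1E; apply: (le_trans (Hc _)); rewrite ler_pM2l //.
apply: (le_trans H1); rewrite ler_pM2l //; apply: lerD; exact: ltW.
Qed.

(** * Stability at an isolated local minimum *)

Section local_minimum.
Variable ubar : 'rV[R]_(\sum_i m i).
Hypothesis ubar_isolated : isolated_stationary_point h f phi ubar.
Hypothesis ubar_min : local_minimum h f phi ubar.

Let F := Fsigmah h f phi.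
Let e := tracking_equilibrium h f phi ubar.

Lemma local_min_grad u : (\forall u' \near u, F u <= F u') -> gF u = 0.
Proof.
move=> /nbhs_normP[r /= r0 Hr].
have l := @right_derive_line R _ u (- gF u).
have := @right_derive_comp R _ _ F (fun s : R => u + s *: - gF u) 0 (- gF u).
rewrite /= scale0r addr0 => /(_ (F_diff D u) l); rewrite (diff_grad _ (F_diff D u)).
have -> : dot (- gF u) (grad F u) = - sqn (gF u) by rewrite -scaleN1r dotZl dot_sqn mulN1r.
move=> dF; apply: sqn_eq0; rewrite leNgt; apply/negP => gpos.
have g2 : 0 < sqn (gF u) / 2 by lra.
have g1 : 0 < `|gF u| + 1 by rewrite ltr_wpDl.
have : \forall s \near (0 : R)^'+, False.
  have sm : \forall s \near (0 : R)^'+, s < r / (`|gF u| + 1).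
    by apply: nbhs_right_lt; rewrite divr_gt0.
  apply: filterS3 (nbhs_right_gt 0) sm (right_derive_dini dF g2) => s s0 sr.
  rewrite /= add0r scale0r addr0.
  have : F u <= F (u + s *: - gF u).
    apply: Hr; rewrite /= opprD addrA subrr sub0r normrN normrZ normrN gtr0_norm //.
    apply: le_lt_trans (_ : s * (`|gF u| + 1) < r).
      by rewrite ler_pM2l // lerDl.
    by rewrite -ltr_pdivlMr.
  have : 0 < s * (sqn (gF u) / 2) by rewrite mulr_gt0.
  lra.
by move=> /filter_ex[].
Qed.

(** Isolation makes the minimum strict: a nearby [u] with the same cost would itself be a local
    minimum, hence stationary, hence [ubar]. The radius is halved so that such a [u] keeps a
    neighbourhood where the cost is at least [F ubar]. *)
Lemma isolated_min_radius : exists2 r : R, 0 < r & forall u, `|u - ubar| <= r ->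
  (gF u = 0 -> u = ubar) /\ (u != ubar -> F ubar < F u).
Proof.
have [_ [V0 /nbhs_normP[r1 /= r10 H1] VA]] := ubar_isolated.
have /nbhs_normP[r2 /= r20 H2] := ubar_min.
pose r := Num.min r1 r2; have r0 : 0 < r by rewrite lt_min r10.
have crit u : `|u - ubar| < r -> gF u = 0 -> u = ubar.
  rewrite lt_min => /andP[ur1 _] gu; suff : [set ubar] u by [].
  by rewrite -VA; split => //; apply: H1; rewrite /= distrC.
have minF u : `|u - ubar| < r -> F ubar <= F u.
  by rewrite lt_min => /andP[_ ur2]; apply: H2; rewrite /= distrC.
have lt_half u : `|u - ubar| <= r / 2 -> `|u - ubar| < r by lra.
exists (r / 2) => [|u /lt_half ur]; first lra.
split; first exact: crit.
move=> une; rewrite lt_neqAle minF // andbT; apply/eqP => Fu.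
move/eqP: une; apply; apply: crit => //; apply: local_min_grad.
apply/nbhs_normP; exists (r - `|u - ubar|) => /=; first lra.
move=> u' uu'; rewrite -Fu; apply: minF.
rewrite -(subrK u u') -addrA; apply: (le_lt_trans (ler_normD _ _)).
by move: uu'; rewrite /= distrC; lra.
Qed.

Lemma equilibrium_zero_mean : zero_mean_states e.
Proof.
have key (xi : 'I_N -> 'rV[R]_d) (c : 'rV[R]_d) : c = mean xi -> \sum_i (- xi i + c) = 0.
  move=> ->; have := sum_sub_mean xi (N_pos D) => /(congr1 -%R); rewrite oppr0 -sumrN => H.
  by rewrite -[RHS]H; apply: eq_bigr => i _; rewrite opprB addrC.
rewrite /e /tracking_equilibrium /zero_mean_states /=; split.
  under eq_bigr do rewrite mxrowK.
  exact: key.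
under eq_bigr do rewrite mxrowK.
exact: key.
Qed.

Lemma equilibrium_fast_energy : fast_energy f phi V e = 0.
Proof.
have yE i : y_est phi e i = sigma phi (hstack h ubar).
  by rewrite /y_est /e /= mxrowK addrC addrA subrr add0r.
have vE i : v_est f phi e i = mean (fun j => grad2 f (submxrow (hstack h ubar) j) (sigma phi (hstack h ubar))).
  by rewrite /v_est yE /e /= mxrowK addrC addrA subrr add0r.
have cst0 (xi : 'I_N -> 'rV[R]_d) c : (forall i, xi i = c) -> dispersion xi = 0.
  move=> xc; apply/eqP; rewrite eq_le dispersion_ge0 andbT.
  apply: (le_trans (dispersion_le xi c (N_pos D))); rewrite big1 // => i _.
  by rewrite xc subrr /sqn big1 // => j _; rewrite mxE expr0n.
rewrite /fast_energy /y_energy /v_energy (cst0 _ _ yE) (cst0 _ _ vE) !addr0.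
rewrite /plant_energy big1 // => i _.
have := V_bounds D (plant_state e i) (plant_input e i).
have -> : plant_state e i = h (plant_input e i) by rewrite /plant_state /= mxrowK.
by rewrite subrr normr0 mulr0 -eq_le => /eqP <-; rewrite expr0n.
Qed.

Lemma equilibrium_grad0 : gF ubar = 0.
Proof. by have [+ _] := ubar_isolated; rewrite inE. Qed.

(** The fast energy vanishes here, so [descent_error] identifies the descent direction with the
    gradient, which is zero, and the estimates equal their means, which kills the Laplacian
    terms. *)
Lemma equilibrium_stationary : g e = 0.
Proof.
have K0 : 0 <= K by have := K_ge1 D; lra.
have fe := equilibrium_fast_energy.
have dG : \mxrow_i descent h f phi e i = gF ubar.
  have := descent_error D equilibrium_zero_mean; rewrite fe mulr0 => /sqn_eq0 /eqP.
  by rewrite subr_eq0 => /eqP.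
rewrite equilibrium_grad0 in dG.
have ye i : y_est phi e i = mean (y_est phi e).
  apply/eqP; rewrite -subr_eq0 -normr_le0; apply: (le_trans (y_est_norm f phi V e i)).
  by rewrite fe sqrtr0.
have ve i : v_est f phi e i = mean (v_est f phi e).
  apply/eqP; rewrite -subr_eq0 -normr_le0; apply: (le_trans (v_est_norm f phi V e i)).
  by rewrite fe sqrtr0.
rewrite /g (closed_loopE D).
have z1 : \mxrow_i p (plant_state e i) (plant_input e i) = 0.
  rewrite -[RHS]mxrow0; apply/eq_mxrowP => i.
  have -> : plant_state e i = h (plant_input e i) by rewrite /plant_state /= mxrowK.
  exact: p_equil D _ _.
have z2 : \mxrow_i - (alpha1 *: descent h f phi e i) = 0.
  rewrite -[RHS]mxrow0; apply/eq_mxrowP => i.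
  have := congr1 (fun M => submxrow M i) dG; rewrite mxrowK submxrow0 => ->.
  by rewrite scaler0 oppr0.
have z3 (xi : 'I_N -> 'rV[R]_d) : (forall i, xi i = mean xi) ->
    \mxrow_i - (alpha2^-1 *: \sum_j a i j *: (xi i - xi j)) = 0.
  move=> xm; rewrite -[RHS]mxrow0; apply/eq_mxrowP => i.
  rewrite big1 ?scaler0 ?oppr0 // => j _.
  by rewrite (xm i) (xm j) subrr scaler0.
by rewrite z1 z2 (z3 _ ye) (z3 _ ve).
Qed.

Lemma equilibrium_lyapunov : W e = F ubar.
Proof.
have := equilibrium_fast_energy; rewrite /W /lyapunov /fast_energy /=.
have := plant_energy_ge0 V e; have := dispersion_ge0 (y_est phi e).
have := dispersion_ge0 (v_est f phi e).
rewrite -/(y_energy phi e) -/(v_energy f phi e) -/F.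
move: (plant_energy _ _) (y_energy _ _) (v_energy _ _ _) => P Q Z Z0 Q0 P0 PQZ.
have -> : P = 0 by lra.
have -> : Q = 0 by lra.
have -> : Z = 0 by lra.
by rewrite !mulr0 !addr0.
Qed.

(** Beyond stability, [r] confines the input to a ball which, when the lemma is applied, contains no
    stationary point other than [ubar]; the attraction proof relies on that. *)
Lemma trapping (eps r : R) : 0 < eps -> 0 < r ->
  (forall u, `|u - ubar| <= r -> u != ubar -> F ubar < F u) ->
  exists2 delta : R, 0 < delta & forall (T : \bar R) (s : R -> state R d n m),
    trajectory g T s -> zero_mean_states (s 0) -> `|s 0 - e| < delta ->
    forall t, time_domain T t -> `|s t - e| < eps /\ `|(s t).1.1.2 - ubar| <= r.
Proof.
move=> eps0 r0 minF; have [C C0 HC] := tracking_distance D.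
pose q := eps / (4 * C); have q0 : 0 < q by rewrite divr_gt0 // mulr_gt0.
have qE : C * (q + q) = eps / 2 by rewrite /q; field; rewrite gt_eqF.
(* The trajectory cannot cross the sphere |u - ubar| = r1, because there F exceeds
   F ubar, the value of W at the equilibrium, by a fixed amount. *)
pose r1 := Num.min r q; have r10 : 0 < r1 by rewrite lt_min r0.
have r1r : r1 <= r by rewrite ge_min lexx.
have r1q : r1 <= q by rewrite ge_min lexx orbT.
have dist_cont : continuous (fun u : 'rV[R]_(\sum_i m i) => `|u - ubar|).
  move=> u; apply: (@lipschitz_continuous _ _ _ (fun u : 'rV[R]_(\sum_i m i) => `|u - ubar|) 1) => x y.
  by rewrite mul1r; apply: (le_trans (ler_dist_dist _ _)); rewrite opprB addrA subrK.
have Fcont : continuous F by move=> u; exact: differentiable_continuous (F_diff D u).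
have [mu mu0 Hmu] : exists2 mu : R, 0 < mu & forall u, `|u - ubar| = r1 -> mu <= F u - F ubar.
  have cA : compact ([set u | `|u - ubar| <= r1] `&` [set u | r1 <= `|u - ubar|]).
    apply: compact_closedI; first exact: ball_compact.
    apply: (@closed_comp _ _ (fun u : 'rV[R]_(\sum_i m i) => `|u - ubar|) [set x : R | r1 <= x]).
      by move=> u _; exact: dist_cont.
    exact: closed_ge.
  have cG : continuous (fun u => F u - F ubar).
    by move=> u; apply: (@continuousB _ _ _ F (fun=> F ubar) u (Fcont u)); exact: cst_continuous.
  have [|mu mu0 H] := compact_pos_lower_bound cA cG.
    move=> u [/= u1 u2]; rewrite subr_gt0; apply: minF; first exact: le_trans r1r.
    by apply/eqP => uE; move: u2; rewrite uE subrr normr0; lra.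
  by exists mu => // u ur; apply: H; rewrite /= ur.
(* [mu] excludes the sphere; [q ^+ 2 / 2] keeps the fast energy, at most twice the excess of [W]
   over the cost, below [q ^+ 2]. *)
pose nu := Num.min mu (q ^+ 2 / 2).
have nu0 : 0 < nu by rewrite lt_min mu0 divr_gt0 // exprn_gt0.
have numu : nu <= mu by rewrite ge_min lexx.
have nuq : nu <= q ^+ 2 / 2 by rewrite ge_min lexx orbT.
have /nbhs_normP[d1 /= d10 Hd1] : \forall s \near e, W s < F ubar + nu.
  apply: ((continuous_lyapunov D) kw e _ (lt_nbhsl _)).
  by rewrite -/W equilibrium_lyapunov ltrDl.
exists (Num.min d1 r1) => [|T s traj S0]; first by rewrite lt_min d10.
rewrite lt_min => /andP[sd sr] t tT.
have W0 : W (s 0) < F ubar + nu by apply: Hd1; rewrite /= distrC.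
have Flt q' : time_domain T q' -> F (s q').1.1.2 < F ubar + nu.
  move=> qT; have := lyapunov_le D a1_gt0 decrease traj S0 qT.
  have := fast_energy_le h f phi V kw_ge1 (s q'); have := fast_energy_ge0 f phi V (s q').
  rewrite -/W -/F; move: (W _) (W _) (F _) (F _) (fast_energy _ _ _ _) W0 => *; lra.
have ut : `|(s t).1.1.2 - ubar| < r1.
  rewrite ltNge; apply/negP => tr; case: (tT) => t0 tT'.
  have sub : `[0, t]%classic `<=` time_domain T.
    move=> x /=; rewrite in_itv /= => /andP[x0 xt]; split => //.
    by apply: le_lt_trans tT'; rewrite lee_fin.
  have cs : {within `[0, t], continuous (fun t => `|(s t).1.1.2 - ubar|)}.
    have cd : continuous (fun s : state R d n m => `|s.1.1.2 - ubar|).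
      apply: (@lipschitz_continuous _ _ _ _ 1) => s1 s2; rewrite mul1r.
      by apply: (le_trans (ler_dist_dist _ _)); rewrite opprB addrA subrK; exact: state_u_norm.
    case: traj => _ cs _; move: (continuous_subspaceW sub cs) => cs' x.
    exact: (@continuous_comp (subspace `[0, t]) _ _ s _ x (cs' x) (cd _)).
  have u0 : `|(s 0).1.1.2 - ubar| <= r1.
    have eu : e.1.1.2 = ubar by [].
    by rewrite -eu; apply: (le_trans (state_u_norm (s 0) e)); exact: ltW.
  have [|c] := IVT t0 cs (v := r1); first by rewrite ge_min u0 /= le_max tr orbT.
  rewrite in_itv /= => /andP[c0 ct] cr.
  have cT : time_domain T c by apply: sub; rewrite /= in_itv /= c0.
  by have := Flt c cT; have := Hmu _ cr; move: (F _) (F _) => *; lra.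
split; last by apply: ltW; exact: lt_le_trans r1r.
have St := zero_mean_invariant D traj S0 tT.
have [_ H] := HC (s t) ubar St; apply: (le_lt_trans H).
have Fu : F ubar <= F (s t).1.1.2.
  have [->//|une] := eqVneq (s t).1.1.2 ubar.
  by apply: ltW; apply: minF => //; apply: ltW; exact: lt_le_trans r1r.
have sq : Num.sqrt (fast_energy f phi V (s t)) <= q.
  rewrite -[leRHS]ger0_norm ?(ltW q0) // -sqrtr_sqr; apply: ler_wsqrtr.
  have := lyapunov_le D a1_gt0 decrease traj S0 tT.
  have := fast_energy_le h f phi V kw_ge1 (s t).
  rewrite -/W -/F; move: (W _) (W _) (F _) (F _) (fast_energy _ _ _ _) W0 Fu => *; lra.
apply: (@le_lt_trans _ _ (C * (q + q))); last by rewrite qE gtr_pMr // invf_lt1 // ltr1n.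
by rewrite ler_pM2l //; apply: lerD => //; apply: ltW; exact: lt_le_trans r1q.
Qed.

Lemma locally_asymptotically_stable :
  locally_asymptotically_stable_on (@zero_mean_states R N d n m) g e.
Proof.
have [r r0 Hr] := isolated_min_radius.
have minF u : `|u - ubar| <= r -> u != ubar -> F ubar < F u by move=> /Hr[].
split; [exact: equilibrium_zero_mean | exact: equilibrium_stationary | |].
  move=> eps eps0; have [delta d0 H] := trapping eps0 r0 minF.
  by exists delta => // T s traj S0 sd t tT; have [] := H T s traj S0 sd t tT.
(* Any [eps] would serve, here 1: attraction uses only the confinement of the input. *)
have [delta d0 H] := trapping ltr01 r0 minF.
exists delta => // s traj S0 sd; have {}H := H _ _ traj S0 sd.
have [C C0 HC] := tracking_distance D.
apply/cvgrPdist_lt => eps eps0.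
pose q := eps / (4 * C); have q0 : 0 < q by rewrite divr_gt0 // mulr_gt0.
have qE : C * (q + q) = eps / 2 by rewrite /q; field; rewrite gt_eqF.
have [eta eta0 Heta] := near_zero_set (@ball_compact _ _ ubar r) continuous_sqn_gradF
  (fun u => sqn_ge0 (gF u)) q0.
have e2 : 0 < Num.min q eta by rewrite lt_min q0.
have [T0 T00 HT] := residual_cvg traj S0 e2.
exists T0; split; first exact: num_real.
move=> t /ltW Tt; have [] := HT t Tt; rewrite !lt_min => /andP[fe _] /andP[_ ge].
have dom : time_domain +oo%E t by split; [exact: le_trans (ltW T00) Tt | rewrite ltry].
have [_ ur] := H t dom.
have [u0 [u0r gu0 uu0]] := Heta _ ur ge.
have u0E : u0 = ubar by have [+ _] := Hr _ u0r; apply; apply: sqn_eq0; rewrite gu0.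
rewrite u0E in uu0.
have [_ Hd] := HC (s t) ubar (zero_mean_invariant D traj S0 dom).
rewrite distrC; apply: (le_lt_trans Hd).
apply: (@le_lt_trans _ _ (C * (q + q))); last by rewrite qE gtr_pMr // invf_lt1 // ltr1n.
by rewrite ler_pM2l //; apply: lerD; exact: ltW.
Qed.

End local_minimum.

Lemma zero_trackers_zero_mean (s : state R d n m) : zero_trackers s -> zero_mean_states s.
Proof.
case: s => [[[x u] w] z] /= [-> ->].
by rewrite big1 => [|i _]; rewrite ?submxrow0 // big1 // => i _; rewrite submxrow0.
Qed.

Lemma state_norm_bounded (T : \bar R) (s : R -> state R d n m) : trajectory g T s ->
  zero_mean_states (s 0) ->
  exists M : R, forall t, time_domain T t -> state_norm (s t) <= M.
Proof.
move=> traj S0; have [M HM] := trajectory_bounded D kw_ge1 a1_gt0 decrease traj S0.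
have [c c0 Hc] := state_norm_equiv; exists (c * M) => t /HM[sM _].
by apply: (le_trans (Hc _)); rewrite ler_pM2l.
Qed.

End conclusions.

(** * Uniform constants *)

Section euclidean_norm.
Variable R : realType.

Lemma norm_le_enorm k (v : 'rV[R]_k) : `|v| <= enorm v.
Proof. exact: le_sqrt (normr_ge0 _) (norm_sqn v). Qed.

(** The strict inequality forces [k0 >= 1], so [k <= k0 ^+ 2] and the constant needs no square
    root. *)
Lemma enorm_le k k0 (v : 'rV[R]_k) : (k < k0)%N -> enorm v <= k0%:R * `|v|.
Proof.
move=> kk0; have k1 : 1 <= k0%:R :> R by rewrite ler1n; case: k0 kk0.
have kv : 0 <= k0%:R * `|v| by rewrite mulr_ge0.
rewrite -[leRHS]ger0_norm // -sqrtr_sqr; apply: ler_wsqrtr.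
apply: (le_trans (sqn_le _)); rewrite exprMn; apply: ler_wpM2r; first exact: sqr_ge0.
have : k%:R <= k0%:R :> R by rewrite ler_nat ltnW.
by rewrite expr2; nra.
Qed.

Lemma enorm_lipW k k' k0 (v : 'rV[R]_k) (w : 'rV[R]_k') (L : R) : (k' < k0)%N -> 0 <= L ->
  enorm v <= L * enorm w -> `|v| <= k0%:R * L * `|w|.
Proof.
move=> kk0 L0 H; apply: (le_trans (norm_le_enorm v)); apply: (le_trans H).
by rewrite [_%:R * L]mulrC -mulrA; apply: ler_wpM2l => //; exact: enorm_le.
Qed.

Lemma row_mx_norm k k' (v : 'rV[R]_k) (w : 'rV[R]_k') : `|row_mx v w| <= `|v| + `|w|.
Proof.
apply: rV_norm_le => [|j]; first exact: addr_ge0.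
rewrite mxE; case: (fintype.split j) => l; apply: (le_trans (coord_norm_le _ _ _)).
  by rewrite lerDl.
by rewrite lerDr.
Qed.

Lemma rV_continuous (V : normedModType R) k (g : V -> 'rV[R]_k) :
  (forall j, continuous (fun x => g x 0 j)) -> continuous g.
Proof.
move=> gc x; apply/cvgrPdist_le => e e0.
have : \forall y \near x, forall j, `|g x 0 j - g y 0 j| <= e.
  apply: filter_forall => j; have /cvgrPdist_le := gc j x; exact.
apply: filterS => y H; apply: rV_norm_le => [|j]; first exact: ltW.
by rewrite !mxE.
Qed.

End euclidean_norm.

Section uniformity.
Variables (R : realType) (N d : nat) (n m : 'I_N -> nat).
Variable p : forall i, 'rV[R]_(n i) -> 'rV[R]_(m i) -> 'rV[R]_(n i).
Variable h : forall i, 'rV[R]_(m i) -> 'rV[R]_(n i).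
Variable f : forall i, 'rV[R]_(n i) -> 'rV[R]_d -> R.
Variable phi : forall i, 'rV[R]_(n i) -> 'rV[R]_d.
Variable E : rel 'I_N.
Variable a : 'I_N -> 'I_N -> R.

Lemma hstack_continuous : (forall i, continuous (@h i)) -> continuous (hstack h).
Proof.
move=> hc; apply: rV_continuous => j.
have -> : (fun u => hstack h u 0 j) = (fun u => h (submxrow u (tagnat.sig1 j)) 0 (tagnat.sig2 j)).
  by apply/funext => u; rewrite mxE.
move=> u.
apply: (@continuous_comp _ _ _ (fun u : 'rV[R]_(\sum_i m i) => submxrow u (tagnat.sig1 j))
  (fun v : 'rV[R]_(m (tagnat.sig1 j)) => h v 0 (tagnat.sig2 j))).
  exact: differentiable_continuous (differentiable_submxrow _ _).
apply: (@continuous_comp _ _ _ (@h (tagnat.sig1 j)) (fun v : 'rV[R]_(n (tagnat.sig1 j)) => v 0 (tagnat.sig2 j))).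
  exact: hc.
exact: coord_continuous.
Qed.

(** Each coordinate is a finite sum of products of the gradient of [Fsigma] with entries of
    [nabla h]. Here the continuity of the Jacobians enters; it makes the dissipation continuous, on
    which the Barbalat argument rests. *)
Lemma grad_Fsigmah_continuous : (forall i (u : 'rV[R]_(m i)), differentiable (@h i) u) ->
  (forall i, continuous (nabla (@h i))) ->
  (forall u, differentiable (Fsigmah h f phi) u) ->
  (forall i (xy : 'rV[R]_(n i) * 'rV[R]_d),
    differentiable (fun xy' : 'rV[R]_(n i) * 'rV[R]_d => f xy'.1 xy'.2) xy) ->
  (forall i (x : 'rV[R]_(n i)), differentiable (@phi i) x) ->
  continuous (grad (Fsigma f phi)) ->
  continuous (grad (Fsigmah h f phi)).
Proof.
move=> hd hC Fd fd phid gc.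
have hs : continuous (hstack h).
  by apply: hstack_continuous => i u; exact: differentiable_continuous (hd i u).
apply: rV_continuous => j.
have -> : (fun u => grad (Fsigmah h f phi) u 0 j) = (fun u =>
    \sum_k (submxrow (grad (Fsigma f phi) (hstack h u)) (tagnat.sig1 j)) 0 k *
      nabla (@h (tagnat.sig1 j)) (submxrow u (tagnat.sig1 j)) (tagnat.sig2 j) k).
  apply/funext => u; rewrite (grad_Fsigmah fd phid hd (Fd u)) mxE mxE.
  by apply: eq_bigr => k _; congr (_ * _); rewrite mxE.
apply: continuous_sum => k u; apply: continuousM.
  have -> : (fun u => submxrow (grad (Fsigma f phi) (hstack h u)) (tagnat.sig1 j) 0 k) =
      (fun x : 'rV[R]_(\sum_i n i) => x 0 (tagnat.Rank (tagnat.sig1 j) k)) \o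
      grad (Fsigma f phi) \o hstack h.
    by apply/funext => v; rewrite mxE.
  apply: continuous_comp; first exact: hs.
  apply: continuous_comp; [exact: gc | exact: coord_continuous].
apply: (@continuous_comp _ _ _ (fun u : 'rV[R]_(\sum_i m i) => submxrow u (tagnat.sig1 j))
  (fun v : 'rV[R]_(m (tagnat.sig1 j)) => nabla (@h (tagnat.sig1 j)) v (tagnat.sig2 j) k)).
  exact: differentiable_continuous (differentiable_submxrow _ _).
apply: (@continuous_comp _ _ _ (nabla (@h (tagnat.sig1 j)))
  (fun M : 'M[R]_(m (tagnat.sig1 j), n (tagnat.sig1 j)) => M (tagnat.sig2 j) k)).
  exact: hC.
exact: coord_continuous.
Qed.

Lemma agent_lyapunov (k0 : nat) : (forall i, (n i < k0)%N) -> (forall i, (m i < k0)%N) ->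
  plant_assumption p h ->
  exists (V : forall i, 'rV[R]_(n i) -> 'rV[R]_(m i) -> R) (kappa C : R),
  [/\ 0 < kappa, 0 < C,
      forall i (x : 'rV[R]_(n i)) (u : 'rV[R]_(m i)),
        `|x - h u| <= V i x u <= C * `|x - h u|,
      forall i (x x' : 'rV[R]_(n i)) (u u' : 'rV[R]_(m i)),
        `|V i x u - V i x' u'| <= C * (`|x - x'| + `|u - u'|) &
      forall i (x : 'rV[R]_(n i)) (u : 'rV[R]_(m i)) (eta : R), 0 < eta ->
        \forall s \near (0 : R)^'+, V i (x + s *: p x u) u <= V i x u + (- kappa * V i x u + eta) * s].
Proof.
move=> nk mk [stab [Lh [Lp [Lh0 Lp0 lip]]]].
have k00 : 0 <= k0%:R :> R by [].
pose L := 1 + k0%:R * (Lh + Lp).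
have L1 : 1 <= L by rewrite lerDl mulr_ge0 // addr_ge0 // ltW.
have hlip i u u' : `|@h i u - h u'| <= L * `|u - u'|.
  have [H _ _] := lip i 0 0 u u'; apply: (le_trans (enorm_lipW (mk i) (ltW Lh0) H)).
  by apply: ler_wpM2r => //; have := mulr_ge0 k00 (ltW Lp0); rewrite /L; lra.
have pxlip i x x' u : `|@p i x u - p x' u| <= L * `|x - x'|.
  have [_ H _] := lip i x x' u u; apply: (le_trans (enorm_lipW (nk i) (ltW Lp0) H)).
  by apply: ler_wpM2r => //; have := mulr_ge0 k00 (ltW Lh0); rewrite /L; lra.
have pulip i x u u' : `|@p i x u - p x u'| <= L * `|u - u'|.
  have [_ _ H] := lip i x x u u'; apply: (le_trans (enorm_lipW (mk i) (ltW Lp0) H)).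
  by apply: ler_wpM2r => //; have := mulr_ge0 k00 (ltW Lh0); rewrite /L; lra.
have H i : exists VkC : ('rV[R]_(n i) -> 'rV[R]_(m i) -> R) * R * R,
  [/\ 0 < VkC.1.2, 0 < VkC.2,
      forall x u, `|x - h u| <= VkC.1.1 x u <= VkC.2 * `|x - h u|,
      forall x u x' u', `|VkC.1.1 x u - VkC.1.1 x' u'| <= VkC.2 * (`|x - x'| + `|u - u'|) &
      forall x u (eta : R), 0 < eta -> \forall s \near (0 : R)^'+,
        VkC.1.1 (x + s *: p x u) u <= VkC.1.1 x u + (- VkC.1.2 * VkC.1.1 x u + eta) * s].
  have [d1 [d2 [d10 d20 st]]] := stab i.
  have kp : 0 < k0%:R :> R by rewrite ltr0n; exact: leq_ltn_trans (nk i).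
  have stable u (X : R -> 'rV[R]_(n i)) : trajectory (fun x => p x u) +oo%E X ->
      forall t, 0 <= t -> `|X t - h u| <= (k0%:R * d1) * `|X 0 - h u| * expR (- d2 * t).
    move=> traj t t0; have [_ /(_ X traj t t0) Ht] := st u.
    apply: (le_trans (norm_le_enorm _)); apply: (le_trans Ht).
    apply: ler_wpM2r; first exact: expR_ge0.
    by rewrite [_%:R * d1]mulrC -mulrA; apply: ler_wpM2l; [exact: ltW | exact: enorm_le].
  have [V [kap [C HV]]] := converse_lyapunov L1 (mulr_gt0 kp d10) d20
    (@pxlip i) (@pulip i) (@hlip i) stable.
  by exists (V, kap, C).
pose V i := (sval (cid (H i))).1.1; pose kap i := (sval (cid (H i))).1.2.
pose C i := (sval (cid (H i))).2.
have kap0 i : 0 < kap i by have [] := svalP (cid (H i)).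
have C0 i : 0 < C i by have [] := svalP (cid (H i)).
pose S := 1 + \sum_i (kap i)^-1; pose T := 1 + \sum_i C i.
have S0 : 0 < S by rewrite ltr_pwDl // sumr_ge0 // => i _; rewrite invr_ge0 ltW.
have T0 : 0 < T by rewrite ltr_pwDl // sumr_ge0 // => i _; exact: ltW.
have CT i : C i <= T.
  rewrite /T (bigD1 i) //= addrCA lerDl addr_ge0 // sumr_ge0 // => j _; exact: ltW.
have Sk i : S^-1 <= kap i.
  rewrite -[leRHS]invrK lef_pV2 ?posrE ?invr_gt0 //.
  by rewrite /S (bigD1 i) //= addrCA lerDl addr_ge0 // sumr_ge0 // => j _; rewrite invr_ge0 ltW.
have V1 i x u : `|x - h u| <= V i x u <= C i * `|x - h u|.
  by have [_ _ + _ _] := svalP (cid (H i)); exact.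
have V2 i x u x' u' : `|V i x u - V i x' u'| <= C i * (`|x - x'| + `|u - u'|).
  by have [_ _ _ + _] := svalP (cid (H i)); exact.
have V3 i x u (eta : R) : 0 < eta -> \forall s \near (0 : R)^'+,
    V i (x + s *: p x u) u <= V i x u + (- kap i * V i x u + eta) * s.
  by have [_ _ _ _ +] := svalP (cid (H i)); exact.
exists V, S^-1, T; split => //; first by rewrite invr_gt0.
- move=> i x u; have /andP[-> H2] := V1 i x u; apply: (le_trans H2); exact: ler_wpM2r.
- by move=> i x x' u u'; apply: (le_trans (V2 i x u x' u')); apply: ler_wpM2r => //; exact: addr_ge0.
move=> i x u eta eta0; apply: filterS2 (nbhs_right_gt 0) (V3 i x u eta eta0) => s s0 H3.
apply: (le_trans H3); rewrite lerD2l; apply: ler_wpM2r; first exact: ltW.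
rewrite lerD2r !mulNr lerN2; apply: ler_wpM2r => //.
by have /andP[+ _] := V1 i x u; apply: le_trans.
Qed.

Lemma uniform_constants : (0 < N)%N -> steady_state_C1 h -> plant_assumption p h ->
  cost_assumption h f phi -> network_assumption E a ->
  exists (V : forall i, 'rV[R]_(n i) -> 'rV[R]_(m i) -> R) (K kappa lambda CL : R),
    uniform_data p h f phi E a V K kappa lambda CL.
Proof.
move=> N0 hC1 A1 A2 A3.
(* Larger than every dimension that occurs, so one factor converts all Euclidean Lipschitz bounds to
   the max norm. *)
pose k0 := (\sum_i n i + \sum_i m i + d).+1.
have ni i : (n i <= \sum_j n j)%N by rewrite (bigD1 i) //= leq_addr.
have mi i : (m i <= \sum_j m j)%N by rewrite (bigD1 i) //= leq_addr.
have nk i : (n i < k0)%N by have := ni i; rewrite /k0; lia.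
have mk i : (m i < k0)%N by have := mi i; rewrite /k0; lia.
have ndk i : (n i + d < k0)%N by have := ni i; rewrite /k0; lia.
have nsk : (\sum_i n i < k0)%N by rewrite /k0; lia.
have [V [kappa [C [kap0 C0 V1 V2 V3]]]] := agent_lyapunov nk mk A1.
have [_ [Lh [Lp [Lh0 Lp0 lip]]]] := A1.
have [Frad Fd fd [L0 [L1 [L2 [L00 L10 L20 gFlip glip]]]] [phid [L3 L30 philip]]] := A2.
have [lambda lam0 gapH] := spectral_gap A3.
have [CL CL0 lap] := @laplacian_bounded R N d a.
pose B : R := k0%:R; have B0 : 0 <= B by [].
have P0 := mulr_ge0 B0 (ltW Lh0); have P1 := mulr_ge0 B0 (ltW Lp0).
have P2 := mulr_ge0 B0 (ltW L00); have P3 := mulr_ge0 B0 (ltW L10).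
have P4 := mulr_ge0 B0 (ltW L20); have P5 := mulr_ge0 B0 (ltW L30).
pose K := 1 + B * (Lh + Lp + L0 + L1 + L2 + L3) + C.
have gK : continuous (grad (Fsigma f phi)).
  apply: (@lipschitz_continuous _ _ _ _ (B * L0)) => x x'.
  exact: enorm_lipW nsk (ltW L00) (gFlip x x').
have two k k' (L : R) (v : 'rV[R]_k) (w : 'rV[R]_k') q (z : 'rV[R]_q) : 0 <= L ->
    (k + k' < k0)%N -> B * L <= K -> enorm z <= L * enorm (row_mx v w) ->
    `|z| <= K * (`|v| + `|w|).
  move=> L0' kk LK H; apply: (le_trans (enorm_lipW kk L0' H)).
  have BL : 0 <= B * L by rewrite mulr_ge0.
  apply: (@le_trans _ _ (B * L * (`|v| + `|w|))); first by apply: ler_wpM2l => //; exact: row_mx_norm.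
  by apply: ler_wpM2r => //; exact: addr_ge0.
exists V, K, kappa, lambda, CL; split => //.
- by rewrite /K; lra.
- move=> i u u'; have [H _ _] := lip i 0 0 u u'; apply: (le_trans (enorm_lipW (mk i) (ltW Lh0) H)).
  by apply: ler_wpM2r => //; rewrite -/B /K; lra.
- move=> i x x' u; have [_ H _] := lip i x x' u u; apply: (le_trans (enorm_lipW (nk i) (ltW Lp0) H)).
  by apply: ler_wpM2r => //; rewrite -/B /K; lra.
- by move=> i u; case: A1 => /(_ i)[d1 [d2 [_ _ /(_ u)[]]]].
- move=> i x x'; apply: (le_trans (enorm_lipW (nk i) (ltW L30) (philip i x x'))).
  by apply: ler_wpM2r => //; rewrite -/B /K; lra.
- move=> i x x' y y'; have [H _] := glip i x x' y y'.
  by apply: (two _ _ L1 _ _ _ _ (ltW L10) (ndk i) _ H); rewrite /K; lra.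
- move=> i x x' y y'; have [_ H] := glip i x x' y y'.
  by apply: (two _ _ L2 _ _ _ _ (ltW L20) (ndk i) _ H); rewrite /K; lra.
- move=> x x'; apply: (le_trans (enorm_lipW nsk (ltW L00) (gFlip x x'))).
  by apply: ler_wpM2r => //; rewrite -/B /K; lra.
- move=> i x u; have /andP[-> H] := V1 i x u; apply: (le_trans H).
  by apply: ler_wpM2r => //; rewrite /K; lra.
- move=> i x x' u u'; apply: (le_trans (V2 i x x' u u')).
  by apply: ler_wpM2r; [exact: addr_ge0 | rewrite /K; lra].
- by case: A3.
- by move=> i j ij; case: A3 => /(_ i j)[_ /(_ ij)].
- by move=> i u; have [] := hC1 i.
- apply: grad_Fsigmah_continuous => // i; first by move=> u; have [] := hC1 i.
  by have [] := hC1 i.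
Qed.

End uniformity.

Theorem mainTheorem1 (R : realType) (N d : nat) (n m : 'I_N -> nat)
    (p : forall i, 'rV[R]_(n i) -> 'rV[R]_(m i) -> 'rV[R]_(n i))
    (h : forall i, 'rV[R]_(m i) -> 'rV[R]_(n i))
    (f : forall i, 'rV[R]_(n i) -> 'rV[R]_d -> R)
    (phi : forall i, 'rV[R]_(n i) -> 'rV[R]_d)
    (E : rel 'I_N) (a : 'I_N -> 'I_N -> R)
    (N_gt0 : (0 < N)%N)
    (h_C1 : steady_state_C1 h)
    (A1 : plant_assumption p h)
    (A2 : cost_assumption h f phi)
    (A3 : network_assumption E a) :
  exists alpha1bar alpha2bar : R,
    [/\ 0 < alpha1bar, 0 < alpha2bar &
     forall alpha1 alpha2 : R,
       0 < alpha1 < alpha1bar -> 0 < alpha2 < alpha2bar ->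
       let g := closed_loop p h f phi E a alpha1 alpha2 in
       (forall (T : \bar R) (s : R -> state R d n m),
          trajectory g T s -> zero_trackers (s 0) ->
          (exists M : R, forall t, time_domain T t -> state_norm (s t) <= M) /\
          (T = +oo%E ->
           state_dist (target h f phi) (shifted f phi (s t))
             @[t --> +oo] --> 0%E)) /\
       (forall ubar : 'rV[R]_(\sum_i m i),
          isolated_stationary_point h f phi ubar ->
          local_minimum h f phi ubar ->
          locally_asymptotically_stable_on
            (@zero_mean_states R N d n m) g
            (tracking_equilibrium h f phi ubar))].
Proof.
have [V [K [kappa [lambda [CL D]]]]] := uniform_constants N_gt0 h_C1 A1 A2 A3.
have [kw [a1 [a2 [kw1 a10 a20 dec]]]] := lyapunov_decrease D.
exists a1, a2; split => // alpha1 alpha2 al1 al2 g.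
have {}dec := dec alpha1 alpha2 al1 al2.
move: al1 al2 => /andP[al1 _] /andP[al2 _].
split=> [T s traj /zero_trackers_zero_mean S0 | ubar iso lmin].
  split; first exact: (state_norm_bounded D kw1 al1 dec traj S0).
  by move=> TE; rewrite TE in traj; exact: (target_distance_cvg D kw1 al1 al2 dec traj S0).
exact: (locally_asymptotically_stable D kw1 al1 al2 dec iso lmin).
Qed.
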